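(* Let $r\geq 1$ be an integer and let $p>\max\{\frac{4}{r},2\}$. For $\mathbf{b}=(b_1,\ldots,b_r)\in\mathbb{R}^r$ and $N>1$, let $$\mathbf{J}_{\mathbf{b},N}:=\{\xi=(n_1,\ldots,n_r)\in\mathbb{Z}^r:\ b_i\leq n_i\leq b_i+N,\ i=1,\ldots,r\}.$$ Then for every $(a_\xi)\in \ell^2(\mathbb{Z}^r)$, $$\left\|\sum_{\xi\in\mathbf{J}_{\mathbf{b},N}}a_\xi e^{-it|\xi|^2}\right\|_{L^p_t([0,2\pi])}\lesssim N^{\frac{r}{2}-\frac{2}{p}}\|a_\xi\|_{\ell^2(\mathbb{Z}^r)},$$ with the implicit constant independent of $\mathbf{b}$.
   Context: $|\xi|^2=n_1^2+\cdots+n_r^2$. $A\lesssim B$ means $A\le CB$ for a positive constant $C$; here $C$ depends only on $r$ and $p$ (not on $\mathbf{b}$, $N$ or $(a_\xi)$). *)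

(* Defs.v *)
From HB Require Import structures.
From mathcomp Require Import all_boot all_order all_algebra.
From mathcomp Require Import complex.
From mathcomp Require Import all_classical all_reals all_analysis.
From mathcomp Require Import zify lra.

Set Implicit Arguments.
Unset Strict Implicit.
Unset Printing Implicit Defensive.
Import Order.TTheory GRing.Theory Num.Theory.
Import numFieldNormedType.Exports.

Local Open Scope classical_set_scope.
Local Open Scope ring_scope.
Local Open Scope complex_scope.

Section ExponentialSums.
Context {R : realType}.

(* exp(i x), by Euler's formula. *)
Definition expi (x : R) : R[i] := cos x +i* sin x.

Definition normsq r (xi : 'rV[int]_r) : int := \sum_(i < r) xi 0 i ^+ 2.

Definition Jbox r (b : 'rV[R]_r) (N : R) : set 'rV[int]_r :=
  [set xi | forall i, b 0 i <= (xi 0 i)%:~R <= b 0 i + N].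

(* By finite_Jbox below, the summation over \in is a genuine finite sum. *)
Definition expsum r (a : 'rV[int]_r -> R[i]) (b : 'rV[R]_r) (N t : R) : R[i] :=
  \sum_(xi \in Jbox b N) a xi * expi (- (t * (normsq xi)%:~R)).

(* The modulus is Normc.normc : R[i] -> R because `|z| has type R[i]. *)
Definition l2norm r (a : 'rV[int]_r -> R[i]) : \bar R :=
  ((\esum_(xi in [set: 'rV[int]_r]) (Normc.normc (a xi) ^+ 2)%:E) `^ 2^-1)%E.

Definition leb02pi : {measure set (measurableTypeR R) -> \bar R} :=
  mrestr lebesgue_measure (measurable_itv `[(0 : R), 2 * pi]).

Definition LpNorm02pi (p : R) (f : R -> R[i]) : \bar R :=
  Lnorm leb02pi p%:E (fun t => (Normc.normc (f t))%:E).

Lemma finite_Jbox r (b : 'rV[R]_r) (N : R) : finite_set (Jbox b N).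
Proof.
pose M : R := \sum_(i < r) (`|b 0 i| + `|b 0 i + N|).
pose K := Num.truncn M.
pose dec (u : 'rV['I_(K + K).+1]_r) : 'rV[int]_r :=
  \row_i ((u 0 i)%:Z - K%:Z).
apply: (@sub_finite_set _ _ (dec @` setT)); last first.
  exact/finite_image/finite_finset.
move=> xi Jxi.
have bd (i : 'I_r) : (absz (xi 0%R i) <= K)%N.
  have h : `|(xi 0 i)%:~R| <= M :> R.
    rewrite /M (bigD1 i)//=; apply: (@le_trans _ _ (`|b 0 i| + `|b 0 i + N|)).
      have /andP[h1 h2] := Jxi i.
      move: (ler_norm (b 0 i + N)) (ler_norm (- b 0 i)) h1 h2.
      rewrite normrN ler_norml => ? ? ? ?.
      have := normr_ge0 (b 0 i); have := normr_ge0 (b 0 i + N) => ? ?.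
      by apply/andP; split; lra.
    by rewrite lerDl sumr_ge0// => j _; rewrite addr_ge0.
  rewrite /K -ltnS -(ltr_nat R); apply: le_lt_trans (truncnS_gt M).
  by rewrite natr_absz intr_norm.
exists (\row_i inord (absz (xi 0 i + K%:Z))) => //.
by apply/rowP => i; rewrite !mxE inordK; have := bd i; lia.
Qed.

End ExponentialSums.

(* Main.v *)
(** The case of two squares is the heart: for [r = 1] one squares the sum and uses [p / 2 > 2],
    and for [r >= 3] the extra [r - 2] coordinates only multiply the kernel by at most [L ^ (r -
    2)], where [L ~ N] is the number of integers in an interval.

    Sampling at [t + 2 pi j / M], [j < M], with [M] larger than all differences of frequencies,
    turns the integral into an average of finite sums over the grid, since a translation in [t]
    only changes the phases of the coefficients. It remains to count the set [E] of those [j]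
    where the sum has modulus at least [eta^(1/2)] times its trivial bound [L ^ (r / 2) ||a||];
    one needs [#E <= C (M / L^2) eta^(- 1 - kappa)] for every [kappa > 0].

    For [eta <= C L^(-1/4)] this follows from orthogonality, because a circle carries at most [C
    L^eps] lattice points of a box of side [L], uniformly in the position of the box.

    For larger [eta] one follows Bourgain's argument for the squares: by duality [eta L^2
    (#E)^2] is at most the sum over [E * E] of the kernel, and by Weyl differencing the kernel
    at [t] is at most [C L^2 u^(th - 1)], where [u = q + L^2 |2 q t - a|] for a Diophantine
    approximation [a / q] of [2 t]. Counting the pairs of [E] with [u <= U] by means of the
    Fejer kernel produces the Fourier coefficients of [E] at [2 q k], [q <= U]. The frequency
    [0] is harmless in this range of [eta], and the other ones are weighted by the number of
    divisors of the frequency that are at most [U], all of whose moments are [O(U^eps)] on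
    average. *)

Require Import Defs.
From mathcomp Require Import all_boot all_order all_algebra.
From mathcomp Require Import complex.
From mathcomp Require Import all_classical all_reals all_analysis measurable_realfun.
From mathcomp Require Import zify ring lra.

Set Implicit Arguments.
Unset Strict Implicit.
Unset Printing Implicit Defensive.
Import Order.TTheory GRing.Theory Num.Theory.
Import numFieldNormedType.Exports.

(** * The divisor function *)

(** The statement leaves no room for an [L^eps], so every loss must be a small power of [1 / eta].
    For [eta] below a constant times [L^(-1/4)] this is automatic, since [L^(kappa / 4)] is then
    [O(eta^(- kappa))]. For larger [eta] the losses are small powers of a cutoff [Q] on [u], chosen
    so that the pairs with [u > Q] account for at most half of the left side; [Q] is a power of
    [1 / eta] up to a constant, and the lower bound on [eta] keeps it small against [L]. The
    exponent [1 + kappa < p / 2] makes the level sets summable over dyadic [eta]. The modulus [M]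
    exceeds the differences of frequencies and therefore depends on [b]. This is harmless, because
    [M] enters only through the factor [M / L^2] and the mesh [2 pi / M] cancels it; the remaining
    [L^(-2)] is the source of [N^(- 2 / p)]. *)

Definition numdiv (m : nat) : nat := size (divisors m).

Definition truncdiv (U l : nat) : nat := count (fun q => q %| l) (iota 1 U).

Lemma dvdnM_split (a b e : nat) : 0 < a -> e %| a * b ->
  exists x y, [/\ x %| a, y %| b & e = x * y].
Proof.
move=> a0 eab; exists (gcdn e a), (e %/ gcdn e a).
have g0 : 0 < gcdn e a by rewrite gcdn_gt0 a0 orbT.
split; first exact: dvdn_gcdr.
  have co : coprime (e %/ gcdn e a) (a %/ gcdn e a).
    rewrite /coprime -(eqn_pmul2r g0) muln_gcdl !divnK ?dvdn_gcdl ?dvdn_gcdr //.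
    by rewrite mul1n.
  rewrite -(Gauss_dvdr _ co) -(@dvdn_pmul2r (gcdn e a)) // divnK ?dvdn_gcdl //.
  by rewrite mulnAC divnK ?dvdn_gcdr.
by rewrite mulnC divnK ?dvdn_gcdl.
Qed.

(** Products of a divisor of [a] and a divisor of [b] cover the divisors of [a * b], with
    repetitions when [a] and [b] share a factor. *)
Lemma numdivM (a b : nat) : 0 < a -> 0 < b ->
  numdiv (a * b) <= numdiv a * numdiv b.
Proof.
move=> a0 b0; rewrite /numdiv -(size_allpairs muln).
apply: uniq_leq_size; first exact: divisors_uniq.
move=> e; rewrite -dvdn_divisors ?muln_gt0 ?a0 // => /(dvdnM_split a0)[x [y [xa yb ->]]].
by apply: allpairs_f; rewrite -dvdn_divisors.
Qed.

Lemma truncdivM (U a b : nat) : 0 < a ->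
  truncdiv U (a * b) <= numdiv a * truncdiv U b.
Proof.
move=> a0; rewrite /truncdiv -!size_filter /numdiv -(size_allpairs muln).
apply: uniq_leq_size; first by rewrite filter_uniq // iota_uniq.
move=> e; rewrite mem_filter mem_iota => /andP[/(dvdnM_split a0)[x [y [xa yb exy]]] eU].
rewrite exy; apply: allpairs_f; rewrite -?dvdn_divisors //.
rewrite mem_filter yb mem_iota /=; move: eU; rewrite exy; nia.
Qed.

Lemma truncdivE (U l : nat) : truncdiv U l = \sum_(1 <= q < U.+1) (q %| l).
Proof. by rewrite /truncdiv -sum1_count big_mkcond /index_iota subn1 /=; apply: eq_bigr => i _; case: ifP. Qed.

Lemma numdiv_pexp (p e : nat) : prime p -> numdiv (p ^ e) <= e.+1.
Proof.
move=> pp; rewrite /numdiv -[e.+1](size_iota 0) -[size (iota _ _)](size_map (fun i => p ^ i)).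
apply: uniq_leq_size; first exact: divisors_uniq.
move=> d; rewrite -dvdn_divisors ?expn_gt0 ?prime_gt0 // => /(dvdn_pfactor _ _ pp)[m me ->].
by apply: (map_f (fun i => p ^ i)); rewrite mem_iota.
Qed.


Lemma expn_exponent_le (k : nat) : exists2 C, 0 < C & forall e, e.+1 ^ k <= C * 2 ^ e.
Proof.
elim: k => [|k [C C0 IH]].
  by exists 1 => // e; rewrite expn0 mul1n expn_gt0.
(* (e+1)^(k+1) <= 2^(k+1) ((e/2)+1)^(k+1), and (e./2).+1 <= 2^(e./2) *)
exists (C ^ 2 * 2 ^ k.+1) => [|e]; first by rewrite muln_gt0 !expn_gt0 C0.
have h1 : e.+1 <= 2 * (e./2).+1 by lia.
have h2 : (e./2).+1 <= 2 ^ e./2 by apply: ltn_expl.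
have h3 := IH e./2.
have h4 : e.+1 ^ k.+1 <= 2 ^ k.+1 * ((e./2).+1 ^ k * (e./2).+1).
  by rewrite -expnSr -expnMn leq_exp2r.
have h5 : 2 ^ e./2 * 2 ^ e./2 <= 2 ^ e by rewrite -expnD leq_exp2l //; lia.
apply: (leq_trans h4); rewrite [C ^ 2 * _]mulnC -mulnA leq_mul2l; apply/orP; right.
apply: (leq_trans (leq_mul h3 h2)); rewrite -mulnA; apply: leq_mul => //.
by rewrite expnS expn1 leq_pmulr.
Qed.

Lemma leq_expl (m n e : nat) : m <= n -> m ^ e <= n ^ e.
Proof. by case: e => // e; rewrite leq_exp2r. Qed.

(** The divisor bound [numdiv m = O(m^(1 / k))]. A prime [p >= 2^k] costs nothing, as
    [(e + 1)^k <= 2^(e k) <= p^e]; each of the fewer than [2^k] smaller primes costs one factor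
    [C]. *)
Lemma numdiv_exp_le (k : nat) :
  exists2 C, 0 < C & forall m, 0 < m -> numdiv m ^ k <= C * m.
Proof.
have [C C0 HC] := expn_exponent_le k.
exists (C ^ (2 ^ k)) => [|m m0]; first by rewrite expn_gt0 C0.
have key (s : seq (nat * nat)) : (forall pe, pe \in s -> prime pe.1) ->
    numdiv (\prod_(pe <- s) pe.1 ^ pe.2) ^ k <=
    (\prod_(pe <- s | pe.1 < 2 ^ k) C) * \prod_(pe <- s) pe.1 ^ pe.2.
  elim: s => [|[p e] s IH] ps; first by rewrite !big_nil /numdiv /= exp1n.
  have ps' pe : pe \in s -> prime pe.1 by move=> h; apply: ps; rewrite inE h orbT.
  have pp : prime p by apply: (ps (p, e)); rewrite inE eqxx.
  rewrite !big_cons /=.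
  have P0 : 0 < \prod_(j <- s) j.1 ^ j.2.
    rewrite big_seq; elim/big_ind : _ => // [x y x0 y0|j js]; first by rewrite muln_gt0 x0.
    by rewrite expn_gt0 prime_gt0 ?ps'.
  have pe0 : 0 < p ^ e by rewrite expn_gt0 prime_gt0.
  have h1 : numdiv (p ^ e * \prod_(j <- s) j.1 ^ j.2) ^ k <=
     e.+1 ^ k * numdiv (\prod_(j <- s) j.1 ^ j.2) ^ k.
    rewrite -expnMn; apply: leq_expl; apply: (leq_trans (numdivM pe0 P0)).
    by rewrite leq_mul2r numdiv_pexp // orbT.
  apply: (leq_trans h1).
  case: ifP => hp.
    rewrite mulnACA; apply: leq_mul; last exact: IH.
    apply: (leq_trans (HC e)); rewrite leq_mul2l; apply/orP; right.
    exact/leq_expl/prime_gt1.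
  rewrite mulnCA; apply: leq_mul; last exact: IH.
  have hp' : 2 ^ k <= p by rewrite leqNgt hp.
  have : e.+1 ^ k <= (2 ^ e) ^ k by apply/leq_expl/ltn_expl.
  by move/leq_trans; apply; rewrite -expnM mulnC expnM; apply: leq_expl.
have := key (prime_decomp m).
rewrite -(prod_prime_decomp m0) => /(_ _)/leq_trans; apply.
  by move=> [p e] /mem_prime_decomp[].
rewrite leq_mul2r; apply/orP; right.
rewrite big_const_seq iter_muln_1 leq_pexp2l //.
have -> : count (fun i => i.1 < 2 ^ k) (prime_decomp m) = count (fun i => i < 2 ^ k) (primes m).
  by rewrite /primes count_map.
rewrite -size_filter -[leqRHS](size_iota 0); apply: uniq_leq_size.
  by rewrite filter_uniq ?primes_uniq.
by move=> x; rewrite mem_filter mem_iota => /andP[].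
Qed.

Lemma sum_multiples (V : nmodType) (F : nat -> V) (q X : nat) : 0 < q ->
  (\sum_(1 <= l < X.+1 | (q %| l)%N) F l = \sum_(1 <= l < (X %/ q)%N.+1) F (q * l)%N)%R.
Proof.
move=> q0; elim: X => [|X IH]; first by rewrite div0n !big_geq.
rewrite big_mkcond big_nat_recr //= -big_mkcond IH divnS //; case: (boolP (q %| X.+1)) => h.
  rewrite add1n [RHS]big_nat_recr //=; congr (_ + F _)%R.
  have := divnS X q0; rewrite h add1n => <-.
  by rewrite mulnC divnK.
by rewrite GRing.addr0 add0n.
Qed.

(* Peel one factor [truncdiv U l = sum of (q %| l)] off the power and write [l = q * l']. *)
Lemma truncdiv_momentS (U B X : nat) :
  \sum_(1 <= l < X.+1) truncdiv U l ^ B.+1 <=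
  \sum_(1 <= q < U.+1) numdiv q ^ B * \sum_(1 <= l < (X %/ q).+1) truncdiv U l ^ B.
Proof.
under eq_bigr => l _ do rewrite expnSr {2}truncdivE big_distrr /=.
rewrite exchange_big /=.
rewrite big_nat [leqRHS]big_nat; apply: leq_sum => q /andP[q0 qU].
have -> : \sum_(1 <= l < X.+1) truncdiv U l ^ B * (q %| l) =
    \sum_(1 <= l < X.+1 | q %| l) truncdiv U l ^ B.
  rewrite [RHS]big_mkcond; apply: eq_bigr => l _.
  by case: (q %| l); rewrite ?muln1 ?muln0.
rewrite (sum_multiples (fun l => truncdiv U l ^ B)) // big_distrr /=.
by apply: leq_sum => l _; rewrite -expnMn; apply/leq_expl/truncdivM.
Qed.

Local Open Scope ring_scope.

(** * Lattice points on circles *)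

Lemma PoszX (n k : nat) : (n ^ k)%N%:Z = n%:Z ^+ k.
Proof. by elim: k => // k IH; rewrite expnS exprS PoszM IH. Qed.

Lemma card_le_fibers (T : finType) (K : eqType) (key : T -> K) (s : seq K)
    (A : {set T}) (B : nat) :
  uniq s -> {in A, forall p, key p \in s} ->
  (forall v, #|[set p in A | key p == v]| <= B)%N -> (#|A| <= size s * B)%N.
Proof.
move=> us ks hB.
have -> : #|A| = (\sum_(v <- s) #|[set p in A | key p == v]|)%N.
  under eq_bigr => v _ do rewrite -sum1_card big_mkcond /=.
  rewrite exchange_big /= -sum1_card big_mkcond /=; apply: eq_bigr => p _.
  under eq_bigr => v _ do rewrite inE.
  case: (boolP (p \in A)) => pA /=; last by rewrite big1.
  rewrite -big_mkcond /= sum1_count (eq_count (a2 := pred1 (key p))); last first.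
    by move=> v; rewrite /= eq_sym.
  by rewrite count_uniq_mem // ks.
apply: leq_trans (leq_sum _ (fun v _ => hB v)) _.
by rewrite big_const_seq count_predT iter_addn_0 mulnC.
Qed.

Lemma numdiv_dvd (m n : nat) : (0 < n)%N -> (m %| n)%N -> (numdiv m <= numdiv n)%N.
Proof.
move=> n0 mn; apply: uniq_leq_size; first exact: divisors_uniq.
have m0 : (0 < m)%N by case: m mn => //; rewrite dvd0n; case: n n0.
by move=> d; rewrite -!dvdn_divisors // => /dvdn_trans; apply.
Qed.

(** The formula [abc = 4 R * area], squared, with [k = R^2] and a determinant equal to twice the
    area. It rests on [2 P.u = - |u|^2] for a chord [u] issued from the point [P] of the circle. *)
Lemma chord_area (x1 y1 x2 y2 x3 y3 k : int) :
  x1 ^+ 2 + y1 ^+ 2 = k -> x2 ^+ 2 + y2 ^+ 2 = k -> x3 ^+ 2 + y3 ^+ 2 = k ->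
  4 * k * ((x2 - x1) * (y3 - y1) - (x3 - x1) * (y2 - y1)) ^+ 2 =
  ((x2 - x1) ^+ 2 + (y2 - y1) ^+ 2) * ((x3 - x1) ^+ 2 + (y3 - y1) ^+ 2) *
  ((x3 - x2) ^+ 2 + (y3 - y2) ^+ 2).
Proof.
move=> h1 h2 h3.
pose u := x2 - x1; pose u' := y2 - y1; pose v := x3 - x1; pose v' := y3 - y1.
have hu : 2 * (x1 * u + y1 * u') = - (u ^+ 2 + u' ^+ 2).
  by apply/eqP; rewrite -subr_eq0; apply/eqP; rewrite -[RHS](subrr k) -{1}h2 -h1 /u /u'; ring.
have hv : 2 * (x1 * v + y1 * v') = - (v ^+ 2 + v' ^+ 2).
  by apply/eqP; rewrite -subr_eq0; apply/eqP; rewrite -[RHS](subrr k) -{1}h3 -h1 /v /v'; ring.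
transitivity ((2 * (x1 * u + y1 * u') * v - 2 * (x1 * v + y1 * v') * u) ^+ 2 +
              (2 * (x1 * u + y1 * u') * v' - 2 * (x1 * v + y1 * v') * u') ^+ 2).
  by rewrite -h1 /u /u' /v /v'; ring.
by rewrite hu hv /u /u' /v /v'; ring.
Qed.

(* On the circle, a point is recovered from its cross and dot products with a fixed point. *)
Lemma circle_fiber_card (T : finType) (x y : T -> int) (A : {set T}) (k : int) (p1 : T) :
  (forall p q, p \in A -> q \in A -> x p = x q -> y p = y q -> p = q) -> 0 < k ->
  (forall p, p \in A -> x p ^+ 2 + y p ^+ 2 = k) -> p1 \in A ->
  (forall p, p \in A -> (k %| 2 * (x p * y p1 - x p1 * y p))%Z) ->
  (#|A| <= 10)%N.
Proof.
move=> inj k0 hA p1A hd.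
pose c p : int := x p * y p1 - x p1 * y p; pose e p : int := x p * x p1 + y p * y p1.
have ce p : p \in A -> c p ^+ 2 + e p ^+ 2 = k ^+ 2.
  move=> pA; transitivity ((x p ^+ 2 + y p ^+ 2) * (x p1 ^+ 2 + y p1 ^+ 2)).
    by rewrite /c /e; ring.
  by rewrite !hA.
(* Since [c^2 + e^2 = k^2] and [k] divides [2 c], the quotient [2 c / k] lies in [[-2, 2]] and is
   shifted by [2] into ['I_5]; [c] and the sign of [e] then determine [e]. *)
pose f p : 'I_5 * bool := (inord (absz (((2 * c p) %/ k)%Z + 2)), 0 <= e p).
have -> : 10%N = #|{: 'I_5 * bool}| by rewrite card_prod card_ord card_bool.
rewrite -(card_in_imset (f := f)); first exact: max_card.
have cb p : p \in A -> exists2 m : int, -2 <= m <= 2 & 2 * c p = m * k.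
  move=> pA; have /dvdzP[m hm] := hd _ pA; exists m => //.
  have := ce _ pA; move: hm; rewrite -/(c p) !expr2.
  move: (c p) (e p) => C E hc hce.
  have h1 : C <= k by rewrite leNgt; apply/negP => h; nia.
  have h2 : - k <= C by rewrite leNgt; apply/negP => h; nia.
  by apply/andP; split; rewrite leNgt; apply/negP => h; nia.
move=> p q pA qA [].
have [m hm cm] := cb _ pA; have [n hn cn] := cb _ qA.
rewrite cm cn !mulzK ?gt_eqF // => /(congr1 (@nat_of_ord 5)); rewrite !inordK; [|lia|lia] => mn ep.
have emn : m = n by lia.
have cpq : c p = c q by rewrite emn -cn in cm; lia.
have epq : e p = e q.
  have h1 := ce _ pA; have h2 := ce _ qA; rewrite cpq -h2 in h1.
  have h3 : e p ^+ 2 = e q ^+ 2 by lia.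
  have /eqP := h3; rewrite eqf_sqr => /orP[/eqP //|/eqP h].
  move: ep; rewrite h; lia.
have kx r : r \in A -> k * x r = e r * x p1 + c r * y p1.
  by move=> rA; rewrite -(hA _ p1A) /e /c; ring.
have ky r : r \in A -> k * y r = e r * y p1 - c r * x p1.
  by move=> rA; rewrite -(hA _ p1A) /e /c; ring.
have k1 : k != 0 by rewrite gt_eqF.
apply: inj => //; apply: (mulfI k1); first by rewrite (kx _ pA) (kx _ qA) cpq epq.
by rewrite (ky _ pA) (ky _ qA) cpq epq.
Qed.

Lemma coprimez_circle (x y k : int) : coprimez x y -> x ^+ 2 + y ^+ 2 = k -> coprimez k y.
Proof.
move=> co <-; rewrite expr2 [y ^+ 2]expr2.
by rewrite /coprimez gcdzC addrC gcdzMDl -/(coprimez _ _) coprimezMr coprimez_sym co.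
Qed.

(** This plays the role of factorization in the Gaussian integers. With [c] and [d] the difference
    and the sum of [x y0] and [x0 y], one has [c d = k (y0^2 - y^2)], so [g = gcd(c, k)] divides [c]
    and [l = k / g] divides [d]. As [y0 X = c y' - c' y = d y' - d' y] and [y0] is prime to [k],
    both [g] and [l] divide [X = x y' - x' y]. Finally [gcd(g, l)] divides [c + d = 2 x y0], hence
    [2], so that [k = g l] divides [2 X]. *)
Lemma circle_cross_dvd (k x0 y0 x y x' y' : int) : 0 < k ->
  coprimez x0 y0 -> coprimez x y -> coprimez x' y' ->
  x0 ^+ 2 + y0 ^+ 2 = k -> x ^+ 2 + y ^+ 2 = k -> x' ^+ 2 + y' ^+ 2 = k ->
  gcdz (x * y0 - x0 * y) k = gcdz (x' * y0 - x0 * y') k ->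
  (k %| 2 * (x * y' - x' * y))%Z.
Proof.
move=> k0 co0 co co' h0 h h'.
set c := x * y0 - x0 * y; set c' := x' * y0 - x0 * y'; set g := gcdz c k => eg.
pose d := x * y0 + x0 * y; pose d' := x' * y0 + x0 * y'.
pose X := x * y' - x' * y.
have k1 : k != 0 by rewrite gt_eqF.
have gk : (g %| k)%Z by exact: dvdz_gcdr.
have g0 : g != 0 by rewrite gcdz_eq0 negb_and k1 orbT.
have /dvdzP[l kl] := gk.
have hcd : c * d = k * (y0 ^+ 2 - y ^+ 2).
  rewrite /c /d; transitivity (x ^+ 2 * y0 ^+ 2 - x0 ^+ 2 * y ^+ 2); first ring.
  have -> : x ^+ 2 = k - y ^+ 2 by rewrite -h; ring.
  have -> : x0 ^+ 2 = k - y0 ^+ 2 by rewrite -h0; ring.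
  ring.
have hcd' : c' * d' = k * (y0 ^+ 2 - y' ^+ 2).
  rewrite /c' /d'; transitivity (x' ^+ 2 * y0 ^+ 2 - x0 ^+ 2 * y' ^+ 2); first ring.
  have -> : x' ^+ 2 = k - y' ^+ 2 by rewrite -h'; ring.
  have -> : x0 ^+ 2 = k - y0 ^+ 2 by rewrite -h0; ring.
  ring.
have ldvd a b w : gcdz a k = g -> a * b = k * w -> (l %| b)%Z.
  move=> ea hab; have /dvdzP[a1 ha1] : (g %| a)%Z by rewrite -ea dvdz_gcdl.
  have co1 : coprimez l a1.
    have : gcdz (a1 * g) (l * g) = g by rewrite -ha1 -kl.
    rewrite -mulz_gcdl gez0_abs; last by rewrite /g.
    by rewrite -[RHS]mul1r gcdzC => /(mulIf g0)/eqP.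
  rewrite -(Gauss_dvdzr _ co1); apply/dvdzP; exists w; apply: (mulfI g0).
  by rewrite mulrA [g * a1]mulrC -ha1 hab kl; ring.
have ld : (l %| d)%Z by apply: (ldvd c _ _ _ hcd).
have ld' : (l %| d')%Z by apply: (ldvd c' _ _ _ hcd').
have gc : (g %| c)%Z by exact: dvdz_gcdl.
have gc' : (g %| c')%Z by rewrite eg dvdz_gcdl.
have coky0 := coprimez_circle co0 h0.
have gX : (g %| X)%Z.
  have co1 : coprimez g y0 by apply: coprimez_dvdl gk coky0.
  rewrite -(Gauss_dvdzr _ co1); have -> : y0 * X = c * y' - c' * y by rewrite /X /c /c'; ring.
  by rewrite rpredB // dvdz_mulr.
have lk : (l %| k)%Z by rewrite kl dvdz_mulr.
have lX : (l %| X)%Z.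
  have co1 : coprimez l y0 by apply: coprimez_dvdl lk coky0.
  rewrite -(Gauss_dvdzr _ co1); have -> : y0 * X = d * y' - d' * y by rewrite /X /d /d'; ring.
  by rewrite rpredB // dvdz_mulr.
pose G := gcdz g l.
have G2 : (G %| 2)%Z.
  have Gk : (G %| k)%Z := dvdz_trans (dvdz_gcdl _ _) gk.
  have coy : coprimez G y0 := coprimez_dvdl Gk coky0.
  have cox : coprimez G x.
    have cokx : coprimez k x.
      by apply: (@coprimez_circle y); rewrite 1?coprimez_sym // addrC.
    exact: coprimez_dvdl Gk cokx.
  rewrite -(Gauss_dvdzl _ cox) -(Gauss_dvdzl _ coy).
  have -> : 2 * x * y0 = c + d by rewrite /c /d; ring.
  by rewrite rpredD // ?(dvdz_trans (dvdz_gcdl _ _) gc) ?(dvdz_trans (dvdz_gcdr _ _) ld).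
have [u [v uv]] := Bezoutz g l.
have GX : (k %| G * X)%Z.
  rewrite /G -uv mulrDl rpredD //; [rewrite -mulrA | rewrite -mulrA]; apply: dvdz_mull.
    by rewrite kl [l * g]mulrC dvdz_mul2l ?(negPf g0).
  by rewrite kl; apply: dvdz_mul.
by apply: (dvdz_trans GX); apply: dvdz_mul.
Qed.

(** The points are sorted by the gcd of [k] with their cross product against a fixed point. A class
    has at most [10] points, since twice a cross product within it is divisible by [k]. *)
Lemma primitive_circle_card (T : finType) (x y : T -> int) (A : {set T}) (k : nat) :
  (forall p q, p \in A -> q \in A -> x p = x q -> y p = y q -> p = q) -> (0 < k)%N ->
  (forall p, p \in A -> x p ^+ 2 + y p ^+ 2 = k%:Z) ->
  (forall p, p \in A -> coprimez (x p) (y p)) ->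
  (#|A| <= numdiv k * 10)%N.
Proof.
move=> inj k0 hA hco.
have [->|[p0 p0A]] := set_0Vmem A; first by rewrite cards0.
pose key p := gcdn (absz (x p * y p0 - x p0 * y p)%R) k.
apply: (card_le_fibers (key := key)) => [|p pA|v]; first exact: divisors_uniq.
  by rewrite -dvdn_divisors // dvdn_gcdr.
have [->|[p1]] := set_0Vmem [set p in A | key p == v]; first by rewrite cards0.
move=> p1F; have := p1F; rewrite inE => /andP[p1A /eqP k1].
apply: (circle_fiber_card (x := x) (y := y) (k := k) (p1 := p1)) => //.
- by move=> p q; rewrite !inE => /andP[pA _] /andP[qA _]; exact: inj.
- by move=> p; rewrite inE => /andP[pA _]; exact: hA.
move=> p; rewrite inE => /andP[pA /eqP kp].
apply: (@circle_cross_dvd k (x p0) (y p0)); rewrite ?hA ?hco //.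
by rewrite /gcdz /= -[gcdn _ k]/(key p) -[gcdn _ k]/(key p1) kp k1.
Qed.

(** The square of the content [v = gcd(x, y)] divides [k], so at most [numdiv k] contents occur, and
    division by [v] gives primitive points on the circle of [k / v^2]. *)
Lemma circle_card (T : finType) (x y : T -> int) (A : {set T}) (k : nat) :
  (forall p q, p \in A -> q \in A -> x p = x q -> y p = y q -> p = q) -> (0 < k)%N ->
  (forall p, p \in A -> x p ^+ 2 + y p ^+ 2 = k%:Z) ->
  (#|A| <= numdiv k * (numdiv k * 10))%N.
Proof.
move=> inj k0 hA.
pose key p := absz (gcdz (x p) (y p)).
have g0 p : p \in A -> (0 < key p)%N.
  move=> pA; rewrite /key /gcdz /= gcdn_gt0 !absz_gt0 -negb_and.
  apply/negP => /andP[/eqP hx /eqP hy]; have := hA _ pA; rewrite hx hy; lia.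
have g2 p : p \in A -> ((key p) ^ 2 %| k)%N.
  move=> pA; have /dvdzP[a ha] : (key p %| x p)%Z by exact: dvdz_gcdl.
  have /dvdzP[b hb] : (key p %| y p)%Z by exact: dvdz_gcdr.
  suff: ((key p ^ 2)%N%:Z %| k%:Z)%Z by [].
  apply/dvdzP; exists (a ^+ 2 + b ^+ 2); rewrite -(hA _ pA) ha hb.
  by rewrite PoszX; ring.
apply: (card_le_fibers (key := key)) => [|p pA|v]; first exact: divisors_uniq.
  by rewrite -dvdn_divisors //; apply: dvdn_trans (g2 _ pA); rewrite dvdn_exp.
have [->|[p1]] := set_0Vmem [set p in A | key p == v]; first by rewrite cards0.
rewrite inE => /andP[p1A /eqP k1].
have v0 : (0 < v)%N by rewrite -k1 g0.
have vk : (v ^ 2 %| k)%N by rewrite -k1 g2.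
have kv0 : (0 < k %/ v ^ 2)%N by rewrite divn_gt0 ?expn_gt0 ?v0 // dvdn_leq.
apply: (@leq_trans (numdiv (k %/ v ^ 2) * 10)); last first.
  by rewrite leq_mul2r numdiv_dvd ?orbT // dvdn_div.
have v1 : v%:Z != 0 by case: (v) v0.
have dv p : p \in [set p in A | key p == v] ->
    exists a b, [/\ p \in A, x p = a * v%:Z, y p = b * v%:Z & coprimez a b].
  rewrite inE => /andP[pA /eqP kp].
  have /dvdzP[a ha] : (v %| x p)%Z by rewrite -kp; exact: dvdz_gcdl.
  have /dvdzP[b hb] : (v %| y p)%Z by rewrite -kp; exact: dvdz_gcdr.
  exists a, b; split => //.
  have : gcdz (x p) (y p) = v by rewrite -kp /key gez0_abs.
  by rewrite ha hb -mulz_gcdl -[RHS]mul1r => /(mulIf v1)/eqP.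
apply: (@primitive_circle_card T (fun p => (x p %/ v)%Z) (fun p => (y p %/ v)%Z)) => //.
- move=> p q /dv[a [b [pA xa yb _]]] /dv[a' [b' [qA xa' yb' _]]].
  rewrite xa xa' yb yb' !mulzK // => aa bb.
  by apply: inj => //; rewrite ?xa ?xa' ?yb ?yb' ?aa ?bb.
- move=> p /dv[a [b [pA xa yb _]]]; rewrite xa yb !mulzK //.
  have v2 : (v ^ 2)%N%:Z != 0 by rewrite PoszX expf_neq0.
  apply: (mulIf v2); rewrite -PoszM divnK // -(hA _ pA) xa yb PoszX; ring.
- by move=> p /dv[a [b [pA xa yb co]]]; rewrite xa yb !mulzK.
Qed.

(* Three lattice points on a circle of radius [R] span a triangle of area at least [1/2],
   while the area is [abc / 4R]; so a box of side [L] contains at most two points of a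
   circle with [R^2 > 2 L^6]. *)
Lemma box_circle_card (L : nat) (b1 b2 k : int) :
  exists2 m : nat, (0 < m <= 2 * L ^ 6 + 1)%N &
    (#|[set p : 'I_L * 'I_L | ((b1 + p.1%:Z) ^+ 2 + (b2 + p.2%:Z) ^+ 2 == k)%R]|
      <= numdiv m * (numdiv m * 10))%N.
Proof.
set A := [set p | _].
pose x (p : 'I_L * 'I_L) : int := b1 + p.1%:Z; pose y (p : 'I_L * 'I_L) : int := b2 + p.2%:Z.
have hA p : p \in A -> x p ^+ 2 + y p ^+ 2 = k by rewrite inE => /eqP.
have inj p q : x p = x q -> y p = y q -> p = q.
  case: p q => [p1 p2] [q1 q2] /addrI[h1] /addrI[h2].
  by congr pair; apply: val_inj.
have dx p q : - L%:Z <= x p - x q <= L%:Z.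
  by rewrite /x; have := ltn_ord p.1; have := ltn_ord q.1; lia.
have dy p q : - L%:Z <= y p - y q <= L%:Z.
  by rewrite /y; have := ltn_ord p.2; have := ltn_ord q.2; lia.
(* The witness [m = 1] serves whenever at most two points occur. *)
have small : (#|A| <= 2)%N -> (#|A| <= numdiv 1 * (numdiv 1 * 10))%N.
  by move/leq_trans; apply.
have [kL|kL] := leP k (2 * L ^ 6)%N%:Z; last first.
  exists 1%N; rewrite ?addn1 //; apply: small; rewrite leqNgt; apply/negP.
  move=> /card_gt2P[p [q [r [[pA qA rA] [pq qr rp]]]]].
  have := chord_area (hA _ pA) (hA _ qA) (hA _ rA).
  have nz u v : u != v -> 0 < (x u - x v) ^+ 2 + (y u - y v) ^+ 2.
    move=> uv; rewrite lt_neqAle addr_ge0 ?sqr_ge0 // andbT eq_sym paddr_eq0 ?sqr_ge0 //.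
    rewrite !sqrf_eq0 !subr_eq0; apply/negP => /andP[/eqP h1 /eqP h2].
    by move: uv; rewrite (inj _ _ h1 h2) eqxx.
  have ub u v : (x u - x v) ^+ 2 + (y u - y v) ^+ 2 <= 2 * L%:Z ^+ 2.
    have := dx u v; have := dy u v; rewrite !expr2; nia.
  move: (nz q p) (nz r p) (nz r q); rewrite (eq_sym q p) pq rp (eq_sym r q) qr.
  move=> /(_ isT) a0 /(_ isT) b0 /(_ isT) c0.
  move: (ub q p) (ub r p) (ub r q) a0 b0 c0.
  pose D : int := (x q - x p) * (y r - y p) - (x r - x p) * (y q - y p).
  pose a : int := (x q - x p) ^+ 2 + (y q - y p) ^+ 2.
  pose b : int := (x r - x p) ^+ 2 + (y r - y p) ^+ 2.
  pose c : int := (x r - x q) ^+ 2 + (y r - y q) ^+ 2.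
  rewrite -/D -/a -/b -/c; move: a b c D => a b c D ha hb hc a0 b0 c0 h.
  have abc : a * b * c <= (2 * L%:Z ^+ 2) ^+ 3.
    move: (2 * L%:Z ^+ 2) ha hb hc => X ha hb hc; rewrite exprS expr2 mulrA.
    exact: ler_pM (ltW (mulr_gt0 a0 b0)) (ltW c0) (ler_pM (ltW a0) (ltW b0) ha hb) hc.
  have h0 : 0 < a * b * c by rewrite !mulr_gt0.
  have D1 : 1 <= D ^+ 2.
    have : D ^+ 2 != 0 by apply/negP => /eqP D0; move: h; rewrite D0 mulr0; lia.
    have := sqr_ge0 D; lia.
  have : (2 * L%:Z ^+ 2) ^+ 3 = 4 * (2 * L ^ 6)%N%:Z.
    by rewrite PoszM PoszX; ring.
  have : 4 * k <= 4 * k * D ^+ 2 by rewrite ler_peMr //; lia.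
  lia.
have [k0|k0] := leP k 0.
  exists 1%N; rewrite ?addn1 //; apply: small; apply: (@leq_trans 1) => //.
  have z u : u \in A -> x u = 0 /\ y u = 0.
    move=> uA; have : x u ^+ 2 + y u ^+ 2 == 0.
      by rewrite eq_le {1}(hA _ uA) k0 addr_ge0 ?sqr_ge0.
    by rewrite paddr_eq0 ?sqr_ge0 // !sqrf_eq0 => /andP[/eqP -> /eqP ->].
  apply/card_le1_eqP => p q /z[xp yp] /z[xq yq].
  by apply: inj; rewrite ?xp ?xq ?yp ?yq.
exists (absz k); first lia.
have k1 : (absz k)%:Z = k by rewrite gez0_abs // ltW.
apply: (circle_card (x := x) (y := y)).
- by move=> p q _ _; exact: inj.
- by rewrite absz_gt0 gt_eqF.
- by move=> p pA; rewrite hA.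
Qed.

(** * Moments of the truncated divisor function *)

Section Powers.
Context {R : realType}.
Implicit Types (a b x y th e : R).

Lemma gt0_powRD x a b : 0 < x -> x `^ (a + b) = x `^ a * x `^ b.
Proof. by move=> x0; rewrite powRD // (gt_eqF x0) implybT. Qed.

Lemma gt0_powRB x a b : 0 < x -> x `^ (a - b) = x `^ a / x `^ b.
Proof. by move=> x0; rewrite gt0_powRD // powRN. Qed.

(** Bernoulli's inequality, read off Young's inequality for the product of [a^th] and [1] with
    exponents [1 / th] and [1 / (1 - th)]. *)
Lemma powR_le1D a th : 0 <= a -> 0 < th <= 1 -> a `^ th <= 1 + th * (a - 1).
Proof.
move=> a0 /andP[th0]; rewrite le_eqVlt => /predU1P[->|th1].
  by rewrite powRr1 // mul1r addrCA subrr addr0.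
have := @conjugate_powR R (a `^ th) 1 th^-1 (1 - th)^-1 (powR_ge0 _ _) ler01.
rewrite !invr_gt0 !invrK subr_gt0 => /(_ th0 th1 (subrKC _ _)).
rewrite mulr1 -powRrM divff ?gt_eqF // powRr1 // powR1; lra.
Qed.

(** Comparison with the integral of [x^(th - 1)]; the induction step is Bernoulli's inequality at
    [1 - 1 / (X + 1)]. This bound later stands in for logarithms. *)
Lemma sum_powR_le th (X : nat) : 0 < th <= 1 ->
  \sum_(1 <= m < X.+1) m%:R `^ (th - 1) <= X%:R `^ th / th.
Proof.
move=> th01; have /andP[th0 th1] := th01.
elim: X => [|X IH]; first by rewrite big_geq // divr_ge0 ?powR_ge0 // ltW.
rewrite big_nat_recr //=; apply: le_trans (lerD IH (lexx _)) _.
have X0 : 0 < X.+1%:R :> R by rewrite ltr0n.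
rewrite gt0_powRB // powRr1 ?(ltW X0) // ler_pdivlMr // mulrDl divfK ?gt_eqF //.
have -> : X%:R = X.+1%:R * (1 - X.+1%:R^-1) :> R.
  by rewrite mulrBr mulr1 divff ?gt_eqF // -natr1 addrK.
have h0 : 0 <= 1 - X.+1%:R^-1 :> R by rewrite subr_ge0 invf_le1 // ler1n.
rewrite powRM // ?(ltW X0) //.
have := ler_wpM2l (powR_ge0 X.+1%:R th) (powR_le1D h0 th01).
move: X.+1%:R^-1 (X.+1%:R `^ th) => n P; nra.
Qed.

(** Each factor [truncdiv] peeled off produces a sum over [q], and the [X / q] multiples that are
    left provide the weight [1 / q]. *)
Lemma truncdiv_moment (U B X : nat) :
  (\sum_(1 <= l < X.+1) truncdiv U l ^ B)%N%:R <=
  X%:R * \prod_(i < B) \sum_(1 <= q < U.+1) (numdiv q ^ i)%N%:R / q%:R :> R.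
Proof.
elim: B X => [|B IH] X.
  under eq_bigr do rewrite expn0.
  by rewrite big_ord0 mulr1 sum_nat_const_nat subSS subn0 muln1.
apply: (@le_trans _ _ (\sum_(1 <= q < U.+1) (numdiv q ^ B *
    \sum_(1 <= l < (X %/ q).+1) truncdiv U l ^ B)%N%:R)).
  by rewrite -natr_sum ler_nat truncdiv_momentS.
rewrite big_ord_recr /= mulrA mulr_sumr big_nat [leRHS]big_nat; apply: ler_sum => q /andP[q0 _].
rewrite natrM [leRHS]mulrC mulrAC -mulrA ler_wpM2l //.
rewrite mulrC; apply: le_trans (IH _) _; rewrite mulrA ler_wpM2r //.
  by apply: prodr_ge0 => i _; apply: sumr_ge0 => j _; apply: divr_ge0.
by rewrite -[q%:R^-1 * _]mulrC ler_pdivlMr ?ltr0n // -natrM ler_nat leq_trunc_div.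
Qed.

Lemma numdiv_powR e : 0 < e ->
  exists2 C, 0 < C & forall m, (0 < m)%N -> (numdiv m)%:R <= C * m%:R `^ e.
Proof.
move=> e0; pose k := (Num.truncn e^-1).+1.
have ke : e^-1 <= k%:R by rewrite ltW // truncnS_gt.
have [C C0 HC] := numdiv_exp_le k.
exists (C%:R `^ (k%:R^-1)) => [|m m0]; first by rewrite powR_gt0 // ltr0n.
have k0 : 0 < k%:R :> R by rewrite ltr0n.
apply: (@le_trans _ _ ((C * m)%:R `^ (k%:R^-1))).
  have -> : (numdiv m)%:R = ((numdiv m)%:R ^+ k) `^ (k%:R^-1) :> R.
    by rewrite -powR_mulrn // -powRrM divff ?gt_eqF // powRr1.
  by apply: ge0_ler_powR; rewrite ?nnegrE ?invr_ge0 ?exprn_ge0 ?ler0n // -natrX ler_nat HC.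
rewrite natrM powRM // ler_wpM2l ?powR_ge0 // ler_powR ?ler1n //.
by rewrite -[leRHS]invrK lef_pV2 ?posrE ?invr_gt0.
Qed.

(** The loss is a power of the truncation [U], not of the length [X], which will be of order [L^2]
    whatever [U] is. *)
Lemma truncdiv_moment_powR e (B : nat) : 0 < e ->
  exists2 C, 0 < C & forall U X, (0 < U)%N ->
    (\sum_(1 <= l < X.+1) truncdiv U l ^ B)%N%:R <= C * X%:R * U%:R `^ e.
Proof.
move=> e0.
(* Each of the [B] factors loses [U^(d B)] from the powers of [numdiv] and [U^d] from the sum, in
   all [U^(d B (B + 1)) <= U^e]. *)
pose d : R := Num.min (e / (B.+1 ^ 2)%:R) 1.
have B0 : 0 < (B.+1 ^ 2)%:R :> R by rewrite ltr0n expn_gt0.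
have d0 : 0 < d by rewrite lt_min ltr01 divr_gt0.
have d1 : d <= 1 by rewrite ge_min lexx orbT.
have dB : d * (B.+1 ^ 2)%:R <= e.
  by rewrite -ler_pdivlMr // ge_min lexx.
have [C C0 HC] := numdiv_powR d0.
have [C1 C10 CC1] : exists2 C1, 1 <= C1 & C <= C1.
  by exists (Num.max 1 C); rewrite le_max lexx ?orbT.
pose D := C1 ^+ B / d.
have C1p : 0 < C1 := lt_le_trans ltr01 C10.
have D0 : 0 < D by rewrite divr_gt0 ?exprn_gt0.
have inner (i : 'I_B) (U : nat) : (0 < U)%N ->
    \sum_(1 <= q < U.+1) (numdiv q ^ i)%N%:R / q%:R <= D * U%:R `^ (d * B.+1%:R).
  move=> U0.
  apply: (@le_trans _ _ (\sum_(1 <= q < U.+1) (C1 ^+ B * U%:R `^ (d * B%:R)) * q%:R `^ (d - 1))).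
    rewrite big_nat [leRHS]big_nat; apply: ler_sum => q /andP[q0 qU].
    have q0' : 0 < q%:R :> R by rewrite ltr0n.
    have q1 : 1 <= q%:R :> R by rewrite ler1n.
    rewrite gt0_powRB // (@powRr1 R) ?ler0n // mulrA ler_wpM2r ?invr_ge0 ?ler0n //.
    rewrite natrX; apply: (@le_trans _ _ ((C1 * q%:R `^ d) ^+ i)).
      rewrite lerXn2r ?nnegrE ?mulr_ge0 ?powR_ge0 ?(ltW C1p) //.
      by apply: le_trans (HC _ q0) _; rewrite ler_wpM2r ?powR_ge0.
    rewrite exprMn; apply: (@le_trans _ _ (C1 ^+ B * (U%:R `^ (d * B%:R)))).
      apply: ler_pM; rewrite ?exprn_ge0 ?powR_ge0 ?(ltW C1p) //.
        by rewrite ler_weXn2l // ltnW.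
      rewrite -powR_mulrn ?powR_ge0 // -powRrM.
      apply: (@le_trans _ _ (q%:R `^ (d * B%:R))).
        by rewrite ler_powR // ler_wpM2l ?(ltW d0) // ler_nat ltnW.
      by apply: ge0_ler_powR; rewrite ?nnegrE ?mulr_ge0 ?(ltW d0) // ler_nat -ltnS.
    rewrite ler_peMr ?mulr_ge0 ?exprn_ge0 ?powR_ge0 ?(ltW C1p) //.
    by rewrite -[leLHS](powRr0 q%:R) ler_powR // ltW.
  rewrite -mulr_sumr.
  apply: le_trans (ler_wpM2l _ (sum_powR_le U _)) _.
  - by rewrite mulr_ge0 ?exprn_ge0 ?powR_ge0 ?(ltW C1p).
  - by rewrite d0.
  - rewrite -[B.+1%:R]natr1 mulrDr mulr1 gt0_powRD ?ltr0n // /D.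
    by rewrite le_eqVlt; apply/orP; left; apply/eqP; ring.
exists (D ^+ B) => [|U X U0]; first exact: exprn_gt0.
apply: le_trans (truncdiv_moment _ _ _) _.
rewrite [_ * X%:R]mulrC -mulrA ler_wpM2l //.
apply: (@le_trans _ _ (\prod_(i < B) (D * U%:R `^ (d * B.+1%:R)))).
  apply: ler_prod => i _; rewrite inner // andbT.
  by apply: sumr_ge0 => j _; apply: divr_ge0.
rewrite prodr_const card_ord exprMn ler_wpM2l ?exprn_ge0 ?(ltW D0) //.
rewrite -powR_mulrn ?powR_ge0 // -powRrM ler_powR ?ler1n //.
apply: le_trans dB; rewrite -mulrA ler_wpM2l ?(ltW d0) // -natrM ler_nat; nia.
Qed.
End Powers.

Local Open Scope classical_set_scope.
Local Open Scope ring_scope.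

(** * Exponentials *)

Section ComplexNorm.
Context {R : realType}.
Implicit Types z w : R[i].
Local Notation normc := (@Normc.normc R).
Local Notation Re := (@complex.Re R).

Lemma normc_ge0 z : 0 <= normc z.
Proof. by case: z => a b; rewrite sqrtr_ge0. Qed.

Lemma normcD_le z w : normc (z + w) <= normc z + normc w.
Proof. exact: le_normcD. Qed.

Lemma normc_oppr z : normc (- z) = normc z.
Proof. by case: z => a b /=; rewrite !sqrrN. Qed.

Lemma normc_conjc z : normc (conjc z) = normc z.
Proof. by case: z => a b /=; rewrite sqrrN. Qed.

Lemma normc_real (x : R) : normc x%:C%C = `|x|.
Proof. by rewrite /= expr0n addr0 sqrtr_sqr. Qed.

Lemma normc_sum_le (I : Type) (r : seq I) (P : pred I) (F : I -> R[i]) :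
  normc (\sum_(i <- r | P i) F i) <= \sum_(i <- r | P i) normc (F i).
Proof.
elim/big_ind2: _ => [|z x w y zx wy|//]; first by rewrite Normc.normc0.
exact: le_trans (normcD_le _ _) (lerD zx wy).
Qed.

Lemma normc_exp z n : normc (z ^+ n) = normc z ^+ n.
Proof. by elim: n => [|n IH]; rewrite ?expr0 ?Normc.normc1 // !exprS Normc.normcM IH. Qed.

Lemma Re_sum (I : Type) (r : seq I) (P : pred I) (F : I -> R[i]) :
  Re (\sum_(i <- r | P i) F i) = \sum_(i <- r | P i) Re (F i).
Proof. by elim/big_rec2: _ => [//|i y z _ <-]; case: (F i); case: z. Qed.

Lemma Re_le_normc z : Re z <= normc z.
Proof.
case: z => a b /=; apply: le_trans (ler_norm a) _.
by rewrite -sqrtr_sqr ler_wsqrtr // lerDl sqr_ge0.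
Qed.

Lemma sqr_normcE z : normc z ^+ 2 = Re (z * conjc z).
Proof. by case: z => a b /=; rewrite sqr_sqrtr ?addr_ge0 ?sqr_ge0 //; ring. Qed.

Lemma mul_conjc z : z * conjc z = (normc z ^+ 2)%:C%C.
Proof. by rewrite sqr_normcE; case: z => a b; congr (_ +i* _)%C => /=; ring. Qed.

Lemma Re_mulrC z w : Re (z * conjc w) = Re (w * conjc z).
Proof. by case: z w => [a b] [c d] /=; ring. Qed.

Lemma conjcM z w : conjc (z * w) = conjc z * conjc w.
Proof. exact: (rmorphM (@conjc R)). Qed.

Lemma conjc_sum (I : Type) (r : seq I) (P : pred I) (F : I -> R[i]) :
  conjc (\sum_(i <- r | P i) F i) = \sum_(i <- r | P i) conjc (F i).
Proof. exact: (raddf_sum (@conjc R)). Qed.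

Lemma sqr_normc_sum (I : finType) (F : I -> R[i]) :
  normc (\sum_i F i) ^+ 2 = \sum_i \sum_j Re (F i * conjc (F j)).
Proof.
rewrite sqr_normcE conjc_sum mulr_suml Re_sum; apply: eq_bigr => i _.
by rewrite mulr_sumr Re_sum.
Qed.

End ComplexNorm.

Section Exponential.
Context {R : realType}.
Implicit Types x y : R.
Local Notation normc := (@Normc.normc R).

Lemma expiD x y : expi (x + y) = expi x * expi y.
Proof. by rewrite /expi cosD sinD; congr (_ +i* _)%C; rewrite addrC mulrC [sin x * _]mulrC. Qed.

Lemma expi0 : expi 0 = 1 :> R[i].
Proof. by rewrite /expi cos0 sin0. Qed.

Lemma conjc_expi x : conjc (expi x) = expi (- x).
Proof. by rewrite /expi cosN sinN. Qed.

Lemma normc_expi x : normc (expi x) = 1.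
Proof. by rewrite /= cos2Dsin2 sqrtr1. Qed.

Definition ee x : R[i] := expi (2 * pi * x).

Lemma eeD x y : ee (x + y) = ee x * ee y.
Proof. by rewrite /ee mulrDr expiD. Qed.

Lemma ee0 : ee 0 = 1.
Proof. by rewrite /ee mulr0 expi0. Qed.

Lemma conjc_ee x : conjc (ee x) = ee (- x).
Proof. by rewrite /ee conjc_expi mulrN. Qed.

Lemma normc_ee x : normc (ee x) = 1.
Proof. exact: normc_expi. Qed.

Lemma ee_natmul (n : nat) x : ee (n%:R * x) = ee x ^+ n.
Proof. by elim: n => [|n IH]; rewrite ?mul0r ?ee0 // exprS -IH -eeD -natr1; congr ee; ring. Qed.

Lemma ee_nat (n : nat) : ee n%:R = 1.
Proof.
rewrite -[n%:R]mulr1 ee_natmul /ee mulr1 mulr_natl /expi cos2pi sin2pi.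
exact: expr1n.
Qed.

Lemma ee_int (k : int) : ee k%:~R = 1.
Proof.
case: k => n; first by rewrite -pmulrn ee_nat.
have := ee_nat n.+1; rewrite NegzE mulrNz -pmulrn => h.
have := eeD n.+1%:R (- n.+1%:R); rewrite subrr ee0 h mul1r; exact: esym.
Qed.

Lemma eeDint x (k : int) : ee (x + k%:~R) = ee x.
Proof. by rewrite eeD ee_int mulr1. Qed.

(** By the mean value theorem on [[0, x / 2]], where the cosine is at least [cos (pi / 4)], one gets
    [sin x = 2 cos (x / 2) sin (x / 2) >= 2 cos (pi / 4)^2 (x / 2)]. *)
Lemma sin_ge_half x : 0 <= x <= pi / 2 -> x / 2 <= sin x.
Proof.
move=> /andP[]; rewrite le_eqVlt => /predU1P[<- _|x0 xp]; first by rewrite mul0r sin0.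
have h0 : 0 < x / 2 by rewrite divr_gt0.
have p0 := @pi_gt0 R.
have dsin (y : R) : y \in `]0, (x / 2)[%R -> is_derive y 1 sin (cos y) by move=> _; exact: is_derive_sin.
have csin : {within `[0, (x / 2)]%classic, continuous (@sin R)}.
  by apply: continuous_subspaceT => y; exact: continuous_sin.
have [c] := MVT h0 dsin csin.
rewrite sin0 !subr0 in_itv /= => /andP[c0 cx] sx.
have cosh : cos (pi / 4) ^+ 2 = 2^-1 :> R.
  have := cos_mulr2n (pi / 4 : R).
  have -> : (pi / 4) *+ 2 = pi / 2 :> R by rewrite mulr2n; field.
  rewrite cos_pihalf mulr2n; lra.
have c4 : 0 <= cos (pi / 4 : R) by apply: cos_ge0_pihalf; apply/andP; split; lra.
have le4 : cos (pi / 4) <= cos (x / 2).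
  rewrite leNgt ltr_cos ?in_itv /= -?leNgt; [lra|..]; apply/andP; split; lra.
have lec : cos (x / 2) <= cos c.
  rewrite leNgt ltr_cos ?in_itv /= -?leNgt; [lra|..]; apply/andP; split; lra.
have -> : sin x = 2 * (cos (x / 2) * sin (x / 2)).
  have -> : x = (x / 2) *+ 2 by rewrite mulr2n; field.
  rewrite sin_mulr2n mulr2n; have -> : (x / 2) *+ 2 / 2 = x / 2 by rewrite mulr2n; field.
  by ring.
rewrite sx; move: (cos (pi / 4 : R)) (cos (x / 2)) (cos c) cosh c4 le4 lec => u v w.
rewrite expr2 => h1 h2 h3 h4.
have h5 : u * u <= v * w by apply: ler_pM => //; lra.
nra.
Qed.

(** Here [|1 - ee x| = 2 |sin (pi x)|], and the crude [sin z >= z / 2] is enough because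
    [pi >= 2]. *)
Lemma normc_1Bee x : `|x| <= 1 / 2 -> 2 * `|x| <= normc (1 - ee x).
Proof.
move=> x2; have p0 := @pi_ge2 R.
have e : normc (1 - ee x) = 2 * `|sin (pi * x)|.
  rewrite /ee /expi -[1]/(1 +i* 0)%C /= -mulrA mulr_natl.
  rewrite sin_mulr2n cos_mulr2n.
  have h := cos2Dsin2 (pi * x).
  rewrite -[RHS]ger0_norm ?mulr_ge0 // -sqrtr_sqr; congr Num.sqrt.
  rewrite exprMn real_normK ?num_real //.
  have -> : cos (pi * x) ^+ 2 = 1 - sin (pi * x) ^+ 2 by rewrite -h; ring.
  have -> : (0 - (cos (pi * x) * sin (pi * x)) *+ 2) ^+ 2 =
    4 * (cos (pi * x) ^+ 2) * sin (pi * x) ^+ 2 by rewrite mulr2n; ring.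
  have -> : cos (pi * x) ^+ 2 = 1 - sin (pi * x) ^+ 2 by rewrite -h; ring.
  by rewrite !mulr2n; ring.
have -> : normc (1 - ee x) = 2 * sin (pi * `|x|).
  rewrite e; congr (2 * _).
  have h : 0 <= sin (pi * `|x|).
    apply: sin_ge0_pi; rewrite mulr_ge0 ?pi_ge0 //=; have := normr_ge0 x; nra.
  rewrite -[RHS]ger0_norm //; case: (ger0P x) => // _.
  by rewrite mulrN sinN normrN.
have := @sin_ge_half (pi * `|x|); rewrite mulr_ge0 ?pi_ge0 //= => /(_ _).
have := normr_ge0 x; move: x2; move: `|x| => t t2 t0 h.
have h1 : pi * t <= pi / 2 by nra.
have := h h1; nra.
Qed.
End Exponential.

(** * Weyl sums *)

Lemma sum_square_diff (V : comNzRingType) (c : nat -> nat -> V) (L : nat) :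
  (forall m n, c m n = c n m) ->
  \sum_(0 <= n < L) \sum_(0 <= m < L) c n m =
  \sum_(0 <= n < L) c n n +
  (\sum_(1 <= h < L) \sum_(0 <= m < L - h) c (m + h)%N m) *+ 2.
Proof.
move=> csym; elim: L => [|L IH]; first by rewrite !big_geq // mul0rn addr0.
rewrite big_nat_recr //=; under eq_bigr => n _ do rewrite big_nat_recr //=.
rewrite big_split /= IH.
have -> : \sum_(1 <= h < L.+1) \sum_(0 <= m < L.+1 - h) c (m + h)%N m =
  \sum_(1 <= h < L) \sum_(0 <= m < L - h) c (m + h)%N m + \sum_(0 <= m < L) c L m.
  transitivity (\sum_(1 <= h < L.+1) (\sum_(0 <= m < L - h) c (m + h)%N m + c L (L - h)%N)).
    rewrite big_nat [RHS]big_nat; apply: eq_bigr => h /andP[h0 hL].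
    by rewrite subSn // big_nat_recr //= subnK.
  rewrite big_split /=; congr (_ + _).
    case: (L) => [|L']; first by rewrite !big_geq.
    by rewrite big_nat_recr //= subnn [X in _ + X]big_geq // addr0.
  rewrite big_add1 /= big_nat_rev /= big_nat [RHS]big_nat; apply: eq_bigr => m /andP[_ mL].
  by congr c; lia.
rewrite [X in _ + X = _]big_nat_recr //= [X in _ = X + _]big_nat_recr //=.
have -> : \sum_(0 <= n < L) c n L = \sum_(0 <= m < L) c L m by apply: eq_bigr.
by rewrite !mulr2n; ring.
Qed.

Section Kernel.
Context {R : realType}.
Implicit Types x y t : R.
Local Notation normc := (@Normc.normc R).

(** The modulus of the Dirichlet kernel; its square is [l] times the Fejer kernel. *)
Definition dker (l : nat) y : R := normc (\sum_(0 <= m < l) ee (m%:R * y)).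

Lemma dker_ge0 l y : 0 <= dker l y.
Proof. exact: normc_ge0. Qed.

Lemma dker_le l y : dker l y <= l%:R.
Proof.
apply: le_trans (normc_sum_le _ _ _) _.
under eq_bigr do rewrite normc_ee.
by rewrite big_const_nat subn0 iter_addr_0.
Qed.

(** The hypothesis says that [y] is at distance at least [rho] from the integers. The geometric sum
    then has numerator at most [2] and denominator at least [2 rho]. *)
Lemma dker_dist l y rho : (forall A : int, rho <= `|y - A%:~R|) -> dker l y * rho <= 1.
Proof.
pose A := Num.floor (y + 1 / 2) => /(_ A).
have Ay : `|y - A%:~R| <= 1 / 2.
  have := floor_le_tmp (y + 1 / 2); have := floorD1_gt (y + 1 / 2).
  rewrite -/A intrD => h1 h2; rewrite ler_norml; apply/andP; split; lra.
have h1 := normc_1Bee Ay; move: Ay h1; set x := y - A%:~R => Ay h1 hrho.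
apply: le_trans (ler_wpM2l (dker_ge0 _ _) hrho) _.
have E : dker l y = normc (\sum_(i < l) ee x ^+ i).
  rewrite /dker big_mkord; congr normc; apply: eq_bigr => i _.
  by rewrite ee_natmul /x -(eeDint (y - _) A) subrK.
have : dker l y * normc (1 - ee x) <= 2.
  rewrite E -Normc.normcM mulrC -opprB mulNr -subrX1 normc_oppr.
  apply: le_trans (normcD_le _ _) _.
  by rewrite normc_oppr Normc.normc1 normc_exp normc_ee expr1n.
have := ler_wpM2l (dker_ge0 l y) h1; lra.
Qed.

Definition wsum (L : nat) (b : int) t : R[i] :=
  \sum_(0 <= n < L) ee (t * ((b + n%:Z) ^+ 2)%:~R).

(** The position [b] enters [F (m + h) * conjc (F m)] only through a unimodular factor that does not
    depend on [m]; this makes the bound uniform in [b]. *)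
Lemma weyl_differencing (L : nat) (b : int) t :
  normc (wsum L b t) ^+ 2 <= L%:R + 2 * \sum_(1 <= h < L) dker (L - h) (h%:R * (2 * t)).
Proof.
pose F n : R[i] := ee (t * ((b + n%:Z) ^+ 2)%:~R).
have -> : normc (wsum L b t) ^+ 2 =
    \sum_(0 <= n < L) \sum_(0 <= m < L) complex.Re (F n * conjc (F m)).
  transitivity (normc (\sum_(n < L) F n) ^+ 2); first by rewrite /wsum big_mkord.
  rewrite sqr_normc_sum; under eq_bigr => n _.
    by rewrite -(big_mkord predT (fun m => complex.Re (F n * conjc (F m)))); over.
  by rewrite -(big_mkord predT (fun n => \sum_(0 <= m < L) complex.Re (F n * conjc (F m)))).
rewrite sum_square_diff => [|m n]; last exact: Re_mulrC.
rewrite -[_ *+ 2]mulr_natl; apply: lerD.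
  under eq_bigr => n _ do rewrite -sqr_normcE normc_ee expr1n.
  by rewrite big_const_nat subn0 iter_addr_0.
rewrite ler_wpM2l //; rewrite big_nat [leRHS]big_nat; apply: ler_sum => h /andP[h0 hL].
rewrite -Re_sum; apply: le_trans (Re_le_normc _) _.
have -> : \sum_(0 <= m < L - h) F (m + h)%N * conjc (F m) =
  ee (t * (2 * b * h%:Z + h%:Z ^+ 2)%:~R) * \sum_(0 <= m < L - h) ee (m%:R * (h%:R * (2 * t))).
  rewrite mulr_sumr; apply: eq_bigr => m _.
  rewrite /F conjc_ee -!eeD; congr ee; rewrite PoszD.
  rewrite !(rmorphD, rmorphM, rmorphXn) /= -!pmulrn; ring.
by rewrite Normc.normcM normc_ee mul1r.
Qed.

Lemma dirichlet_approx y (Q : nat) : (0 < Q)%N ->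
  exists q : nat, exists a : int,
    [/\ (0 < q <= Q)%N, coprimez a q & `|q%:R * y - a%:~R| * Q%:R <= 1].
Proof.
move=> Q0; have Q0' : 0 < Q%:R :> R by rewrite ltr0n.
pose fr (i : nat) := i%:R * y - (Num.floor (i%:R * y))%:~R.
have fr0 i : 0 <= fr i by rewrite subr_ge0 floor_le_tmp.
have fr1 i : fr i < 1 by rewrite /fr ltrBlDr addrC -[1]/(1%:~R) -intrD floorD1_gt.
have trQ i : (Num.truncn (Q%:R * fr i) < Q)%N.
  by rewrite -(ltr_nat R); apply: (@le_lt_trans _ _ (Q%:R * fr i)); rewrite ?truncn_le ?mulr_ge0 // gtr_pMr.
pose box (i : 'I_Q.+1) : 'I_Q := Ordinal (trQ i).
have /injectivePn[i [j ij bij]] : ~~ injectiveb box.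
  apply/negP => /injectiveP/leq_card; rewrite !card_ord; lia.
wlog ltij : i j ij bij / (i < j)%N.
  move=> H; have : (val i != val j) by [].
  rewrite neq_ltn => /orP[lt|lt]; first exact: (H i j).
  by apply: (H j i) => //; rewrite eq_sym.
pose q := (j - i)%N; pose a : int := Num.floor (j%:R * y) - Num.floor (i%:R * y).
have q0 : (0 < q)%N by rewrite subn_gt0.
have qQ : (q <= Q)%N by rewrite /q; have := ltn_ord j; lia.
have hqa : `|q%:R * y - a%:~R| * Q%:R <= 1.
  have -> : q%:R * y - a%:~R = fr j - fr i.
    by rewrite /q /a /fr natrB ?(ltnW ltij) // intrB; ring.
  have /(congr1 val)/= e : box i = box j := bij.
  have := @truncn_itv R (Q%:R * fr i) (mulr_ge0 (ler0n _ _) (fr0 _)).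
  have := @truncn_itv R (Q%:R * fr j) (mulr_ge0 (ler0n _ _) (fr0 _)).
  rewrite e => /andP[h1 h2] /andP[h3 h4]; rewrite -natr1 in h2 h4.
  rewrite -[Q%:R in leLHS]ger0_norm // -normrM mulrC mulrBr ler_norml; apply/andP; split; lra.
(* Reduction to lowest terms divides the error by [g], so the bound survives. *)
pose g := gcdn (absz a) q.
have g0 : (0 < g)%N by rewrite gcdn_gt0 q0 orbT.
have g0' : 0 < g%:R :> R by rewrite ltr0n.
have gz : g%:Z != 0 by case: (g) g0.
have /dvdnP[q' hq'] : (g %| q)%N := dvdn_gcdr _ _.
have /dvdzP[a' ha'] : (g%:Z %| a)%Z := dvdn_gcdl _ _.
exists q', a'; split.
- have q'0 : (0 < q')%N by move: q0; rewrite hq' muln_gt0 => /andP[].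
  by rewrite q'0 /=; apply: leq_trans qQ; rewrite hq' leq_pmulr.
- have : gcdz (a' * g) (q' * g)%N = g by rewrite -ha' -hq'.
  by rewrite PoszM -mulz_gcdl -[RHS]mul1r => /(mulIf gz)/eqP.
- apply: le_trans hqa; rewrite ler_wpM2r //.
  have -> : q%:R * y - a%:~R = g%:R * (q'%:R * y - a'%:~R).
    by rewrite hq' {1}ha' natrM intrM -pmulrn; ring.
  by rewrite normrM ger0_norm ?ler0n // ler_peMl // ler1n.
Qed.
End Kernel.

Section Weyl.
Context {R : realType}.
Implicit Types x y t v th : R.
Local Notation normc := (@Normc.normc R).

Lemma powR_doubling th x y : 0 < th <= 1 -> 0 < x -> x <= 2 * y ->
  y `^ (th - 1) <= 2 * x `^ (th - 1).
Proof.
move=> /andP[th0 th1] x0 xy.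
have y0 : 0 < y by lra.
rewrite -[th - 1]opprB !powRN ler_pdivlMr ?powR_gt0 // mulrC ler_pdivrMr ?powR_gt0 //.
apply: (@le_trans _ _ ((2 * y) `^ (1 - th))).
  by apply: ge0_ler_powR; rewrite ?nnegrE; lra.
rewrite powRM // ?(ltW y0) // ler_wpM2r ?powR_ge0 //.
by apply: ler1_powR; lra.
Qed.

Definition res_mul (a : int) (q h : nat) : nat := absz ((a * h%:Z) %% q)%Z.

(** As [a] is invertible modulo [q], a block of [q] consecutive [h] contains at most one solution;
    the map [h |-> h %/ q] is injective on the solutions. *)
Lemma card_res_mul (L q r : nat) (a : int) : (0 < q)%N -> coprimez a q ->
  (\sum_(1 <= h < L) (res_mul a q h == r) <= L %/ q + 1)%N.
Proof.
move=> q0 co; apply: (@leq_trans (\sum_(0 <= h < L) (res_mul a q h == r))).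
  case: (L) => [|L']; first by rewrite !big_geq.
  by rewrite [leqRHS]big_ltn // leq_addl.
rewrite big_mkord -big_mkcond /= sum1_card addn1.
rewrite -[(L %/ q).+1]card_ord.
have lt (h : 'I_L) : (h %/ q < (L %/ q).+1)%N by rewrite ltnS leq_div2r // ltnW.
rewrite -(card_in_image (f := fun h : 'I_L => Ordinal (lt h))); first exact: max_card.
move=> h h'; rewrite !unfold_in => /eqP hr /eqP hr' /(congr1 val) /= eh.
apply: val_inj => /=; rewrite (divn_eq h q) (divn_eq h' q) eh; congr (_ + _)%N.
have q1 : q%:Z != 0 by case: (q) q0.
have e : ((a * h%:Z) %% q)%Z = ((a * h'%:Z) %% q)%Z.
  rewrite -[LHS]gez0_abs ?modz_ge0 // -[RHS]gez0_abs ?modz_ge0 //.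
  by rewrite -/(res_mul a q h) -/(res_mul a q h') hr hr'.
have : (q %| a * (h%:Z - h'%:Z))%Z by rewrite mulrBr -eqz_mod_dvd e.
rewrite Gauss_dvdzr 1?coprimez_sym // -eqz_mod_dvd => /eqP.
by rewrite !modz_nat => -[].
Qed.

Section Approximation.
Variables (L q : nat) (a : int) (y th : R).
Hypotheses (L0 : (0 < L)%N) (q0 : (0 < q)%N) (q2L : (q <= 2 * L)%N) (co : coprimez a q).
Hypothesis th01 : 0 < th <= 1.
Let v := `|q%:R * y - a%:~R|.
Hypothesis vL : v * (2 * L)%N%:R <= 1.

Let qR : 0 < q%:R :> R. Proof. by rewrite ltr0n. Qed.
Let v0 : 0 <= v. Proof. exact: normr_ge0. Qed.
Let LR : 0 < L%:R :> R. Proof. by rewrite ltr0n. Qed.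

(** The fraction [a h / q] is at distance [m / q] from the integers, with [m = min(r, q - r) >= 1],
    and [h y] differs from it by at most [1 / (2 q)], because [h < L] and [2 L v <= 1]. So [h y] is
    at distance at least [m / (2 q)]. The sum of two inverses dominates [1 / m] and is easy to sum
    over [r]. *)
Lemma dker_nondiv (l h : nat) : (0 < h < L)%N -> ~~ (q %| h)%N ->
  let r := res_mul a q h in
  (0 < r < q)%N /\ dker l (h%:R * y) <= 2 * q%:R * (r%:R^-1 + (q - r)%N%:R^-1).
Proof.
move=> /andP[h0 hL] qh r.
have q1 : q%:Z != 0 by case: (q) q0.
have r0 : (0 < r)%N.
  rewrite lt0n absz_eq0; apply/negP => /eqP/dvdz_mod0P.
  rewrite Gauss_dvdzr 1?coprimez_sym //; exact/negP.
have rq : (r < q)%N.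
  by rewrite -ltz_nat gez0_abs ?modz_ge0 // ltz_pmod.
split; first by rewrite r0 rq.
pose m := minn r (q - r).
have m0 : (0 < m)%N by rewrite /m; lia.
have mR : 0 < m%:R :> R by rewrite ltr0n.
have key (A : int) : (m <= absz (a * h%:Z - q%:Z * A)%R)%N.
  have e : a * h%:Z = ((a * h%:Z) %/ q)%Z * q + r%:Z.
    by rewrite /r gez0_abs ?modz_ge0 // -divz_eq.
  rewrite e; move: (_ %/ _)%Z => B; clear e.
  have [k kE] : exists k, k = B - A by exists (B - A).
  have -> : B * q + r%:Z - q%:Z * A = k * q + r%:Z by rewrite kE; ring.
  rewrite /m; clear -rq r0; case: (ltrP k 0) => hk; nia.
have : dker l (h%:R * y) * (m%:R / (2 * q%:R)) <= 1.
  apply: dker_dist => A.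
  have hv : h%:R * v <= 1 / 2.
    apply: (@le_trans _ _ (L%:R * v)); first by rewrite ler_wpM2r ?v0 // ler_nat ltnW.
    by move: vL; rewrite natrM; lra.
  have e : q%:R * (h%:R * y - A%:~R) = (a * h%:Z - q%:Z * A)%:~R + h%:R * (q%:R * y - a%:~R).
    by rewrite intrB !intrM -!pmulrn; ring.
  have h1 : m%:R <= `|(a * h%:Z - q%:Z * A)%:~R| :> R.
    by rewrite -intr_norm -natr_absz ler_nat key.
  have h2 : m%:R - 1 / 2 <= q%:R * `|h%:R * y - A%:~R|.
    rewrite -[q%:R]ger0_norm ?(ltW qR) // -normrM e.
    apply: le_trans (lerB_normD _ _); rewrite normrM [`|h%:R|]ger0_norm // -/v; lra.
  have h3 : 1 <= m%:R :> R by rewrite ler1n.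
  by rewrite invfM mulrA ler_pdivrMr // mulrC; lra.
move=> hd; have : dker l (h%:R * y) <= 2 * q%:R * m%:R^-1.
  rewrite -ler_pdivlMr ?divr_gt0 ?mulr_gt0 // in hd *.
  by apply: le_trans hd _; rewrite div1r invf_div.
move/le_trans; apply; rewrite ler_wpM2l ?mulr_ge0 ?(ltW qR) //.
by rewrite /m; case: leqP => _; [rewrite lerDl|rewrite lerDr]; rewrite invr_ge0.
Qed.

(** Each residue occurs at most [L / q + 1] times, and [(L / q + 1) q <= 3 L] because [q <= 2 L].
    The harmonic sum is bounded by [q^th / th]. *)
Lemma sum_dker_nondiv :
  \sum_(1 <= h < L | ~~ (q %| h)%N) dker (L - h) (h%:R * y) <= 12 * L%:R * q%:R `^ th / th.
Proof.
have /andP[th0 th1] := th01.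
pose Phi (r : nat) : R := 2 * q%:R * (r%:R^-1 + (q - r)%N%:R^-1).
have Phi0 r : 0 <= Phi r by rewrite /Phi mulr_ge0 ?mulr_ge0 ?addr_ge0 ?invr_ge0.
apply: (@le_trans _ _ (\sum_(1 <= h < L) \sum_(1 <= r < q) (res_mul a q h == r)%:R * Phi r)).
  rewrite big_mkcond big_nat [leRHS]big_nat; apply: ler_sum => h hL.
  case: ifP => qh; last by apply: sumr_ge0 => r _; rewrite mulr_ge0.
  have [rq /le_trans] := dker_nondiv (L - h) hL qh; apply.
  rewrite (bigD1_seq (res_mul a q h)) /= ?mem_index_iota ?iota_uniq //.
  by rewrite eqxx mul1r lerDl sumr_ge0 // => r _; rewrite mulr_ge0.
rewrite exchange_big /=.
apply: (@le_trans _ _ (\sum_(1 <= r < q) (L %/ q + 1)%N%:R * Phi r)).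
  apply: ler_sum => r _; rewrite -mulr_suml ler_wpM2r // -natr_sum ler_nat.
  exact: card_res_mul.
rewrite -mulr_sumr.
have -> : \sum_(1 <= r < q) Phi r = 4 * q%:R * \sum_(1 <= r < q) r%:R^-1.
  rewrite -mulr_sumr big_split /= [X in _ + X]big_nat_rev /=.
  have -> : \sum_(1 <= i < q) (q - (1 + q - i.+1))%N%:R^-1 = \sum_(1 <= r < q) r%:R^-1 :> R.
    rewrite big_nat [RHS]big_nat; apply: eq_bigr => r /andP[r0 rq].
    by congr (_%:R^-1); lia.
  ring.
have harm : \sum_(1 <= r < q) r%:R^-1 <= q%:R `^ th / th.
  apply: le_trans (sum_powR_le q th01).
  rewrite big_nat_recr //= -[leLHS]addr0; apply: lerD; rewrite ?powR_ge0 //.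
  rewrite big_nat [leRHS]big_nat; apply: ler_sum => r /andP[r0 _].
  have r1 : 1 <= r%:R :> R by rewrite ler1n.
  by rewrite -powR_inv1 // ler_powR //; lra.
apply: (@le_trans _ _ ((L %/ q + 1)%N%:R * (4 * q%:R * (q%:R `^ th / th)))).
  by rewrite !ler_wpM2l // mulr_ge0.
have h1 : (L %/ q + 1)%N%:R * q%:R <= 3 * L%:R :> R.
  by rewrite -!natrM ler_nat mulnDl mul1n; have := leq_trunc_div L q; lia.
have P0 : 0 <= q%:R `^ th / th by rewrite divr_ge0 ?powR_ge0 // ltW.
have := ler_wpM2r P0 h1; rewrite -[leRHS]mulrA.
move: (q%:R `^ th / th) ((L %/ q + 1)%N%:R : R) (q%:R : R) => P a1 q1 h2; lra.
Qed.

(** The integer [m a] is at distance [m v <= 1 / 2] from [q m y], and every other integer is at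
    least as far. *)
Lemma dker_div (l m : nat) : (0 < m)%N -> (q * m < L)%N ->
  dker l ((q * m)%N%:R * y) * (m%:R * v) <= 1.
Proof.
move=> m0 mL; apply: dker_dist => A.
have mR : 0 < m%:R :> R by rewrite ltr0n.
have mv : m%:R * v <= 1 / 2.
  have : m%:R <= L%:R :> R by rewrite ler_nat; apply: leq_trans (ltnW mL); rewrite leq_pmull.
  move=> /(ler_wpM2r v0); move: vL; rewrite natrM; lra.
have -> : (q * m)%N%:R * y - A%:~R = (m%:Z * a - A)%:~R + m%:R * (q%:R * y - a%:~R).
  by rewrite intrB !intrM -!pmulrn natrM; ring.
have [->|nz] := eqVneq (m%:Z * a - A) 0.
  by rewrite add0r normrM ger0_norm.
have h1 : 1 <= `|(m%:Z * a - A)%:~R| :> R.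
  by rewrite -intr_norm -natr_absz ler1n absz_gt0.
apply: le_trans (lerB_normD _ _); rewrite normrM [`|m%:R|]ger0_norm // -/v; lra.
Qed.

Let u := q%:R + L%:R ^+ 2 * v.
Let u0 : 0 < u. Proof. by rewrite /u ltr_pwDl // mulr_ge0. Qed.

(** For [h = q m] the kernel is at most [L] and at most [1 / (m v)]. If [L^2 v <= q], then [u] is of
    order [q] and the trivial bound over at most [L / q] multiples suffices. Otherwise [u] is of
    order [L^2 v] and the decay in [m] is used. *)
Lemma sum_dker_div :
  \sum_(1 <= h < L | (q %| h)%N) dker (L - h) (h%:R * y) <= 2 / th * L%:R ^+ 2 * u `^ (th - 1).
Proof.
have /andP[th0 th1] := th01.
have -> : L = L.-1.+1 by rewrite prednK.
rewrite (sum_multiples (fun h => dker (L.-1.+1 - h) (h%:R * y))) // prednK //.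
pose J := (L.-1 %/ q)%N.
have Jq : (J * q <= L.-1)%N := leq_trunc_div _ _.
have JL : (J <= L)%N by nia.
have mL m : (0 < m < J.+1)%N -> (q * m < L)%N by move=> /andP[m0 mJ]; nia.
have L2 : 0 < L%:R ^+ 2 :> R by rewrite exprn_gt0.
have thV : 1 <= th^-1 by rewrite invf_ge1.
have [vq|vq] := leP (L%:R ^+ 2 * v) q%:R.
  apply: (@le_trans _ _ (\sum_(1 <= m < J.+1) L%:R)).
    apply: ler_sum => m _; apply: le_trans (dker_le _ _) _.
    by rewrite ler_nat leq_subr.
  rewrite sumr_const_nat subSS subn0 -[leLHS]mulr_natl.
  have h1 : J%:R * q%:R <= L%:R :> R.
    by rewrite -natrM ler_nat; apply: leq_trans Jq (leq_pred L).
  have h2 : q%:R `^ (th - 1) <= 2 * u `^ (th - 1).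
    by apply: powR_doubling => //; rewrite /u; lra.
  have h3 : q%:R^-1 <= q%:R `^ (th - 1).
    rewrite -powR_inv1 ?ler0n // ler_powR ?ler1n //; lra.
  have h4 : J%:R <= L%:R * (2 * u `^ (th - 1)).
    apply: (@le_trans _ _ (L%:R / q%:R)); first by rewrite ler_pdivlMr.
    by rewrite ler_wpM2l // (le_trans h3).
  have := ler_wpM2r (ltW LR) h4; move/le_trans; apply.
  have : 0 <= L%:R ^+ 2 * u `^ (th - 1) by rewrite mulr_ge0 ?powR_ge0 ?ltW.
  move: (u `^ (th - 1)) => U; rewrite expr2; nra.
have vp : 0 < v.
  by rewrite lt_neqAle v0 andbT eq_sym; apply/negP => /eqP e; move: vq; rewrite e mulr0 ltNge ltW.
apply: (@le_trans _ _ (\sum_(1 <= m < J.+1) (L%:R `^ th * v `^ (th - 1)) * m%:R `^ (th - 1))).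
  rewrite big_nat [leRHS]big_nat; apply: ler_sum => m hm; have /andP[m0 _] := hm.
  have mR : 0 < m%:R :> R by rewrite ltr0n.
  set D := dker _ _.
  have D0 : 0 <= D by exact: dker_ge0.
  have D1 : D <= L%:R by apply: le_trans (dker_le _ _) _; rewrite ler_nat leq_subr.
  have D2 : D <= (m%:R * v)^-1.
    by rewrite -div1r ler_pdivlMr ?mulr_gt0 //; apply: dker_div => //; exact: mL.
  (* Interpolating between [L] and [1 / (m v)] produces the weight [m^(th - 1)], whose sum is a
     power instead of a logarithm. *)
  have -> : D = D `^ th * D `^ (1 - th).
    rewrite -powRD; first by rewrite subrKC powRr1.
    by rewrite subrKC oner_eq0.
  rewrite -mulrA; apply: ler_pM; rewrite ?powR_ge0 //.
    by apply: ge0_ler_powR; rewrite ?nnegrE ?(ltW th0).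
  rewrite -powRM ?(ltW vp) ?(ltW mR) // mulrC -[th - 1]opprB powRN -powR_inv1 ?powR_ge0 //.
  rewrite powRAC; apply: ge0_ler_powR; rewrite ?nnegrE ?powR_ge0 //; first by lra.
  by rewrite powR_inv1 // mulr_ge0 ?(ltW vp) ?(ltW mR).
rewrite -mulr_sumr.
apply: (@le_trans _ _ (L%:R `^ th * v `^ (th - 1) * (L%:R `^ th / th))).
  rewrite ler_wpM2l ?mulr_ge0 ?powR_ge0 //; apply: le_trans (sum_powR_le J th01) _.
  rewrite ler_wpM2r ?invr_ge0 ?(ltW th0) //.
  by apply: ge0_ler_powR; rewrite ?nnegrE ?ler_nat ?(ltW th0).
have h2 : (L%:R ^+ 2 * v) `^ (th - 1) <= 2 * u `^ (th - 1).
  by apply: powR_doubling => //; rewrite /u; lra.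
have h5 : L%:R `^ th * L%:R `^ th = L%:R ^+ 2 * (L%:R ^+ 2) `^ (th - 1) :> R.
  rewrite mulr_powRB1 ?(ltW L2) // -powR_mulrn ?(ltW LR) // powRAC powR_mulrn ?powR_ge0 //.
have h6 : (L%:R ^+ 2) `^ (th - 1) * v `^ (th - 1) = (L%:R ^+ 2 * v) `^ (th - 1).
  by rewrite [RHS]powRM ?(ltW L2) ?v0.
have -> : L%:R `^ th * v `^ (th - 1) * (L%:R `^ th / th) =
   L%:R ^+ 2 * ((L%:R ^+ 2 * v) `^ (th - 1)) / th.
  transitivity ((L%:R `^ th * L%:R `^ th) * v `^ (th - 1) / th); first by ring.
  by rewrite h5 -h6; ring.
rewrite mulrAC [leRHS]mulrAC -[leRHS]mulrA.
have -> : 2 / th * (u `^ (th - 1) * L%:R ^+ 2) = L%:R ^+ 2 / th * (2 * u `^ (th - 1)) by ring.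
by rewrite ler_wpM2l // divr_ge0 ?(ltW L2) ?(ltW th0).
Qed.

Lemma weyl_bound_approx (b : int) t : y = 2 * t ->
  normc (wsum L b t) ^+ 2 <= 100 / th * (L%:R ^+ 2 * u `^ (th - 1)).
Proof.
move=> yt; have /andP[th0 th1] := th01.
apply: le_trans (weyl_differencing _ _ _) _; rewrite -yt.
rewrite (bigID (fun h => (q %| h)%N)) /=.
(* The [h] not divisible by [q] contribute [L q^th / th] up to a constant, which is absorbed because
   [q] and [u] are both at most [3 L]. *)
have hB : L%:R * q%:R `^ th <= 3 * (L%:R ^+ 2 * u `^ (th - 1)).
  have L3 : 0 < 3 * L%:R :> R by rewrite mulr_gt0.
  have q3 : q%:R <= 3 * L%:R :> R by rewrite -natrM ler_nat; lia.
  have u3 : u <= 3 * L%:R.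
    have h1 : q%:R <= 2 * L%:R :> R by rewrite -natrM ler_nat.
    have h2 : L%:R ^+ 2 * v <= L%:R / 2.
      by rewrite expr2 -mulrA ler_wpM2l ?(ltW LR) //; move: vL; rewrite natrM; lra.
    have := LR; rewrite /u; lra.
  have e : 3 * L%:R = (3 * L%:R) `^ (1 - th) * (3 * L%:R) `^ th :> R.
    by rewrite -powRD ?subrK ?powRr1 ?(ltW L3) // oner_eq0.
  have h1 : u `^ (1 - th) * q%:R `^ th <= 3 * L%:R.
    rewrite e; apply: ler_pM; rewrite ?powR_ge0 //.
      by apply: ge0_ler_powR; rewrite ?nnegrE ?(ltW u0) ?(ltW L3) //; lra.
    by apply: ge0_ler_powR; rewrite ?nnegrE ?ler0n ?(ltW L3) //; lra.
  rewrite -[th - 1]opprB powRN mulrA ler_pdivlMr ?powR_gt0 //.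
  have := ler_wpM2l (ltW LR) h1; rewrite expr2; move: (u `^ _) (q%:R `^ th) => A B; lra.
have h1 := sum_dker_nondiv; have h2 := sum_dker_div.
have hq : 1 <= q%:R `^ th by rewrite -[leLHS](powRr0 q%:R) ler_powR ?ler1n // ltW.
have thV : 1 <= th^-1 by rewrite invf_ge1.
set W := L%:R ^+ 2 * u `^ (th - 1) in hB h2 *.
have hL : L%:R <= L%:R * q%:R `^ th by rewrite ler_peMr ?(ltW LR).
have W0 : 0 <= W by rewrite /W mulr_ge0 ?powR_ge0.
have h3 : 12 * L%:R * q%:R `^ th / th <= 36 * W / th.
  by rewrite ler_wpM2r ?invr_ge0 ?(ltW th0) //; lra.
have h4 : W <= W / th by rewrite ler_peMr.
have e2 : 2 / th * L%:R ^+ 2 * u `^ (th - 1) = 2 * (W / th) by rewrite /W; ring.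
rewrite e2 in h2; have e3 : 36 * W / th = 36 * (W / th) by ring.
rewrite e3 in h3.
have -> : 100 / th * W = 100 * (W / th) by ring.
move: (W / th) h1 h2 h3 h4 => Z h1 h2 h3 h4; lra.
Qed.
End Approximation.

(** The quantifier on [b] comes after [q] and [a], so one approximation of [2 t] serves both
    coordinates of the plane. *)
Lemma weyl_bound th t (L : nat) : 0 < th <= 1 -> (0 < L)%N ->
  exists q : nat, exists a : int, (0 < q)%N /\ forall b,
    normc (wsum L b t) ^+ 2 <=
      100 / th * (L%:R ^+ 2 * (q%:R + L%:R ^+ 2 * `|q%:R * (2 * t) - a%:~R|) `^ (th - 1)).
Proof.
move=> th01 L0; have L2 : (0 < 2 * L)%N by rewrite muln_gt0.
have [q [a [/andP[q0 q2] co h]]] := dirichlet_approx (2 * t) L2.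
by exists q, a; split => // b; apply: weyl_bound_approx.
Qed.
End Weyl.

(** * Large values *)

Section Plancherel.
Context {R : realType}.
Implicit Types x y t : R.
Local Notation normc := (@Normc.normc R).
Local Notation Re := (@complex.Re R).

Lemma sum_ee_orth (M : nat) (d : int) : (0 < M)%N ->
  \sum_(0 <= l < M) ee (l%:R * (d%:~R / M%:R)) =
  (if (M %| d)%Z then M%:R else 0 : R)%:C%C.
Proof.
move=> M0; have MR : M%:R != 0 :> R by rewrite pnatr_eq0 -lt0n.
case: ifPn => [/dvdzP[k ->]|nd].
  rewrite (eq_bigr (fun=> 1)) => [|l _].
    by rewrite big_const_nat subn0 iter_addr_0 rmorph_nat.
  rewrite intrM -pmulrn mulfK //.
  by rewrite ee_natmul ee_int expr1n.
set y := d%:~R / M%:R.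
apply/eqP; rewrite rmorph0.
have zM : ee y ^+ M = 1.
  by rewrite -ee_natmul /y mulrCA divff // mulr1 ee_int.
have z1 : 1 - ee y != 0.
  apply/negP => /eqP z0.
  pose A := Num.floor (y + 1 / 2).
  have Ay : `|y - A%:~R| <= 1 / 2.
    have := floor_le_tmp (y + 1 / 2); have := floorD1_gt (y + 1 / 2).
    rewrite -/A intrD => h1 h2; rewrite ler_norml; apply/andP; split; lra.
  have := normc_1Bee Ay; rewrite -(eeDint (y - _) A) subrK z0 Normc.normc0.
  have := normr_ge0 (y - A%:~R) => h1 h2.
  have /eqP : `|y - A%:~R| = 0 by lra.
  rewrite normr_eq0 subr_eq0 /y => /eqP e.
  have : d%:~R = (A * M%:Z)%:~R :> R by rewrite intrM -pmulrn -e divfK.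
  move/eqP; rewrite eqr_int => /eqP dA.
  by move: nd; rewrite dA dvdz_mull.
rewrite -(mulrI_eq0 _ (lregP z1)) big_mkord; apply/eqP.
under eq_bigr do rewrite ee_natmul.
by rewrite -opprB mulNr -subrX1 zM subrr oppr0.
Qed.

(** Since [phi] may repeat values modulo [M], the diagonal is replaced by the congruent pairs; the
    multiplicity of the frequencies enters here. *)
Lemma plancherel (T : finType) (phi : T -> int) (a : T -> R[i]) (M : nat) : (0 < M)%N ->
  \sum_(0 <= j < M) normc (\sum_x a x * ee (j%:R * ((phi x)%:~R / M%:R))) ^+ 2 =
  M%:R * \sum_x \sum_(x' | (M %| phi x - phi x')%Z) Re (a x * conjc (a x')).
Proof.
move=> M0.
transitivity (\sum_(0 <= j < M) \sum_x \sum_x'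
   Re (a x * conjc (a x') * ee (j%:R * ((phi x - phi x')%:~R / M%:R)))).
  apply: eq_bigr => j _; rewrite sqr_normc_sum; apply: eq_bigr => x _; apply: eq_bigr => x' _.
  rewrite conjcM conjc_ee mulrACA -eeD; congr (Re (_ * ee _)).
  by rewrite intrB; ring.
rewrite exchange_big mulr_sumr; apply: eq_bigr => x _ /=.
rewrite exchange_big mulr_sumr [RHS]big_mkcond; apply: eq_bigr => x' _ /=.
rewrite -Re_sum -mulr_sumr sum_ee_orth //; case: ifP => _.
  by case: (a x * _) => u v /=; ring.
by case: (a x * _) => u v /=; ring.
Qed.

End Plancherel.

(** * Counting pairs whose difference is close to a rational with small denominator *)

Section PairCount.
Context {R : realType}.
Local Notation normc := (@Normc.normc R).
Local Notation Re := (@complex.Re R).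
Variables (M : nat) (E : {set 'I_M}).

Definition fhat (k : int) : R[i] := \sum_(j in E) ee (k%:~R * (j%:R / M%:R)).

Lemma normc_fhat_le k : normc (fhat k) <= #|E|%:R.
Proof.
apply: le_trans (normc_sum_le _ _ _) _.
under eq_bigr do rewrite normc_ee.
by rewrite sumr_const.
Qed.

Lemma normc_fhatN k : normc (fhat (- k)) = normc (fhat k).
Proof.
rewrite -[RHS]normc_conjc /fhat conjc_sum; congr normc; apply: eq_bigr => j _.
by rewrite conjc_ee intrN mulNr.
Qed.

Lemma parseval : (0 < M)%N ->
  \sum_(0 <= l < M) normc (fhat l%:Z) ^+ 2 = M%:R * #|E|%:R.
Proof.
move=> M0.
pose a (j : 'I_M) : R[i] := if j \in E then 1 else 0.
transitivity (\sum_(0 <= l < M) normc (\sum_(j < M) a j * ee (l%:R * ((j%:Z)%:~R / M%:R))) ^+ 2).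
  apply: eq_bigr => l _; rewrite /fhat big_mkcond; congr (normc _ ^+ 2).
  by apply: eq_bigr => j _; rewrite /a; case: ifP; rewrite ?mul1r ?mul0r -?pmulrn.
rewrite plancherel //; congr (_ * _).
transitivity (\sum_(j < M) Re (a j * conjc (a j))).
  apply: eq_bigr => j _; rewrite (big_pred1 j) // => j' /=.
  rewrite -eqz_mod_dvd !modz_nat !modn_small //; apply/eqP/eqP => [[]/val_inj ->|->] //.
rewrite -sum1_card natr_sum [RHS]big_mkcond; apply: eq_bigr => j _.
by rewrite /a; case: ifP => _ /=; ring.
Qed.

Lemma sum_even_parseval (X : nat) : (2 * X < M)%N ->
  \sum_(1 <= l < X.+1) normc (fhat (2 * l%:Z)) ^+ 2 <= M%:R * #|E|%:R.
Proof.
move=> XM; rewrite -parseval ?(leq_trans _ XM) //.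
have h := sum_multiples (fun l => normc (fhat l%:Z) ^+ 2) (2 * X) (ltn0Sn 1).
rewrite mulKn // in h.
under eq_bigr => l _ do rewrite -PoszM.
rewrite -h big_mkcond.
apply: (@le_trans _ _ (\sum_(1 <= l < (2 * X).+1) normc (fhat l%:Z) ^+ 2)).
  by apply: ler_sum => l _; case: ifP => _ //; exact: sqr_ge0.
rewrite [leRHS](@big_cat_nat _ _ _ 1) //=; last exact: leq_trans XM.
rewrite [X in _ <= _ + X](@big_cat_nat _ _ _ (2 * X).+1) //=.
rewrite addrCA lerDl addr_ge0 //; apply: sumr_ge0 => l _; exact: sqr_ge0.
Qed.

(** The squared kernel is a sum over [k, k' < H] of exponentials at the frequencies [q (k - k')], so
    the sum over [E * E] becomes a sum of [|fhat|^2]. A given difference occurs at most [H] times,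
    and the two signs give the factor [2]. *)
Lemma sum_dker_sqr (H : nat) (q : int) :
  \sum_(j in E) \sum_(j' in E) dker H (q%:~R * ((j%:R - j'%:R) / M%:R)) ^+ 2 <=
  2 * H%:R * \sum_(0 <= k < H) normc (fhat (q * k%:Z)) ^+ 2 :> R.
Proof.
have sym k k' : normc (fhat (q * (k%:Z - k'%:Z))) ^+ 2 = normc (fhat (q * (k'%:Z - k%:Z))) ^+ 2.
  by rewrite -normc_fhatN -mulrN opprB.
have -> : \sum_(j in E) \sum_(j' in E) dker H (q%:~R * ((j%:R - j'%:R) / M%:R)) ^+ 2 =
    \sum_(0 <= k < H) \sum_(0 <= k' < H) normc (fhat (q * (k%:Z - k'%:Z))) ^+ 2.
  transitivity (\sum_(j in E) \sum_(j' in E) \sum_(0 <= k < H) \sum_(0 <= k' < H)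
     Re (ee ((q * (k%:Z - k'%:Z))%:~R * ((j%:R - j'%:R) / M%:R)))).
    apply: eq_bigr => j _; apply: eq_bigr => j' _; rewrite /dker big_mkord sqr_normc_sum big_mkord.
    apply: eq_bigr => k _; rewrite big_mkord; apply: eq_bigr => k' _.
    by rewrite conjc_ee -eeD intrM intrB -!pmulrn; congr (Re (ee _)); ring.
  under eq_bigr => j _ do rewrite exchange_big /=.
  rewrite exchange_big /=; apply: eq_bigr => k _.
  under eq_bigr => j _ do rewrite exchange_big /=.
  rewrite exchange_big /=; apply: eq_bigr => k' _.
  rewrite sqr_normcE /fhat conjc_sum mulr_suml Re_sum; apply: eq_bigr => j _.
  rewrite mulr_sumr Re_sum; apply: eq_bigr => j' _.
  by rewrite conjc_ee -eeD; congr (Re (ee _)); ring.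
rewrite (sum_square_diff _ sym).
have -> : \sum_(0 <= n < H) normc (fhat (q * (n%:Z - n%:Z))) ^+ 2 = H%:R * normc (fhat (q * 0%:Z)) ^+ 2.
  under eq_bigr do rewrite subrr.
  by rewrite big_const_nat subn0 iter_addr_0 mulr_natl.
rewrite -[_ *+ 2]mulr_natl.
have [->|H0] := posnP H; first by rewrite !big_geq // !mulr0 mul0r addr0.
rewrite [X in _ <= _ * X]big_ltn // mulrDr -mulrA; apply: lerD.
  by rewrite ler_peMl // ?ler1n // mulr_ge0 ?sqr_ge0.
rewrite -?mulrA ler_wpM2l // mulr_sumr; rewrite big_nat [leRHS]big_nat; apply: ler_sum => h /andP[h0 hH].
apply: (@le_trans _ _ (\sum_(0 <= m < H - h) normc (fhat (q * h%:Z)) ^+ 2)).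
  by apply: ler_sum => m _; rewrite PoszD addrC addKr.
rewrite big_const_nat subn0 iter_addr_0 -[_ *+ _]mulr_natl ler_wpM2r ?sqr_ge0 //.
by rewrite ler_nat leq_subr.
Qed.


(** Within [1 / (8 H)] of an integer all terms of the kernel have an argument of at most [pi / 4] in
    absolute value, hence a real part of at least [cos (pi / 4)]. *)
Lemma dker_ge (H : nat) (y : R) (a : int) :
  `|y - a%:~R| * (8 * H)%N%:R <= 1 -> H%:R ^+ 2 / 2 <= dker H y ^+ 2.
Proof.
move=> hy; set x := y - a%:~R in hy.
have p0 := @pi_gt0 R.
have cosh : cos (pi / 4) ^+ 2 = 2^-1 :> R.
  have := cos_mulr2n (pi / 4 : R).
  have -> : (pi / 4) *+ 2 = pi / 2 :> R by rewrite mulr2n; field.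
  rewrite cos_pihalf mulr2n; lra.
have c4 : 0 <= cos (pi / 4 : R) by apply: cos_ge0_pihalf; apply/andP; split; lra.
have h1 : H%:R * cos (pi / 4) <= dker H y.
  apply: le_trans (Re_le_normc _); rewrite Re_sum.
  have -> : H%:R * cos (pi / 4) = \sum_(0 <= m < H) cos (pi / 4) :> R.
    by rewrite big_const_nat subn0 iter_addr_0 mulr_natl.
  rewrite big_nat [leRHS]big_nat; apply: ler_sum => m /andP[_ mH].
  have -> : ee (m%:R * y) = ee (m%:R * x).
    by rewrite !ee_natmul /x -(eeDint (y - _) a) subrK.
  have mx : m%:R * `|x| <= 1 / 8.
    have : m%:R <= H%:R :> R by rewrite ler_nat ltnW.
    move=> /(ler_wpM2r (normr_ge0 x)); move: hy; rewrite natrM; lra.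
  have -> : Re (ee (m%:R * x)) = cos (2 * pi * (m%:R * `|x|)).
    rewrite /= -[LHS]cos_norm; congr cos; rewrite !normrM.
    by rewrite ger0_norm // [`|pi|]ger0_norm ?ltW // [`|m%:R|]ger0_norm.
  have m0 : 0 <= m%:R * `|x| by rewrite mulr_ge0.
  move: (m%:R * `|x|) m0 mx => z z0 z1.
  rewrite leNgt ltr_cos ?in_itv /= -?leNgt; [nra|..]; apply/andP; split; nra.
have h0 : 0 <= H%:R * cos (pi / 4) :> R by rewrite mulr_ge0.
rewrite -cosh -exprMn ler_sqr ?nnegrE //; exact: le_trans h0 h1.
Qed.


(** The index [k = 0] gives the first term. For the other ones, a frequency [2 l] with [l = q k] has
    a weight of at most [d = truncdiv U l]. Where [d <= T], Parseval gives the second term; where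
    [d > T], one uses [d <= d^(B + 1) / T^B], the trivial bound on [fhat] and the moment
    hypothesis. *)
Lemma sum_fhat_multiples (U H : nat) (eps T : R) (B : nat) (C : R) : (0 < U)%N -> (0 < H)%N ->
  0 < T -> (2 * (U * H) < M)%N ->
  (\sum_(1 <= l < (U * H).+1) truncdiv U l ^ B.+1)%N%:R <= C * (U * H)%N%:R * U%:R `^ eps ->
  \sum_(1 <= q < U.+1) \sum_(0 <= k < H) normc (fhat (2 * q%:Z * k%:Z)) ^+ 2 <=
  U%:R * #|E|%:R ^+ 2 + T * M%:R * #|E|%:R +
  C * (U * H)%N%:R * U%:R `^ eps / T ^+ B * #|E|%:R ^+ 2.
Proof.
move=> U0 H0 T0 UHM mom.
pose g (l : nat) : R := normc (fhat (2 * l%:Z)) ^+ 2.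
have g0 l : 0 <= g l by exact: sqr_ge0.
have gE l : g l <= #|E|%:R ^+ 2.
  by rewrite ler_sqr ?nnegrE ?normc_ge0 // normc_fhat_le.
apply: (@le_trans _ _ (U%:R * #|E|%:R ^+ 2 + \sum_(1 <= l < (U * H).+1) (truncdiv U l)%:R * g l)).
  under eq_bigr => q _ do rewrite big_ltn //.
  rewrite big_split /=; apply: lerD.
    apply: (@le_trans _ _ (\sum_(1 <= q < U.+1) #|E|%:R ^+ 2)).
      by apply: ler_sum => q _; rewrite ler_sqr ?nnegrE ?normc_ge0 // normc_fhat_le.
    by rewrite sumr_const_nat subSS subn0 -[leLHS]mulr_natl.
  have -> : \sum_(1 <= l < (U * H).+1) (truncdiv U l)%:R * g l =
     \sum_(1 <= q < U.+1) \sum_(1 <= l < (U * H).+1 | (q %| l)%N) g l.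
    under eq_bigr => l _ do rewrite truncdivE natr_sum mulr_suml.
    rewrite exchange_big /=; apply: eq_bigr => q _.
    rewrite [RHS]big_mkcond; apply: eq_bigr => l _.
    by case: (q %| l)%N; rewrite ?mul1r ?mul0r.
  rewrite big_nat [leRHS]big_nat; apply: ler_sum => q /andP[q0 qU].
  rewrite sum_multiples // [leRHS](@big_cat_nat _ _ _ H) //=; last first.
    by rewrite ltnW // ltnS leq_divRL // mulnC leq_mul2r -ltnS qU orbT.
  rewrite -[leLHS]addr0; apply: lerD; last by apply: sumr_ge0.
  by apply: ler_sum => k _; rewrite /g PoszM mulrA.
rewrite -addrA lerD2l.
apply: (@le_trans _ _ (\sum_(1 <= l < (U * H).+1)
   (T * g l + (truncdiv U l ^ B.+1)%N%:R / T ^+ B * #|E|%:R ^+ 2))).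
  apply: ler_sum => l _; set d := (truncdiv U l)%:R; have d0 : 0 <= d by rewrite ler0n.
  have TB : 0 < T ^+ B by rewrite exprn_gt0.
  have [dT|dT] := leP d T.
    rewrite -[leLHS]addr0; apply: lerD; first by rewrite ler_wpM2r.
    by rewrite mulr_ge0 ?sqr_ge0 // divr_ge0 // ltW.
  rewrite -[leLHS]add0r; apply: lerD; first by rewrite mulr_ge0 // ltW.
  apply: ler_pM => //; rewrite natrX -/d ler_pdivlMr // exprS ler_wpM2l //.
  by rewrite lerXn2r ?nnegrE // ltW.
rewrite big_split /= -mulr_sumr -!mulr_suml -natr_sum; apply: lerD.
  by rewrite -mulrA ler_wpM2l ?(ltW T0) // sum_even_parseval.
by rewrite ler_wpM2r ?sqr_ge0 // ler_wpM2r // invr_ge0 exprn_ge0 // ltW.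
Qed.

(** For a pair of [P] the squared kernel is at least [H^2 / 2] for some [q <= U], so the indicator
    of [P] is dominated by a sum over all [q <= U]. The constant [4 / H] is [2 / H^2] times the
    [2 H] of [sum_dker_sqr]. *)
Lemma pair_count (U H : nat) (P : {pred 'I_M * 'I_M}) : (0 < U)%N -> (0 < H)%N ->
  (forall p, p \in P -> [/\ p.1 \in E, p.2 \in E & exists q : nat, exists a : int,
     (0 < q <= U)%N /\
     `|q%:R * (2 * ((p.1%:R - p.2%:R) / M%:R)) - a%:~R| * (8 * H)%N%:R <= 1 :> R]) ->
  #|P|%:R <= 4 / H%:R * \sum_(1 <= q < U.+1) \sum_(0 <= k < H) normc (fhat (2 * q%:Z * k%:Z)) ^+ 2.
Proof.
move=> U0 H0 hP; have HR : 0 < H%:R :> R by rewrite ltr0n.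
pose D (q : nat) (j j' : 'I_M) : R := dker H ((2 * q%:Z)%:~R * ((j%:R - j'%:R) / M%:R)) ^+ 2.
have D0 q j j' : 0 <= D q j j' by exact: sqr_ge0.
apply: (@le_trans _ _ (\sum_(j in E) \sum_(j' in E) \sum_(1 <= q < U.+1) 2 / H%:R ^+ 2 * D q j j')).
  rewrite pair_big_dep /= -sum1_card natr_sum big_mkcond [leRHS]big_mkcond /=.
  apply: ler_sum => -[j j'] _ /=; case: ifP => [/hP/=[-> -> [q [a [/andP[q0 qU] h]]]]|_] /=.
    rewrite (bigD1_seq q) /= ?mem_index_iota ?iota_uniq ?q0 ?ltnS //.
    rewrite -[leLHS]addr0; apply: lerD; last first.
      by apply: sumr_ge0 => q' _; rewrite mulr_ge0 // divr_ge0 // exprn_ge0 // ltW.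
    have : H%:R ^+ 2 / 2 <= D q j j'.
      apply: (@dker_ge _ _ a); rewrite intrM -!pmulrn; apply: le_trans h.
      by rewrite [_ * q%:R]mulrC -mulrA.
    have : 0 < H%:R ^+ 2 :> R by rewrite exprn_gt0.
    move: (H%:R ^+ 2 : R) => h2 h20 hh; rewrite mulrAC ler_pdivlMr //; lra.
  case: ifP => // _; apply: sumr_ge0 => q _; rewrite mulr_ge0 // divr_ge0 // exprn_ge0 // ltW.
under eq_bigr => j _ do rewrite exchange_big /=.
rewrite exchange_big /= mulr_sumr; apply: ler_sum => q _.
under eq_bigr => j _ do rewrite -mulr_sumr.
rewrite -mulr_sumr.
apply: le_trans (ler_wpM2l _ (sum_dker_sqr H (2 * q%:Z))) _.
  by rewrite divr_ge0 // exprn_ge0 // ltW.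
rewrite le_eqVlt; apply/orP; left; apply/eqP; rewrite expr2; field; by rewrite gt_eqF.
Qed.
End PairCount.

Section Dyadic.
Context {R : realType}.
Implicit Types (th u : R).

(** The term with the least [2^i >= u] already suffices: it is less than [2 u] unless [u = 1]. This
    form turns a decreasing power of [u] into counts of [u <= 2^i]. *)
Lemma dyadic_powR_le th u (n : nat) : 0 < th <= 1 -> 1 <= u <= (2 ^ n)%N%:R ->
  u `^ (th - 1) <=
  \sum_(i < n.+1) 2 * (2 ^ i)%N%:R `^ (th - 1) * (u <= (2 ^ i)%N%:R)%R%:R.
Proof.
move=> th01; have t0 i : 0 <= 2 * (2 ^ i)%N%:R `^ (th - 1) * (u <= (2 ^ i)%N%:R)%R%:R.
  by rewrite !mulr_ge0 ?powR_ge0.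
elim: n => [|n IH] /andP[u1 un].
  have -> : u = 1 by apply/eqP; rewrite eq_le un u1.
  by rewrite big_ord_recr big_ord0 /= expn0 powR1 lexx /= mulr1 mulr1 add0r ler1n.
rewrite big_ord_recr /=; have [un'|un'] := leP u (2 ^ n)%N%:R.
  by rewrite -[leLHS]addr0 lerD // IH // u1.
rewrite un mulr1 -[leLHS]add0r; apply: lerD; first by apply: sumr_ge0.
apply: (powR_doubling th01); first by rewrite ltr0n expn_gt0.
by rewrite expnS natrM ler_wpM2l // ltW.
Qed.

Lemma sum_pow2_powR th (n : nat) : 0 < th ->
  \sum_(i < n.+1) (2 ^ i)%N%:R `^ th <= 2 `^ th / (2 `^ th - 1) * (2 ^ n)%N%:R `^ th :> R.
Proof.
move=> th0; set rho := 2 `^ th.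
have e i : (2 ^ i)%N%:R `^ th = rho ^+ i :> R.
  by rewrite natrX -powR_mulrn // powRAC powR_mulrn ?powR_ge0.
have rho1 : 1 < rho.
  by rewrite /rho -[ltLHS](powRr0 2) /powR gt_eqF // ltr_expR ltr_pM2r // ln_gt0 // ltr1n.
under eq_bigr => i _ do rewrite e.
rewrite e mulrAC ler_pdivlMr ?subr_gt0 // mulrC -subrX1 exprS lerBlDr lerDl; exact: ler01.
Qed.

Lemma dyadic_ceil (Q : R) : 1 <= Q -> exists n : nat, Q <= (2 ^ n)%N%:R <= 2 * Q.
Proof.
move=> Q1; have Q0 : 0 <= Q by lra.
pose m := Num.truncn Q.
have /andP[mQ Qm] : m%:R <= Q < m.+1%:R := truncn_itv Q0.
have m0 : (0 < m)%N by rewrite truncn_gt0.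
exists (trunc_log 2 m).+1; apply/andP; split.
  by apply: (le_trans (ltW Qm)); rewrite ler_nat trunc_log_ltn.
rewrite expnS natrM ler_wpM2l //; apply: le_trans mQ.
by rewrite ler_nat trunc_logP.
Qed.
End Dyadic.

Section LargeValues.
Context {R : realType}.
Local Notation normc := (@Normc.normc R).
Variables (M L : nat) (E : {set 'I_M}).
Variables (q : 'I_M -> 'I_M -> nat) (a : 'I_M -> 'I_M -> int).
Hypotheses (L0 : (0 < L)%N) (LM : (L ^ 2 <= M)%N) (q0 : forall j j', (0 < q j j')%N).

Let u (j j' : 'I_M) : R := (q j j')%:R +
  L%:R ^+ 2 * `|(q j j')%:R * (2 * ((j%:R - j'%:R) / M%:R)) - (a j j')%:~R|.

Let LR : 0 < L%:R ^+ 2 :> R. Proof. by rewrite exprn_gt0 ?ltr0n. Qed.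
Let e2 : 0 <= #|E|%:R ^+ 2 :> R. Proof. by rewrite exprn_ge0. Qed.

Let u_ge1 j j' : 1 <= u j j'.
Proof. by rewrite /u -[leLHS]addr0 lerD ?ler1n // mulr_ge0 // ltW. Qed.

Lemma scale_count (U B : nat) (T C1 : R) : (0 < U)%N -> (8 * U <= L ^ 2)%N -> 0 < T -> 0 < C1 ->
  (forall U X, (0 < U)%N ->
    (\sum_(1 <= l < X.+1) truncdiv U l ^ B.+1)%N%:R <= C1 * X%:R * U%:R `^ 1) ->
  \sum_(j in E) \sum_(j' in E) (u j j' <= U%:R)%R%:R <=
  U%:R * (64 / L%:R ^+ 2 * (U%:R * #|E|%:R ^+ 2 + T * M%:R * #|E|%:R) +
          4 * C1 * U%:R / T ^+ B * #|E|%:R ^+ 2).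
Proof.
move=> U0 UL T0 C10 mom.
(* With this length [u <= U] forces [|2 q t - a| <= U / L^2 <= 1 / (8 H)], as [pair_count] requires,
   while [H >= L^2 / (16 U)] gives [4 / H <= 64 U / L^2]. *)
pose H := (L ^ 2 %/ (8 * U))%N.
have U8 : (0 < 8 * U)%N by rewrite muln_gt0.
have H0 : (0 < H)%N by rewrite divn_gt0.
have HU : (H * (8 * U) <= L ^ 2)%N := leq_trunc_div _ _.
have HL : (L ^ 2 <= 2 * (H * (8 * U)))%N.
  have := ltn_ceil (L ^ 2) U8; rewrite -/H; nia.
have UR : 0 < U%:R :> R by rewrite ltr0n.
have HR : 0 < H%:R :> R by rewrite ltr0n.
have L20 : (0 < L ^ 2)%N by rewrite expn_gt0 L0.
pose P : {pred 'I_M * 'I_M} := [pred p | [&& p.1 \in E, p.2 \in E & u p.1 p.2 <= U%:R]].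
have -> : \sum_(j in E) \sum_(j' in E) (u j j' <= U%:R)%R%:R = #|P|%:R :> R.
  rewrite -sum1_card natr_sum [RHS]big_mkcond pair_big_dep /= [LHS]big_mkcond /=.
  apply: eq_bigr => -[j j'] _ /=.
  have -> : ((j, j') \in P) = [&& j \in E, j' \in E & u j j' <= U%:R] by [].
  by case: (j \in E); case: (j' \in E) => //=; case: (u j j' <= _).
have hP p : p \in P -> [/\ p.1 \in E, p.2 \in E & exists q : nat, exists a : int,
     (0 < q <= U)%N /\
     `|q%:R * (2 * ((p.1%:R - p.2%:R) / M%:R)) - a%:~R| * (8 * H)%N%:R <= 1 :> R].
  case: p => j j' /and3P[/= jE jE' uU]; split => //; exists (q j j'), (a j j').
  have v0 : 0 <= `|(q j j')%:R * (2 * ((j%:R - j'%:R) / M%:R)) - (a j j')%:~R| :> R by [].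
  move: uU; rewrite /u /=; move: v0; set v := `| _ | => v0 uU.
  have Lv : 0 <= L%:R ^+ 2 * v by rewrite mulr_ge0 // ltW.
  rewrite q0 -(ler_nat R) /=; split; first by lra.
  have q1 : 0 <= (q j j')%:R :> R by [].
  have Lv' : L%:R ^+ 2 * v <= U%:R by lra.
  have HUR : H%:R * (8 * U%:R) <= L%:R ^+ 2 :> R by rewrite -natrX -!natrM ler_nat.
  rewrite natrM; have := ler_wpM2r v0 HUR => h.
  rewrite -(ler_pM2r UR) mul1r; lra.
apply: le_trans (pair_count (E := E) U0 H0 hP) _.
have UHM : (2 * (U * H) < M)%N by nia.
have := sum_fhat_multiples E U0 H0 T0 UHM (mom U (U * H)%N U0).
rewrite powRr1 ?ler0n // => /(ler_wpM2l _)-/(_ (4 / H%:R) _)/le_trans; apply.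
  by rewrite divr_ge0 // ltW.
rewrite mulrDr [leRHS]mulrDr; apply: lerD.
  rewrite mulrA ler_wpM2r //.
    by rewrite addr_ge0 // mulr_ge0 // ?mulr_ge0 // ltW.
  rewrite mulrCA mulrA ler_pdivlMr // mulrAC ler_pdivrMr //.
  have : L%:R ^+ 2 <= 2 * (H%:R * (8 * U%:R)) :> R by rewrite -natrX -!natrM ler_nat.
  lra.
rewrite natrM le_eqVlt; apply/orP; left; apply/eqP; field.
by rewrite !gt_eqF // exprn_gt0.
Qed.

(** The pairs with [u > Q] contribute at most [A Q^(th - 1)] times the square of [#|E|], half of the
    left side. The other ones are counted at the scales [2^i <= 2 Q], all within reach of
    [scale_count] by [16 Q <= L^2]; weight times count grows like [2^(i th)], so the largest scale
    dominates. *)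
Lemma large_values_raw (B : nat) (th eta A Q T C1 : R) :
  0 < th <= 1 -> 0 < A -> 0 < eta -> 1 <= Q -> 16 * Q <= L%:R ^+ 2 -> 0 < T -> 0 < C1 ->
  A * Q `^ (th - 1) <= eta / 2 ->
  (forall U X, (0 < U)%N ->
    (\sum_(1 <= l < X.+1) truncdiv U l ^ B.+1)%N%:R <= C1 * X%:R * U%:R `^ 1) ->
  eta * #|E|%:R ^+ 2 <= A * \sum_(j in E) \sum_(j' in E) u j j' `^ (th - 1) ->
  eta * #|E|%:R ^+ 2 <=
    8 * A * (2 `^ th / (2 `^ th - 1)) * Q `^ th *
    (64 / L%:R ^+ 2 * (2 * Q * #|E|%:R ^+ 2 + T * M%:R * #|E|%:R) +
          8 * C1 * Q / T ^+ B * #|E|%:R ^+ 2).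
Proof.
move=> th01 A0 eta0 Q1 QL T0 C10 AQ mom hE; have /andP[th0 th1] := th01.
have [n /andP[Qn nQ]] := dyadic_ceil Q1.
have Q0 : 0 < Q by lra.
set Y := (64 / _ * _ + _).
have Y0 : 0 <= Y.
  rewrite /Y addr_ge0 //; first by rewrite mulr_ge0 ?divr_ge0 ?addr_ge0 ?mulr_ge0 // ltW.
  by rewrite mulr_ge0 // divr_ge0 ?mulr_ge0 ?exprn_ge0 // ltW.
pose c i : R := 2 * (2 ^ i)%N%:R `^ (th - 1).
have c0 i : 0 <= c i by rewrite /c mulr_ge0 ?powR_ge0.
have step1 : \sum_(j in E) \sum_(j' in E) u j j' `^ (th - 1) <=
    #|E|%:R ^+ 2 * Q `^ (th - 1) +
    \sum_(i < n.+1) c i * \sum_(j in E) \sum_(j' in E) (u j j' <= (2 ^ i)%N%:R)%R%:R.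
  apply: (@le_trans _ _ (\sum_(j in E) \sum_(j' in E)
     (Q `^ (th - 1) + \sum_(i < n.+1) c i * (u j j' <= (2 ^ i)%N%:R)%R%:R))).
    apply: ler_sum => j _; apply: ler_sum => j' _.
    have [uQ|uQ] := leP (u j j') Q.
      rewrite -[leLHS]add0r lerD ?powR_ge0 // dyadic_powR_le // u_ge1 /=; exact: le_trans Qn.
    rewrite -[leLHS]addr0 lerD //; last by apply: sumr_ge0 => i _; rewrite mulr_ge0.
    rewrite -[th - 1]opprB !powRN lef_pV2 ?posrE ?powR_gt0 //; last by lra.
    by apply: ge0_ler_powR; rewrite ?nnegrE; lra.
  under eq_bigr => j _ do rewrite big_split /=.
  rewrite big_split /=; apply: lerD.
    under eq_bigr => j _ do rewrite sumr_const.
    by rewrite sumr_const -mulrnA -[leLHS]mulr_natl natrM expr2.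
  rewrite le_eqVlt; apply/orP; left; apply/eqP.
  under eq_bigr => j _ do rewrite exchange_big /=.
  rewrite exchange_big /=; apply: eq_bigr => i _; rewrite mulr_sumr.
  by apply: eq_bigr => j _; rewrite mulr_sumr.
have step2 : \sum_(i < n.+1) c i * \sum_(j in E) \sum_(j' in E) (u j j' <= (2 ^ i)%N%:R)%R%:R <=
    2 * (2 `^ th / (2 `^ th - 1)) * (2 * Q) `^ th * Y.
  apply: (@le_trans _ _ (\sum_(i < n.+1) 2 * (2 ^ i)%N%:R `^ th * Y)).
    apply: ler_sum => i _.
    have iU : (2 ^ i <= 2 ^ n)%N by rewrite leq_exp2l // -ltnS ltn_ord.
    have UL : (8 * 2 ^ i <= L ^ 2)%N.
      rewrite -(ler_nat R) natrX natrM; move: iU; rewrite -(ler_nat R); lra.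
    have U0 : (0 < 2 ^ i)%N by rewrite expn_gt0.
    have := scale_count U0 UL T0 C10 mom.
    move=> /(ler_wpM2l (c0 i))/le_trans; apply.
    have UR : 0 < (2 ^ i)%N%:R :> R by rewrite ltr0n.
    have UQ : (2 ^ i)%N%:R <= 2 * Q by apply: le_trans nQ; rewrite ler_nat.
    rewrite mulrA /c; have -> : 2 * (2 ^ i)%N%:R `^ (th - 1) * (2 ^ i)%N%:R = 2 * (2 ^ i)%N%:R `^ th :> R.
      by rewrite -mulrA [_ * (2 ^ i)%N%:R]mulrC mulr_powRB1 // ltW.
    rewrite ler_wpM2l ?mulr_ge0 ?powR_ge0 // /Y lerD //.
      rewrite ler_wpM2l ?divr_ge0 ?(ltW LR) // lerD2r ler_wpM2r //.
    rewrite ler_wpM2r // ler_wpM2r ?invr_ge0 ?exprn_ge0 ?(ltW T0) //.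
    have := ler_wpM2l (ltW C10) UQ; lra.
  rewrite -mulr_suml -mulr_sumr ler_wpM2r // -mulrA ler_wpM2l //.
  apply: le_trans (sum_pow2_powR n th0) _.
  have rho1 : 1 < 2 `^ th :> R.
    by rewrite -[ltLHS](powRr0 2) /powR gt_eqF // ltr_expR ltr_pM2r // ln_gt0 // ltr1n.
  rewrite ler_wpM2l //; first by rewrite divr_ge0 ?powR_ge0 // subr_ge0 ltW.
  by apply: ge0_ler_powR; rewrite ?nnegrE ?(ltW th0) //; lra.
have h3 : 2 `^ th <= 2 :> R by rewrite ler1_powR // ler1n.
have rho1 : 1 < 2 `^ th :> R.
  by rewrite -[ltLHS](powRr0 2) /powR gt_eqF // ltr_expR ltr_pM2r // ln_gt0 // ltr1n.
have G0 : 0 <= 2 `^ th / (2 `^ th - 1) :> R by rewrite divr_ge0 ?powR_ge0 // subr_ge0 ltW.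
rewrite powRM ?(ltW Q0) // in step2.
have step3 := le_trans hE (ler_wpM2l (ltW A0) (le_trans step1 (lerD (lexx _) step2))).
have h4 := ler_wpM2r e2 AQ.
have W0 : 0 <= A * (2 `^ th / (2 `^ th - 1)) * Q `^ th * Y.
  exact: mulr_ge0 (mulr_ge0 (mulr_ge0 (ltW A0) G0) (powR_ge0 _ _)) Y0.
have h5 := ler_wpM2r W0 h3.
move: step3 h4 h5; set G := 2 `^ th / (2 `^ th - 1).
lra.
Qed.
End LargeValues.

Section LargeValuesA.
Context {R : realType}.
Local Notation normc := (@Normc.normc R).

Lemma large_values (kappa : R) : 0 < kappa ->
  exists2 C : R, 0 < C & forall (L M : nat) (b1 b2 : int) (E : {set 'I_M}) (eta : R),
    (0 < L)%N -> (L ^ 2 <= M)%N -> 0 < eta <= 1 -> C <= eta * L%:R `^ (1 / 4) ->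
    eta * L%:R ^+ 2 * #|E|%:R ^+ 2 <=
      \sum_(j in E) \sum_(j' in E)
         normc (wsum L b1 ((j%:R - j'%:R) / M%:R)) * normc (wsum L b2 ((j%:R - j'%:R) / M%:R)) ->
    #|E|%:R <= C * (M%:R / L%:R ^+ 2) * eta `^ (- (1 + kappa)).
Proof.
move=> k0.
(* The final exponent of [w] is [2 th + 4 / B], and [th] and [B] each take half of [kappa];
   [th <= 1 / 2] ensures [Q <= w^2]. *)
pose th : R := Num.min (1 / 2) (kappa / 4).
have th0 : 0 < th by rewrite lt_min !divr_gt0.
have th2 : th <= 1 / 2 by rewrite ge_min lexx.
have thk : th <= kappa / 4 by rewrite ge_min lexx orbT.
have th01 : 0 < th <= 1 by apply/andP; split; lra.
pose B := (Num.truncn (8 / kappa)).+1.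
have B0 : 0 < B%:R :> R by rewrite ltr0n.
have Bk : 4 / B%:R <= kappa / 2.
  have : 8 / kappa <= B%:R by rewrite ltW // truncnS_gt.
  rewrite ler_pdivrMr // ler_pdivrMr // => h; lra.
clearbody B.
pose A : R := 100 / th.
have A0 : 0 < A by rewrite divr_gt0.
have A1 : 1 <= 2 * A by rewrite /A mulrA ler_pdivlMr //; lra.
have AE : A = 100 / th by [].
clearbody A.
have [C1 C10 mom] := @truncdiv_moment_powR R 1 B.+1 ltr01.
have rho1 : 1 < 2 `^ th :> R.
  by rewrite -[ltLHS](powRr0 2) /powR gt_eqF // ltr_expR ltr_pM2r // ln_gt0 // ltr1n.
pose K := 8 * A * (2 `^ th / (2 `^ th - 1)).
have G0 : 0 < 2 `^ th / (2 `^ th - 1) :> R by rewrite divr_gt0 ?subr_gt0 ?powR_gt0.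
have K0 : 0 < K by apply: mulr_gt0 G0; exact: mulr_gt0.
pose T1 := 1 + 16 * K * C1 / A.
have KE : K = 8 * A * (2 `^ th / (2 `^ th - 1)) by [].
clearbody K.
have T11 : 1 <= T1.
  by rewrite lerDl; apply: divr_ge0 (ltW A0); rewrite !mulr_ge0 ?(ltW K0) ?(ltW C10).
have T10 : 0 < T1 by lra.
have T1E : T1 = 1 + 16 * K * C1 / A by [].
clearbody T1.
pose s := Num.min (A / (256 * K)) (1 / 16).
have K256 : 0 < 256 * K by rewrite mulr_gt0 ?ltr0n.
have s0 : 0 < s by rewrite lt_min (divr_gt0 A0 K256) divr_gt0 ?ltr0n.
have sA : s <= A / (256 * K) by rewrite ge_min lexx.
have s16 : s <= 1 / 16 by rewrite ge_min lexx orbT.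
clearbody s.
pose Ca := 2 * A / s; pose Cb := 128 * K * T1 * (2 * A) `^ kappa.
have Ca0 : 0 < Ca by rewrite divr_gt0 ?mulr_gt0.
have Cb0 : 0 < Cb by rewrite !mulr_gt0 ?powR_gt0 ?mulr_gt0.
exists (Ca + Cb) => [|L M b1 b2 E eta L0 LM /andP[eta0 eta1] CL hE]; first exact: addr_gt0.
have LR : 0 < L%:R :> R by rewrite ltr0n.
have L1 : 1 <= L%:R :> R by rewrite ler1n.
have L2 : 0 < L%:R ^+ 2 :> R by rewrite exprn_gt0.
have MR : 0 <= M%:R :> R by rewrite ler0n.
pose w := 2 * A / eta.
have w1 : 1 <= w by rewrite /w ler_pdivlMr // mul1r; lra.
have w0 : 0 < w := lt_le_trans ltr01 w1.
pose Q := w `^ (1 - th)^-1.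
have th1 : 0 < 1 - th by move: th2; clear; lra.
have Q1 : 1 <= Q by rewrite -[leLHS](powRr0 w) ler_powR // invr_ge0 ltW.
have Q0 : 0 < Q := lt_le_trans ltr01 Q1.
have AQ : A * Q `^ (th - 1) = eta / 2.
  rewrite -[th - 1]opprB powRN -powRrM mulVf ?gt_eqF // powRr1 ?(ltW w0) // /w.
  by field; rewrite !gt_eqF.
have Qw : Q <= w `^ 2.
  by rewrite ler_powR // -[leRHS]invrK lef_pV2 ?posrE ?invr_gt0 //; lra.
(* The lower bound on [eta] enters here: [Q^2 <= w^4] is a constant times [eta^(-4)], and
   [Ca <= eta L^(1/4)] turns it into [s^4 L <= s L^2]. *)
have QL : Q ^+ 2 <= s * L%:R ^+ 2.
  have h1 : Q ^+ 2 <= w ^+ 4.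
    rewrite (_ : w ^+ 4 = (w ^+ 2) ^+ 2); last by ring.
    rewrite lerXn2r ?nnegrE ?sqr_ge0 ?(ltW Q0) //; apply: le_trans Qw _.
    by rewrite powR_mulrn // ltW.
  apply: le_trans h1 _.
  have h2 : Ca ^+ 4 <= eta ^+ 4 * L%:R.
    have -> : L%:R = (L%:R `^ (1 / 4)) ^+ 4 :> R.
      by rewrite -powR_mulrn ?powR_ge0 // -powRrM divfK // powRr1 // ltW.
    rewrite -exprMn lerXn2r ?nnegrE ?(ltW Ca0) //.
      by rewrite mulr_ge0 ?powR_ge0 // ltW.
    by apply: le_trans CL; rewrite lerDl ltW.
  have h3 : w ^+ 4 * eta ^+ 4 = s ^+ 4 * Ca ^+ 4.
    by rewrite /w /Ca; field; rewrite !gt_eqF.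
  have e4 : 0 < eta ^+ 4 by rewrite exprn_gt0.
  rewrite -(ler_pM2r e4) h3.
  apply: (@le_trans _ _ (s ^+ 4 * (eta ^+ 4 * L%:R))).
    by rewrite ler_wpM2l // exprn_ge0 // ltW.
  rewrite [s ^+ 4 * _]mulrCA [leRHS]mulrC ler_wpM2l ?(ltW e4) //.
  apply: ler_pM; rewrite ?exprn_ge0 ?(ltW s0) ?(ltW LR) //.
    by rewrite exprS ler_piMr ?(ltW s0) // exprn_ile1 ?(ltW s0) //; lra.
  by rewrite expr2 ler_peMr // ltW.
have QQ : Q <= Q ^+ 2 by rewrite expr2 ler_peMr // ltW.
have QL16 : 16 * Q <= L%:R ^+ 2.
  by move: (ler_wpM2r (ltW L2) s16) QQ QL; clear; lra.
(* This threshold on the divisor weights costs only [Q^(2 / B)] in the Parseval term, yet [T^B]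
   reaches [T1 Q^2]; so the moment bound with the crude loss [U^1] is good enough. *)
pose T := T1 * Q `^ (2 / B%:R).
have QB1 : 0 < Q `^ (2 / B%:R) by rewrite powR_gt0.
have T0 : 0 < T by rewrite mulr_gt0.
have TB : T1 * Q ^+ 2 <= T ^+ B.
  have B1 : (0 < B)%N by rewrite -(ltr_nat R).
  have -> : T ^+ B = T1 ^+ B * Q ^+ 2.
    rewrite /T exprMn; congr (_ * _).
    by rewrite -[LHS]powR_mulrn ?(ltW QB1) // -powRrM divfK ?gt_eqF // powR_mulrn ?(ltW Q0).
  by rewrite ler_wpM2r ?sqr_ge0 // -[leLHS]expr1 ler_weXn2l.
have [q [a hqa]] : exists (q : 'I_M -> 'I_M -> nat) (a : 'I_M -> 'I_M -> int),
   forall j j', (0 < q j j')%N /\ forall b,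
    normc (wsum L b ((j%:R - j'%:R) / M%:R)) ^+ 2 <=
      A * (L%:R ^+ 2 * ((q j j')%:R + L%:R ^+ 2 *
         `|(q j j')%:R * (2 * ((j%:R - j'%:R) / M%:R)) - (a j j')%:~R|) `^ (th - 1)).
  have /choice[f hf] : forall p : 'I_M * 'I_M, exists qa : nat * int, (0 < qa.1)%N /\ forall b,
    normc (wsum L b ((p.1%:R - p.2%:R) / M%:R)) ^+ 2 <=
      A * (L%:R ^+ 2 * (qa.1%:R + L%:R ^+ 2 *
         `|qa.1%:R * (2 * ((p.1%:R - p.2%:R) / M%:R)) - qa.2%:~R|) `^ (th - 1)).
    move=> p; have [q [a h]] := weyl_bound ((p.1%:R - p.2%:R) / M%:R) th01 L0.
    by exists (q, a); rewrite AE.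
  by exists (fun j j' => (f (j, j')).1), (fun j j' => (f (j, j')).2) => j j'; exact: hf (j, j').
have q0 j j' : (0 < q j j')%N := (hqa j j').1.
have hE' : eta * #|E|%:R ^+ 2 <= A * \sum_(j in E) \sum_(j' in E) ((q j j')%:R + L%:R ^+ 2 *
         `|(q j j')%:R * (2 * ((j%:R - j'%:R) / M%:R)) - (a j j')%:~R|) `^ (th - 1).
  rewrite -(ler_pM2l L2) mulrA [L%:R ^+ 2 * eta]mulrC; apply: le_trans hE _.
  rewrite !mulr_sumr; apply: ler_sum => j _; rewrite !mulr_sumr; apply: ler_sum => j' _.
  have [_ hb] := hqa j j'; have := hb b1; have := hb b2.
  set x := normc (wsum L b1 _); set y := normc (wsum L b2 _); set U := _ `^ (th - 1).
  move=> hy hx; apply: (@le_trans _ _ ((x ^+ 2 + y ^+ 2) / 2)).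
    by have := sqr_ge0 (x - y); rewrite sqrrB; clear; lra.
  by move: hx hy; clear; lra.
have AQ' : A * Q `^ (th - 1) <= eta / 2 by rewrite AQ.
have := large_values_raw L0 LM q0 th01 A0 eta0 Q1 QL16 T0 C10 AQ' mom hE'.
rewrite -KE.
have [E0 _|Epos] := leP (#|E|%:R : R) 0.
  by apply: le_trans E0 _; rewrite !mulr_ge0 ?powR_ge0 ?invr_ge0 ?sqr_ge0 ?addr_ge0 // ltW.
move: Epos; move: (#|E|%:R : R) => e e0.
have Qth : 0 < Q `^ th by rewrite powR_gt0.
have eQ : eta = 2 * A * (Q `^ th / Q).
  by rewrite -[Q in X in _ / X](powRr1 (ltW Q0)) -gt0_powRB // -mulrA AQ; field.
(* The frequency [0] is absorbed by a quarter of the left side, thanks to [Q^2 <= s L^2]; in [t2]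
   the large divisor weights take another quarter. The Parseval term that remains is linear in [e],
   so one factor [e] cancels. *)
have t1 : K * Q `^ th * (64 / L%:R ^+ 2 * (2 * Q * e ^+ 2)) <= eta / 4 * e ^+ 2.
  have -> : K * Q `^ th * (64 / L%:R ^+ 2 * (2 * Q * e ^+ 2)) =
     (128 * K * Q ^+ 2 / L%:R ^+ 2) * (Q `^ th / Q) * e ^+ 2 by field; rewrite ?gt_eqF.
  have -> : eta / 4 * e ^+ 2 = A / 2 * (Q `^ th / Q) * e ^+ 2 by rewrite eQ; field; rewrite ?gt_eqF.
  rewrite ler_wpM2r ?sqr_ge0 // ler_wpM2r ?divr_ge0 ?(ltW Q0) ?(ltW Qth) //.
  rewrite ler_pdivrMr //; apply: (@le_trans _ _ (128 * K * (s * L%:R ^+ 2))).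
    by rewrite ler_wpM2l // mulr_ge0 // ltW.
  rewrite mulrA ler_wpM2r ?(ltW L2) //; move: sA; rewrite ler_pdivlMr //; clear; lra.
have t2 : K * Q `^ th * (8 * C1 * Q / T ^+ B * e ^+ 2) <= eta / 4 * e ^+ 2.
  have TBp : 0 < T ^+ B by rewrite exprn_gt0.
  have -> : K * Q `^ th * (8 * C1 * Q / T ^+ B * e ^+ 2) =
     (8 * K * C1 * Q ^+ 2 / T ^+ B) * (Q `^ th / Q) * e ^+ 2.
    by field; rewrite ?gt_eqF.
  have -> : eta / 4 * e ^+ 2 = A / 2 * (Q `^ th / Q) * e ^+ 2 by rewrite eQ; field; rewrite ?gt_eqF.
  rewrite ler_wpM2r ?sqr_ge0 // ler_wpM2r ?divr_ge0 ?(ltW Q0) ?(ltW Qth) //.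
  rewrite ler_pdivrMr //; apply: le_trans (ler_wpM2l _ TB); last by rewrite divr_ge0 // ltW.
  have h : 16 * K * C1 <= A * T1.
    have -> : A * T1 = A + 16 * K * C1 by rewrite T1E; field; rewrite gt_eqF.
    by rewrite lerDr ltW.
  move: (ler_wpM2r (sqr_ge0 Q) h); clear; lra.
move=> hraw.
have hfin : eta / 2 * e ^+ 2 <= K * Q `^ th * (64 / L%:R ^+ 2 * (T * M%:R * e)).
  move: hraw; rewrite [64 / _ * (_ + _)]mulrDr -addrA [K * _ * (_ + _)]mulrDr mulrDr => hraw.
  apply: (@le_trans _ _ (eta * e ^+ 2 - eta / 4 * e ^+ 2 - eta / 4 * e ^+ 2)).
    by rewrite le_eqVlt; apply/orP; left; apply/eqP; field.
  rewrite 2!lerBlDr; apply: le_trans hraw _; rewrite addrA; apply: lerD t2.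
  by rewrite addrC; apply: lerD t1.
have {hfin} hfin : eta * e <= 128 * K * T1 * (M%:R / L%:R ^+ 2) * Q `^ (th + 2 / B%:R).
  rewrite gt0_powRD // -(ler_pM2r e0).
  have -> : 128 * K * T1 * (M%:R / L%:R ^+ 2) * (Q `^ th * Q `^ (2 / B%:R)) * e =
     2 * (K * Q `^ th * (64 / L%:R ^+ 2 * (T * M%:R * e))).
    by rewrite /T; field; rewrite gt_eqF.
  move: hfin; rewrite expr2; clear; lra.
have hQk : Q `^ (th + 2 / B%:R) <= (2 * A) `^ kappa * eta `^ (- kappa).
  have -> : (2 * A) `^ kappa * eta `^ (- kappa) = w `^ kappa.
    have -> : eta `^ (- kappa) = eta^-1 `^ kappa.
      by rewrite -[eta^-1]powR_inv1 ?(ltW eta0) // -powRrM mulN1r.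
    rewrite -powRM ?invr_ge0 ?(ltW eta0) //.
    exact: mulr_ge0 (ler0n R 2) (ltW A0).
  apply: (@le_trans _ _ ((w `^ 2) `^ (th + 2 / B%:R))).
    apply: ge0_ler_powR; rewrite ?nnegrE ?powR_ge0 //.
    by rewrite addr_ge0 ?divr_ge0 // ltW.
  rewrite -powRrM ler_powR //; have -> : 2 * (th + 2 / B%:R) = 2 * th + 4 / B%:R by field; rewrite gt_eqF.
  by move: thk Bk; clear; lra.
have -> : eta `^ (- (1 + kappa)) = eta `^ (- kappa) / eta.
  by rewrite opprD addrC gt0_powRD // powR_inv1 // ltW.
rewrite mulrA ler_pdivlMr // mulrC; apply: le_trans hfin _.
apply: (@le_trans _ _ (Cb * (M%:R / L%:R ^+ 2) * eta `^ (- kappa))); last first.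
  by rewrite ler_wpM2r ?powR_ge0 // ler_wpM2r ?divr_ge0 ?(ltW L2) // lerDr ltW.
have -> : Cb * (M%:R / L%:R ^+ 2) * eta `^ (- kappa) =
   128 * K * T1 * (M%:R / L%:R ^+ 2) * ((2 * A) `^ kappa * eta `^ (- kappa)) by rewrite /Cb; ring.
rewrite ler_wpM2l // !mulr_ge0 ?invr_ge0 ?(ltW L2) // ltW //.
Qed.
End LargeValuesA.

(** * The discretized inequality *)

Section LayerCake.
Context {R : realType}.

Lemma sum_sqr_le (I : finType) (x y : I -> R) :
  (\sum_i x i * y i) ^+ 2 <= (\sum_i x i ^+ 2) * (\sum_i y i ^+ 2).
Proof.
pose X := \sum_i x i ^+ 2; pose Y := \sum_i y i ^+ 2; pose Z := \sum_i x i * y i.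
have Y0 : 0 <= Y by apply: sumr_ge0 => i _; exact: sqr_ge0.
have [Yz|Yn] := eqVneq Y 0.
  have y0 i : y i = 0.
    have /psumr_eq0P : forall i, true -> 0 <= y i ^+ 2 by move=> *; exact: sqr_ge0.
    by move=> /(_ Yz i isT)/eqP; rewrite sqrf_eq0 => /eqP.
  rewrite big1 => [|i _]; last by rewrite y0 mulr0.
  by rewrite expr0n mulr_ge0 // sumr_ge0 // => i _; exact: sqr_ge0.
have Yp : 0 < Y by rewrite lt_neqAle eq_sym Yn.
have : 0 <= \sum_i (Y * x i - Z * y i) ^+ 2 by apply: sumr_ge0 => i _; exact: sqr_ge0.
have -> : \sum_i (Y * x i - Z * y i) ^+ 2 = Y * (X * Y - Z ^+ 2).
  transitivity (\sum_i Y ^+ 2 * x i ^+ 2 + \sum_i (- 2 * Y * Z) * (x i * y i) +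
    \sum_i Z ^+ 2 * y i ^+ 2).
    by rewrite -!big_split; apply: eq_bigr => i _ /=; ring.
  by rewrite -!mulr_sumr -/X -/Y -/Z; ring.
by rewrite pmulr_rge0 // subr_ge0.
Qed.

(** Dyadic levels [2^-(k + 1)] give a geometric series of ratio [2^(sigma - s)]. Stopping after [n]
    levels leaves at most [#|I| 2^(- s n)], and [n] of size [#|I| / A] brings this below [A], whence
    the [+ 1] and a constant independent of [#|I|]. *)
Lemma layer_cake (I : finType) (G : I -> R) (A s sigma : R) :
  0 < A -> 0 < sigma -> sigma < s -> 1 <= s -> (forall i, 0 <= G i <= 1) ->
  (forall eta, 0 < eta <= 1 -> #|[set i | eta <= G i]%SET|%:R <= A * eta `^ (- sigma)) ->
  \sum_i G i `^ s <= (2 `^ sigma / (1 - 2 `^ (sigma - s)) + 1) * A.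
Proof.
move=> A0 sg0 ss s1 G01 hG.
pose d := 2 `^ (- s) : R.
have s0 : 0 < s by lra.
have two0 : 0 < 2 :> R by [].
have d0 : 0 < d by rewrite powR_gt0.
have lt1 (x : R) : x < 0 -> 2 `^ x < 1 :> R.
  by move=> x0; rewrite /powR gt_eqF // expR_lt1 pmulr_llt0 // ln_gt0 // ltr1n.
have half n : (2^-1 ^+ n) `^ s = d ^+ n :> R.
  by rewrite -[2^-1 ^+ n]powR_mulrn ?invr_ge0 // powRAC powR_mulrn ?powR_ge0 // -[2^-1]powR_inv1 // -powRrM mulN1r.
have h01 n : 0 < (2^-1 : R) ^+ n <= 1.
  by rewrite exprn_gt0 ?invr_gt0 //= exprn_ile1 ?invr_ge0 // invf_le1 // ler1n.
have pt (n : nat) i : G i `^ s <=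
    \sum_(k < n) d ^+ k * (2^-1 ^+ k.+1 <= G i)%R%:R + d ^+ n.
  have /andP[g0 g1] := G01 i.
  elim: n => [|n IH].
    have one : 1 `^ s = 1 :> R by rewrite powR1.
    by rewrite big_ord0 add0r expr0 -one ge0_ler_powR ?nnegrE ?(ltW s0).
  rewrite big_ord_recr /=; have [h|h] := leP (2^-1 ^+ n.+1) (G i).
    by apply: le_trans IH _; rewrite mulr1 lerDl exprn_ge0 // ltW.
  rewrite mulr0 addr0 -[leLHS]add0r; apply: lerD.
    by apply: sumr_ge0 => k _; rewrite mulr_ge0 // exprn_ge0 // ltW.
  rewrite -half; apply: ge0_ler_powR; rewrite ?nnegrE ?(ltW s0) ?(ltW h) //.
pose rho := 2 `^ (sigma - s) : R.
have rho1 : rho < 1 by apply: lt1; lra.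
have rho0 : 0 < rho by rewrite powR_gt0.
have all_n (n : nat) : \sum_i G i `^ s <= 2 `^ sigma / (1 - rho) * A + #|I|%:R * d ^+ n.
  apply: (@le_trans _ _ (\sum_i (\sum_(k < n) d ^+ k * (2^-1 ^+ k.+1 <= G i)%R%:R + d ^+ n))).
    by apply: ler_sum.
  rewrite big_split /= sumr_const -[d ^+ n *+ _]mulr_natl lerD2r exchange_big /=.
  apply: (@le_trans _ _ (\sum_(k < n) 2 `^ sigma * A * rho ^+ k)).
    apply: ler_sum => k _; rewrite -mulr_sumr.
    have -> : \sum_i (2^-1 ^+ k.+1 <= G i)%R%:R = #|[set i | 2^-1 ^+ k.+1 <= G i]%SET|%:R :> R.
      rewrite -sum1_card natr_sum [RHS]big_mkcond; apply: eq_bigr => i _.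
      by rewrite inE; case: ifP.
    apply: le_trans (ler_wpM2l (exprn_ge0 _ (ltW d0)) (hG _ (h01 _))) _.
    have -> : (2^-1 ^+ k.+1) `^ (- sigma) = 2 `^ sigma * (2 `^ sigma) ^+ k :> R.
      rewrite -exprS -[2^-1 ^+ _]powR_mulrn ?invr_ge0 // powRAC powR_mulrn ?powR_ge0 //.
      by rewrite -[2^-1]powR_inv1 // -powRrM mulN1r opprK.
    have -> : rho ^+ k = (2 `^ sigma) ^+ k * d ^+ k by rewrite -exprMn -gt0_powRD.
    by rewrite le_eqVlt; apply/orP; left; apply/eqP; ring.
  rewrite -mulr_sumr [leRHS]mulrAC ler_wpM2l ?mulr_ge0 ?powR_ge0 ?(ltW A0) //.
  rewrite -[leRHS]div1r ler_pdivlMr ?subr_gt0 // mulrC -opprB mulNr -subrX1 opprB.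
  by rewrite gerBl exprn_ge0 // ltW.
have dn n : d ^+ n <= n.+1%:R^-1.
  have d2 : d <= 2^-1 by rewrite -powR_inv1 // ler_powR // ?ler1n //; lra.
  apply: (@le_trans _ _ (2^-1 ^+ n)); first by rewrite lerXn2r ?nnegrE ?(ltW d0) ?invr_ge0.
  rewrite exprVn lef_pV2 ?posrE ?exprn_gt0 // -natrX ler_nat; exact: ltn_expl.
pose n := Num.truncn (#|I|%:R / A).
apply: le_trans (all_n n) _; rewrite mulrDl mul1r lerD2l.
apply: le_trans (ler_wpM2l (ler0n R _) (dn n)) _.
by rewrite ler_pdivrMr // mulrC -ler_pdivrMr // ltW // truncnS_gt.
Qed.
End LayerCake.

Section Duality.
Context {R : realType}.
Local Notation normc := (@Normc.normc R).
Local Notation Re := (@complex.Re R).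

Lemma phase_exists (z : R[i]) : exists c : R[i], normc c <= 1 /\ c * z = (normc z)%:C%C.
Proof.
have [z0|zn] := eqVneq (normc z) 0.
  by exists 0; rewrite Normc.normc0 mul0r z0.
exists (conjc z * ((normc z)^-1)%:C%C); split.
  by rewrite Normc.normcM normc_conjc normc_real ger0_norm ?invr_ge0 ?normc_ge0 // divff.
rewrite mulrAC [conjc z * z]mulrC mul_conjc -rmorphM /= expr2 mulfK //.
Qed.

(** Multiplied by suitable phases, the sums at the points of [E] add up to a linear form in [a].
    Cauchy-Schwarz in [x] removes [a], and expanding the square of the dual sum [g] leaves the
    kernel at the differences of points of [E]. *)
Lemma duality (T : finType) (phi : T -> int) (a : T -> R[i]) (M : nat) (E : {set 'I_M}) (lam : R) :
  0 <= lam ->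
  (forall j, j \in E -> lam <= normc (\sum_x a x * ee (j%:R * ((phi x)%:~R / M%:R)))) ->
  lam ^+ 2 * #|E|%:R ^+ 2 <= (\sum_x normc (a x) ^+ 2) *
    \sum_(j in E) \sum_(j' in E) normc (\sum_x ee ((j%:R - j'%:R) / M%:R * (phi x)%:~R)).
Proof.
move=> lam0 hE.
pose f (j : 'I_M) := \sum_x a x * ee (j%:R * ((phi x)%:~R / M%:R)).
have [c hc] := choice (fun j : 'I_M => phase_exists (f j)).
pose g x := \sum_(j in E) c j * ee (j%:R * ((phi x)%:~R / M%:R)).
have h1 : lam * #|E|%:R <= \sum_x normc (a x) * normc (g x).
  apply: (@le_trans _ _ (\sum_(j in E) normc (f j))).
    by rewrite mulr_natr -sumr_const; apply: ler_sum => j /hE.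
  have -> : \sum_(j in E) normc (f j) = Re (\sum_x a x * g x).
    transitivity (Re (\sum_(j in E) c j * f j)).
      by rewrite Re_sum; apply: eq_bigr => j _; rewrite (hc j).2.
    congr Re; rewrite /f /g.
    under eq_bigr => j _ do rewrite mulr_sumr.
    rewrite exchange_big /=; apply: eq_bigr => x _; rewrite mulr_sumr.
    by apply: eq_bigr => j _; rewrite mulrCA.
  apply: le_trans (Re_le_normc _) _; apply: le_trans (normc_sum_le _ _ _) _.
  by apply: ler_sum => x _; rewrite Normc.normcM.
have h2 : \sum_x normc (g x) ^+ 2 <=
    \sum_(j in E) \sum_(j' in E) normc (\sum_x ee ((j%:R - j'%:R) / M%:R * (phi x)%:~R)).
  have -> : \sum_x normc (g x) ^+ 2 = \sum_(j in E) \sum_(j' in E)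
      Re (c j * conjc (c j') * \sum_x ee ((j%:R - j'%:R) / M%:R * (phi x)%:~R)).
    transitivity (\sum_x \sum_(j in E) \sum_(j' in E)
      Re (c j * conjc (c j') * ee ((j%:R - j'%:R) / M%:R * (phi x)%:~R))).
      apply: eq_bigr => x _; rewrite sqr_normcE /g conjc_sum mulr_suml Re_sum.
      apply: eq_bigr => j _; rewrite mulr_sumr Re_sum; apply: eq_bigr => j' _.
      by rewrite conjcM conjc_ee mulrACA -eeD; congr (Re (_ * ee _)); ring.
    rewrite exchange_big /=; apply: eq_bigr => j _.
    rewrite exchange_big /=; apply: eq_bigr => j' _.
    by rewrite -Re_sum -mulr_sumr.
  apply: ler_sum => j _; apply: ler_sum => j' _.
  apply: le_trans (Re_le_normc _) _; rewrite !Normc.normcM normc_conjc.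
  rewrite -[leRHS]mul1r ler_wpM2r ?normc_ge0 //.
  by rewrite -[leRHS]mul1r; apply: ler_pM; rewrite ?normc_ge0 ?(hc _).1.
rewrite -exprMn; apply: (@le_trans _ _ ((\sum_x normc (a x) * normc (g x)) ^+ 2)).
  by rewrite lerXn2r ?nnegrE ?mulr_ge0 // (le_trans _ h1) // mulr_ge0.
apply: le_trans (sum_sqr_le _ _) _; rewrite ler_wpM2l //.
by apply: sumr_ge0 => x _; exact: sqr_ge0.
Qed.
End Duality.

(** Two square coordinates and an arbitrary remainder: [X] carries the other [r - 2] coordinates, or
    is [unit] when the square of the sum for [r = 1] is treated as a planar sum. *)
Definition box_phase (L : nat) (X : finType) (b1 b2 : int) (psi : X -> int)
    (p : 'I_L * 'I_L * X) : int :=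
  (b1 + p.1.1%:Z) ^+ 2 + (b2 + p.1.2%:Z) ^+ 2 + psi p.2.

Section DiscreteBound.
Context {R : realType}.
Local Notation normc := (@Normc.normc R).
Local Notation Re := (@complex.Re R).

(* The sample at [t = 2 pi j / M] of the conjugate exponential sum; see [grid_sum_shift]. *)
Definition grid_sum (T : finType) (phi : T -> int) (a : T -> R[i]) (M j : nat) : R[i] :=
  \sum_x a x * ee (j%:R * ((phi x)%:~R / M%:R)).

Lemma box_kernel_le (L : nat) (X : finType) (b1 b2 : int) (psi : X -> int) (t : R) :
  normc (\sum_p ee (t * (@box_phase L X b1 b2 psi p)%:~R)) <=
  #|X|%:R * (normc (wsum L b1 t) * normc (wsum L b2 t)).
Proof.
have -> : \sum_p ee (t * (@box_phase L X b1 b2 psi p)%:~R) =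
    wsum L b1 t * wsum L b2 t * \sum_x ee (t * (psi x)%:~R).
  rewrite /wsum !big_mkord mulr_suml [RHS]big_distrl /=.
  transitivity (\sum_(n < L) \sum_(m < L) \sum_x
     ee (t * (@box_phase L X b1 b2 psi (n, m, x))%:~R)).
    by rewrite pair_bigA pair_bigA; apply: eq_bigr => -[[n m] x].
  apply: eq_bigr => n _; rewrite [X in _ = X * _]mulr_sumr [RHS]big_distrl /=; apply: eq_bigr => m _.
  rewrite mulr_sumr; apply: eq_bigr => x _.
  by rewrite -!eeD /box_phase /=; congr ee; rewrite !intrD; ring.
rewrite Normc.normcM Normc.normcM mulrC ler_wpM2r ?mulr_ge0 ?normc_ge0 //.
apply: le_trans (normc_sum_le _ _ _) _.
by under eq_bigr do rewrite normc_ee; rewrite sumr_const.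
Qed.

Lemma box_phase_card (kappa : R) : 0 < kappa ->
  exists2 C : R, 0 < C & forall (L : nat) (X : finType) (b1 b2 : int) (psi : X -> int) (k : int),
    (0 < L)%N ->
    #|[set p | @box_phase L X b1 b2 psi p == k]%SET|%:R <= C * #|X|%:R * L%:R `^ (kappa / 4).
Proof.
(* Two divisor factors at some [m <= 3 L^6] lose [L^(12 e) <= L^(kappa / 4)]; with [3^e <= 3] the
   constant is [90 = 10 * 3^2]. *)
move=> k0; pose e : R := Num.min (kappa / 48) 1.
have e0 : 0 < e by rewrite lt_min ltr01 divr_gt0 ?ltr0n.
have e1 : e <= 1 by rewrite ge_min lexx orbT.
have ek : e <= kappa / 48 by rewrite ge_min lexx.
clearbody e.
have [C C0 HC] := numdiv_powR e0.
exists (90 * C ^+ 2) => [|L X b1 b2 psi k L0]; first by rewrite mulr_gt0 ?ltr0n ?exprn_gt0.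
have L1 : 1 <= L%:R :> R by rewrite ler1n.
have D (m : nat) : (0 < m <= 2 * L ^ 6 + 1)%N ->
    (numdiv m * (numdiv m * 10))%N%:R <= 90 * C ^+ 2 * L%:R `^ (kappa / 4) :> R.
  move=> /andP[m0 mL].
  have h : (numdiv m)%:R <= C * (3 * L%:R `^ (6 * e)).
    apply: le_trans (HC _ m0) _; rewrite ler_wpM2l ?(ltW C0) //.
    apply: (@le_trans _ _ ((3 * L%:R ^+ 6) `^ e)).
      apply: ge0_ler_powR; rewrite ?nnegrE ?mulr_ge0 ?exprn_ge0 ?(ltW e0) //.
      have L6 : (0 < L ^ 6)%N by rewrite expn_gt0 L0.
      by rewrite -natrX -natrM ler_nat; lia.
    rewrite powRM ?exprn_ge0 //; apply: ler_pM; rewrite ?powR_ge0 //.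
      by rewrite ler1_powR // ler1n.
    by rewrite -powR_mulrn // -powRrM.
  have -> : (numdiv m * (numdiv m * 10))%N%:R = 10 * (numdiv m)%:R ^+ 2 :> R.
    by rewrite !natrM expr2; ring.
  have h2 : (numdiv m)%:R ^+ 2 <= (C * (3 * L%:R `^ (6 * e))) ^+ 2.
    by rewrite lerXn2r ?nnegrE ?mulr_ge0 ?powR_ge0 ?(ltW C0).
  apply: le_trans (ler_wpM2l (ler0n R 10) h2) _.
  have -> : 10 * (C * (3 * L%:R `^ (6 * e))) ^+ 2 = 90 * C ^+ 2 * (L%:R `^ (6 * e)) ^+ 2 by ring.
  rewrite ler_wpM2l ?mulr_ge0 ?exprn_ge0 ?(ltW C0) //.
  rewrite -powR_mulrn ?powR_ge0 // -powRrM ler_powR //; lra.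
have fib x : #|[set p : 'I_L * 'I_L | ((b1 + p.1%:Z) ^+ 2 + (b2 + p.2%:Z) ^+ 2 == k - psi x)%R]%SET|%:R
    <= 90 * C ^+ 2 * L%:R `^ (kappa / 4) :> R.
  have [m hm hc] := box_circle_card L b1 b2 (k - psi x).
  by apply: le_trans (D _ hm); rewrite ler_nat.
have -> : #|[set p | @box_phase L X b1 b2 psi p == k]%SET|%:R = \sum_x
  #|[set p : 'I_L * 'I_L | ((b1 + p.1%:Z) ^+ 2 + (b2 + p.2%:Z) ^+ 2 == k - psi x)%R]%SET|%:R :> R.
  rewrite -natr_sum; congr (_%:R).
  rewrite -sum1_card big_mkcond /=.
  transitivity (\sum_(q : 'I_L * 'I_L) \sum_x (box_phase b1 b2 psi (q, x) == k))%N.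
    rewrite pair_bigA; apply: eq_bigr => -[q x] _ /=; by rewrite inE; case: ifP.
  rewrite exchange_big /=; apply: eq_bigr => x _.
  rewrite -sum1_card [RHS]big_mkcond /=; apply: eq_bigr => q _.
  by rewrite inE /box_phase /= eq_sym -subr_eq eq_sym; case: ifP.
apply: (@le_trans _ _ (\sum_(x : X) 90 * C ^+ 2 * L%:R `^ (kappa / 4))).
  by apply: ler_sum => x _.
by rewrite sumr_const -[_ *+ _]mulr_natl mulrCA mulrA.
Qed.

(** The bound on differences turns congruence modulo [M] into equality of the phases. By the
    inequality of the means, each coefficient is then counted once for every point of its level
    set. *)
Lemma grid_sum_sqr_le (T : finType) (phi : T -> int) (a : T -> R[i]) (M : nat) (D : R) :
  (0 < M)%N -> (forall x x', `|phi x - phi x'| < M%:Z) ->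
  (forall x, #|[set x' | phi x' == phi x]%SET|%:R <= D) ->
  \sum_(j < M) normc (grid_sum phi a M j) ^+ 2 <= M%:R * (D * \sum_x normc (a x) ^+ 2).
Proof.
move=> M0 phiM hD.
rewrite -(big_mkord predT (fun j => normc (grid_sum phi a M j) ^+ 2)) plancherel //.
rewrite ler_wpM2l //.
have same x x' : (M %| phi x - phi x')%Z = (phi x == phi x').
  apply/idP/eqP => [/dvdzP[c hc]|->]; last by rewrite subrr dvdz0.
  have := phiM x x'; rewrite hc normrM; have [c0 _|c0] := eqVneq c 0.
    by apply/eqP; rewrite -subr_eq0 hc c0 mul0r.
  have c1 : 1 <= `|c| by lia.
  have M1 : 0 < M%:Z by [].
  rewrite [`|M%:Z|]ger0_norm // gtr_pMl // ltNge c1 //.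
pose s x := normc (a x) ^+ 2.
apply: (@le_trans _ _ (\sum_x \sum_(x' | phi x == phi x') (s x / 2 + s x' / 2))).
  apply: ler_sum => x _; rewrite (eq_bigl (fun x' => phi x == phi x')) //.
  apply: ler_sum => x' _; apply: le_trans (Re_le_normc _) _.
  rewrite Normc.normcM normc_conjc /s; have := sqr_ge0 (normc (a x) - normc (a x')).
  rewrite sqrrB; lra.
have -> : \sum_x \sum_(x' | phi x == phi x') (s x / 2 + s x' / 2) =
   \sum_x s x * #|[set x' | phi x' == phi x]%SET|%:R.
  transitivity (\sum_x s x / 2 * #|[set x' | phi x' == phi x]%SET|%:R +
      \sum_x s x / 2 * #|[set x' | phi x' == phi x]%SET|%:R); last first.
    by rewrite -big_split; apply: eq_bigr => x _ /=; field.
  under eq_bigr do rewrite big_split /=.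
  have card x : \sum_(x' | phi x == phi x') s x / 2 = s x / 2 * #|[set x' | phi x' == phi x]%SET|%:R.
    by rewrite sumr_const mulr_natr; congr (_ *+ _); apply: eq_card => x'; rewrite inE eq_sym.
  rewrite big_split /=; congr (_ + _); first exact: eq_bigr.
  rewrite (exchange_big_dep predT) //=; apply: eq_bigr => x _.
  by rewrite -card; apply: eq_bigl => x'; rewrite eq_sym.
rewrite mulr_sumr; apply: ler_sum => x _; rewrite mulrC ler_wpM2r //; exact: sqr_ge0.
Qed.

Lemma level_count (kappa : R) : 0 < kappa ->
  exists2 C : R, 0 < C & forall (L M : nat) (X : finType) (b1 b2 : int) (psi : X -> int)
      (a : 'I_L * 'I_L * X -> R[i]) (eta : R),
    let phi := @box_phase L X b1 b2 psi in
    let S := \sum_p normc (a p) ^+ 2 in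
    (0 < L)%N -> (L ^ 2 <= M)%N -> (forall p p', `|phi p - phi p'| < M%:Z) -> 0 < S ->
    0 < eta <= 1 ->
    #|[set j : 'I_M | eta * (L%:R ^+ 2 * #|X|%:R * S) <= normc (grid_sum phi a M j) ^+ 2]%SET|%:R <=
      C * (M%:R / L%:R ^+ 2) * eta `^ (- (1 + kappa)).
Proof.
move=> k0; have [Ca Ca0 HA] := large_values k0; have [Cb Cb0 HB] := box_phase_card k0.
pose C := Cb * Ca `^ kappa.
have C0 : 0 < C by rewrite mulr_gt0 ?powR_gt0.
exists (Ca + C) => [|L M X b1 b2 psi a eta phi S L0 LM phiM S0 /andP[eta0 eta1]]; first exact: addr_gt0.
set E := [set j | _]%SET.
have LR : 0 < L%:R :> R by rewrite ltr0n.
have L2 : 0 < L%:R ^+ 2 :> R by rewrite exprn_gt0.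
have M0 : (0 < M)%N by apply: leq_trans LM; rewrite expn_gt0 L0.
have X0 : 0 < #|X|%:R :> R.
  rewrite ltr0n lt0n; apply/negP => /eqP X0; move: S0; rewrite /S big1 ?ltxx // => -[q x] _.
  by have := enum_rank x; rewrite X0 => -[].
have P0 : 0 <= (M%:R / L%:R ^+ 2) * eta `^ (- (1 + kappa)).
  by rewrite mulr_ge0 ?powR_ge0 ?divr_ge0 ?(ltW L2).
have [big|small] := leP Ca (eta * L%:R `^ (1 / 4)).
  apply: (@le_trans _ _ (Ca * (M%:R / L%:R ^+ 2) * eta `^ (- (1 + kappa)))); last first.
    by rewrite -[leLHS]mulrA -[leRHS]mulrA (ler_wpM2r P0) // lerDl ltW.
  apply: (HA _ _ b1 b2) => //; first by rewrite eta0.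
  pose lam := Num.sqrt (eta * (L%:R ^+ 2 * #|X|%:R * S)).
  have lam2 : lam ^+ 2 = eta * (L%:R ^+ 2 * #|X|%:R * S).
    by rewrite sqr_sqrtr // !mulr_ge0 // ltW.
  have hl j : j \in E -> lam <= normc (\sum_x a x * ee (j%:R * ((phi x)%:~R / M%:R))).
    rewrite inE -lam2 => h; rewrite -(ler_pXn2r (n := 2)) ?nnegrE ?sqrtr_ge0 ?normc_ge0 //.
  have := duality (sqrtr_ge0 _) hl; rewrite lam2 -/S => h.
  have XS : 0 < #|X|%:R * S by rewrite mulr_gt0.
  rewrite -(ler_pM2l XS).
  have -> : #|X|%:R * S * (eta * L%:R ^+ 2 * #|E|%:R ^+ 2) =
     eta * (L%:R ^+ 2 * #|X|%:R * S) * #|E|%:R ^+ 2 by ring.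
  apply: le_trans h _; rewrite [_ * S]mulrC -mulrA ler_wpM2l ?(ltW S0) //.
  rewrite mulr_sumr; apply: ler_sum => j _; rewrite mulr_sumr; apply: ler_sum => j' _.
  exact: box_kernel_le.
apply: (@le_trans _ _ (C * (M%:R / L%:R ^+ 2) * eta `^ (- (1 + kappa)))); last first.
  by rewrite -[leLHS]mulrA -[leRHS]mulrA (ler_wpM2r P0) // lerDr ltW.
have hD p : #|[set p' | phi p' == phi p]%SET|%:R <= Cb * #|X|%:R * L%:R `^ (kappa / 4).
  exact: HB.
have := grid_sum_sqr_le a M0 phiM hD; rewrite -/S => hB.
have hE : #|E|%:R * (eta * (L%:R ^+ 2 * #|X|%:R * S)) <=
    \sum_(j < M) normc (grid_sum phi a M j) ^+ 2.
  rewrite mulr_natl -sumr_const big_mkcond; apply: ler_sum => j _.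
  by case: ifP => [|_]; rewrite ?inE // sqr_ge0.
have {hE} hE := le_trans hE hB.
(* In this case [L^(1/4) < Ca / eta]; the exponent [kappa / 4] is this threshold raised to the power
   [kappa]. *)
have hL : L%:R `^ (kappa / 4) <= Ca `^ kappa * eta `^ (- kappa).
  have -> : Ca `^ kappa * eta `^ (- kappa) = (Ca / eta) `^ kappa.
    have -> : eta `^ (- kappa) = eta^-1 `^ kappa.
      by rewrite -[eta^-1]powR_inv1 ?(ltW eta0) // -powRrM mulN1r.
    by rewrite powRM ?invr_ge0 ?(ltW eta0) ?(ltW Ca0).
  have -> : kappa / 4 = (1 / 4) * kappa by ring.
  rewrite powRrM; apply: ge0_ler_powR; rewrite ?nnegrE ?powR_ge0 ?divr_ge0 ?(ltW eta0) ?(ltW Ca0) ?(ltW k0) //.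
  by rewrite ler_pdivlMr // mulrC ltW.
have -> : eta `^ (- (1 + kappa)) = eta `^ (- kappa) / eta.
  by rewrite opprD addrC gt0_powRD // powR_inv1 // ltW.
have XS : 0 < #|X|%:R * S by rewrite mulr_gt0.
rewrite mulrA ler_pdivlMr // -(ler_pM2r L2) -(ler_pM2r XS).
have -> : #|E|%:R * eta * L%:R ^+ 2 * (#|X|%:R * S) = #|E|%:R * (eta * (L%:R ^+ 2 * #|X|%:R * S)) by ring.
apply: le_trans hE _.
have -> : M%:R * (Cb * #|X|%:R * L%:R `^ (kappa / 4) * S) =
  M%:R * Cb * (#|X|%:R * S) * L%:R `^ (kappa / 4) by ring.
have -> : C * (M%:R / L%:R ^+ 2) * eta `^ (- kappa) * L%:R ^+ 2 * (#|X|%:R * S) =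
  M%:R * Cb * (#|X|%:R * S) * (Ca `^ kappa * eta `^ (- kappa)).
  by rewrite /C; field; rewrite gt_eqF.
by rewrite ler_wpM2l // mulr_ge0 ?(ltW XS) // mulr_ge0 // ltW.
Qed.
End DiscreteBound.

(** * From level sets to moments, and from the plane to [r] coordinates *)

Section Cube.
Context {R : realType}.
Local Notation normc := (@Normc.normc R).

Lemma grid_sum_sqr_card (T : finType) (phi : T -> int) (a : T -> R[i]) (M j : nat) :
  normc (grid_sum phi a M j) ^+ 2 <= #|T|%:R * \sum_x normc (a x) ^+ 2.
Proof.
apply: (@le_trans _ _ ((\sum_x 1 * normc (a x)) ^+ 2)).
  rewrite lerXn2r ?nnegrE ?normc_ge0 //.
    by apply: sumr_ge0 => x _; rewrite mul1r normc_ge0.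
  apply: le_trans (normc_sum_le _ _ _) _; apply: ler_sum => x _.
  by rewrite Normc.normcM normc_ee mulr1 mul1r.
apply: le_trans (sum_sqr_le _ _) _.
by under eq_bigr do rewrite expr1n; rewrite sumr_const.
Qed.

(** The squares of the grid sums, normalized by their Cauchy-Schwarz bound [Z], have level sets
    controlled with the exponent [1 + kappa] halfway between [1] and [p / 2], so the layer cake sum
    converges. *)
Lemma plane_bound (p : R) : 2 < p ->
  exists2 C : R, 0 < C & forall (L M : nat) (X : finType) (b1 b2 : int) (psi : X -> int)
      (a : 'I_L * 'I_L * X -> R[i]),
    let phi := @box_phase L X b1 b2 psi in
    (0 < L)%N -> (L ^ 2 <= M)%N -> (forall x x', `|phi x - phi x'| < M%:Z) ->
    \sum_(j < M) normc (grid_sum phi a M j) `^ p <=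
      C * (M%:R / L%:R ^+ 2) * (L%:R ^+ 2 * #|X|%:R * \sum_x normc (a x) ^+ 2) `^ (p / 2).
Proof.
move=> p2; pose kappa := (p / 2 - 1) / 2.
have k0 : 0 < kappa by rewrite /kappa; lra.
have ks : 1 + kappa < p / 2 by rewrite /kappa; lra.
have [C C0 HC] := @level_count R _ k0.
pose G : R := 2 `^ (1 + kappa) / (1 - 2 `^ (1 + kappa - p / 2)) + 1.
have G0 : 0 < G.
  rewrite ltr_wpDl // divr_ge0 ?powR_ge0 // subr_ge0 -[leRHS](powRr0 2) ler_powR ?ler1n //; lra.
exists (G * C) => [|L M X b1 b2 psi a phi L0 LM phiM]; first exact: mulr_gt0.
pose S := \sum_x normc (a x) ^+ 2; rewrite -/S.
have S_ge0 : 0 <= S by apply: sumr_ge0 => x _; exact: sqr_ge0.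
have L2 : 0 < L%:R ^+ 2 :> R by rewrite exprn_gt0 // ltr0n.
have M0 : (0 < M)%N by apply: leq_trans LM; rewrite expn_gt0 L0.
have p0 : 0 < p by lra.
have cardT : #|{: 'I_L * 'I_L * X}|%:R = L%:R ^+ 2 * #|X|%:R :> R.
  by rewrite !card_prod !card_ord !natrM expr2.
pose Z : R := L%:R ^+ 2 * #|X|%:R * S.
have fZ j : normc (grid_sum phi a M j) ^+ 2 <= Z.
  by rewrite /Z -cardT; exact: grid_sum_sqr_card.
have sqrp x : 0 <= x -> x `^ p = (x ^+ 2) `^ (p / 2).
  by move=> x0; rewrite -powR_mulrn // -powRrM mulrC divfK.
have Z0 : 0 <= Z by rewrite mulr_ge0 // mulr_ge0 // ltW.
have A0 : 0 < C * (M%:R / L%:R ^+ 2) by rewrite mulr_gt0 // divr_gt0 ?ltr0n.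
rewrite -/Z; have [Zz|Zn] := eqVneq Z 0.
  rewrite big1 => [|j _].
    by rewrite mulr_ge0 ?powR_ge0 // -mulrA mulr_ge0 ?(ltW G0) ?(ltW A0).
  have /eqP : normc (grid_sum phi a M j) ^+ 2 = 0.
    by apply/eqP; rewrite eq_le sqr_ge0 andbT -Zz fZ.
  by rewrite sqrf_eq0 => /eqP ->; rewrite powR0 // gt_eqF.
have Zp : 0 < Z by rewrite lt_neqAle eq_sym Zn.
have S0 : 0 < S.
  by rewrite lt_neqAle eq_sym S_ge0 andbT; apply: contra Zn => /eqP h; rewrite /Z h mulr0.
pose g (j : 'I_M) := normc (grid_sum phi a M j) ^+ 2 / Z.
have g01 j : 0 <= g j <= 1.
  by rewrite /g divr_ge0 ?sqr_ge0 //= ler_pdivrMr // mul1r fZ.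
have hg eta : 0 < eta <= 1 ->
    #|[set j | eta <= g j]%SET|%:R <= C * (M%:R / L%:R ^+ 2) * eta `^ (- (1 + kappa)).
  move=> he; have := HC L M X b1 b2 psi a eta L0 LM phiM S0 he; rewrite -/S -/Z.
  have -> : [set j | eta <= g j]%SET =
     [set j : 'I_M | eta * Z <= normc (grid_sum phi a M j) ^+ 2]%SET.
    by apply/setP => j; rewrite !inE /g ler_pdivlMr.
  exact.
have := layer_cake A0 (ltr_wpDr (ltW k0) ltr01) ks _ g01 hg.
move=> /(_ _)/(ler_wpM2l (powR_ge0 Z (p / 2))) h.
have {h} h := h ltac:(lra).
apply: (@le_trans _ _ (Z `^ (p / 2) * \sum_i g i `^ (p / 2))).
  rewrite mulr_sumr le_eqVlt; apply/orP; left; apply/eqP; apply: eq_bigr => j _.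
  rewrite sqrp ?normc_ge0 // -powRM ?(ltW Zp) //; last by have /andP[] := g01 j.
  by congr (_ `^ _); rewrite /g [RHS]mulrC divfK.
apply: le_trans h _; rewrite -/G le_eqVlt; apply/orP; left; apply/eqP; ring.
Qed.

Lemma grid_sum_reindex (T T' : finType) (h : T' -> T) (phi : T -> int) (a : T -> R[i]) (M j : nat) :
  bijective h -> grid_sum phi a M j = grid_sum (phi \o h) (a \o h) M j.
Proof. by move=> bh; rewrite /grid_sum (reindex h) //; exact: onW_bij. Qed.

Definition cube_phase (r L : nat) (c : 'I_r -> int) (n : {ffun 'I_r -> 'I_L}) : int :=
  \sum_i (c i + (n i)%:Z) ^+ 2.

Definition cube_split (s L : nat) (y : 'I_L * 'I_L * {ffun 'I_s -> 'I_L}) : {ffun 'I_s.+2 -> 'I_L} :=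
  [ffun i => if unlift ord0 i is Some i1 then
    (if unlift ord0 i1 is Some i2 then y.2 i2 else y.1.2) else y.1.1].

Lemma cube_split_bij (s L : nat) : bijective (@cube_split s L).
Proof.
exists (fun n : {ffun 'I_s.+2 -> 'I_L} =>
  (n ord0, n (lift ord0 ord0), [ffun i => n (lift ord0 (lift ord0 i))])).
  move=> [[n m] x] /=; rewrite /cube_split !ffunE unlift_none liftK unlift_none /=.
  congr (_, _, _); apply/ffunP => i; rewrite !ffunE !liftK //.
move=> n; apply/ffunP => i; rewrite ffunE.
case: unliftP => [i1 ->|-> //]; case: unliftP => [i2 ->|-> //].
by rewrite ffunE.
Qed.

Lemma cube_phase_split (s L : nat) (c : 'I_s.+2 -> int) (y : 'I_L * 'I_L * {ffun 'I_s -> 'I_L}) :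
  cube_phase c (cube_split y) =
  box_phase (c ord0) (c (lift ord0 ord0)) (cube_phase (fun i : 'I_s => c (lift ord0 (lift ord0 i)))) y.
Proof.
rewrite /cube_phase /box_phase !big_ord_recl /cube_split !ffunE unlift_none liftK unlift_none addrA.
by congr (_ + _); apply: eq_bigr => i _; rewrite ffunE !liftK.
Qed.

Lemma sqr_grid_sum (L : nat) (c : 'I_1 -> int) (a : {ffun 'I_1 -> 'I_L} -> R[i]) (M j : nat) :
  grid_sum (cube_phase c) a M j ^+ 2 =
  grid_sum (@box_phase L unit (c ord0) (c ord0) (fun=> 0))
    (fun y => a [ffun=> y.1.1] * a [ffun=> y.1.2]) M j.
Proof.
have bh : bijective (fun n : 'I_L => [ffun=> n] : {ffun 'I_1 -> 'I_L}).
  exists (fun n : {ffun 'I_1 -> 'I_L} => n ord0) => [n|n]; first by rewrite ffunE.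
  by apply/ffunP => i; rewrite ffunE; congr (n _); rewrite [RHS]ord1.
rewrite (grid_sum_reindex _ _ _ _ bh) /grid_sum expr2 mulr_suml.
transitivity (\sum_(n < L) \sum_(m < L) \sum_(x : unit)
   a [ffun=> n] * a [ffun=> m] *
   ee (j%:R * ((@box_phase L unit (c ord0) (c ord0) (fun=> 0) (n, m, x))%:~R / M%:R))).
  apply: eq_bigr => n _; rewrite mulr_sumr; apply: eq_bigr => m _.
  rewrite (big_pred1 tt) => [|[]//]; rewrite mulrACA -eeD /=.
  congr (_ * _ * ee _); rewrite /cube_phase /box_phase !big_ord1 !ffunE /= addr0 intrD; ring.
by rewrite pair_bigA pair_bigA; apply: eq_bigr => -[[n m] x].
Qed.

(** For [r = 1] the phases of the squared sum are sums of two phases, hence the factor [2] in the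
    hypothesis on [M]; the exponent [p / 2 > 2] comes from [4 / r < p]. *)
Lemma cube_bound (r : nat) (p : R) : (0 < r)%N -> 4 / r%:R < p -> 2 < p ->
  exists2 C : R, 0 < C & forall (L M : nat) (c : 'I_r -> int) (a : {ffun 'I_r -> 'I_L} -> R[i]),
    (0 < L)%N -> (L ^ 2 <= M)%N -> (forall x x' : {ffun 'I_r -> 'I_L},
      2 * `|cube_phase c x - cube_phase c x'| < M%:Z) ->
    \sum_(j < M) normc (grid_sum (cube_phase c) a M j) `^ p <=
      C * (M%:R / L%:R ^+ 2) * (L%:R ^+ r * \sum_x normc (a x) ^+ 2) `^ (p / 2).
Proof.
case: r => // -[|s] _ rp p2.
  have p4 : 2 < p / 2 by lra.
  have [C C0 HC] := plane_bound p4; exists C => // L M c a L0 LM phiM.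
  have LR : 0 <= L%:R :> R by [].
  set phi := @box_phase L unit (c ord0) (c ord0) (fun=> 0).
  have phiM' y y' : `|phi y - phi y'| < M%:Z.
    have := phiM [ffun=> y.1.1] [ffun=> y'.1.1]; have := phiM [ffun=> y.1.2] [ffun=> y'.1.2].
    rewrite /cube_phase /phi /box_phase !big_ord1 !ffunE; lia.
  have := HC L M unit (c ord0) (c ord0) (fun=> 0) (fun y => a [ffun=> y.1.1] * a [ffun=> y.1.2]) L0 LM phiM'.
  rewrite card_unit mulr1.
  have bh : bijective (fun n : 'I_L => [ffun=> n] : {ffun 'I_1 -> 'I_L}).
    exists (fun n : {ffun 'I_1 -> 'I_L} => n ord0) => [n|n]; first by rewrite ffunE.
    by apply/ffunP => i; rewrite ffunE; congr (n _); rewrite [RHS]ord1.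
  have -> : \sum_(y : 'I_L * 'I_L * unit) normc (a [ffun=> y.1.1] * a [ffun=> y.1.2]) ^+ 2 =
     (\sum_x normc (a x) ^+ 2) ^+ 2.
    rewrite (reindex _ (onW_bij _ bh)) expr2 mulr_suml.
    transitivity (\sum_(n < L) \sum_(m < L) \sum_(x : unit) normc (a [ffun=> n] * a [ffun=> m]) ^+ 2).
      by rewrite pair_bigA pair_bigA; apply: eq_bigr => -[[n m] x].
    apply: eq_bigr => n _; rewrite mulr_sumr; apply: eq_bigr => m _.
    by rewrite (big_pred1 tt) => [|[]//]; rewrite Normc.normcM exprMn.
  pose S := \sum_x normc (a x) ^+ 2; rewrite -/S.
  have S0 : 0 <= S by apply: sumr_ge0 => x _; exact: sqr_ge0.
  have sqrp x q : 0 <= x -> (x ^+ 2) `^ (q / 2) = x `^ q :> R.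
    by move=> x0; rewrite -powR_mulrn // -powRrM mulrC divfK.
  rewrite -exprMn sqrp ?mulr_ge0 // expr1 => /(le_trans _); apply.
  apply: ler_sum => j _.
  by rewrite /phi -sqr_grid_sum normc_exp sqrp ?normc_ge0.
have [C C0 HC] := plane_bound p2; exists C => // L M c a L0 LM phiM.
have bh := @cube_split_bij s L.
have -> : \sum_x normc (a x) ^+ 2 = \sum_y normc ((a \o @cube_split s L) y) ^+ 2.
  by rewrite (reindex _ (onW_bij _ bh)).
set c' := fun i : 'I_s => c (lift ord0 (lift ord0 i)).
have hM (x x' : 'I_L * 'I_L * {ffun 'I_s -> 'I_L}) : `|@box_phase L _ (c ord0) (c (lift ord0 ord0)) (cube_phase c') x -
    @box_phase L _ (c ord0) (c (lift ord0 ord0)) (cube_phase c') x'| < M%:Z.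
  have := phiM (cube_split x) (cube_split x'); rewrite !cube_phase_split -/c'.
  move: (box_phase _ _ _ x) (box_phase _ _ _ x') => u v; lia.
have := HC L M _ _ _ _ (a \o @cube_split s L) L0 LM hM.
rewrite card_ffun !card_ord natrX -exprD add2n; apply: le_trans.
apply: ler_sum => j _; rewrite (grid_sum_reindex _ _ _ _ bh) /grid_sum.
by under eq_bigr => x _ do rewrite /= cube_phase_split.
Qed.
End Cube.

(** * From the grid to the circle *)

Section Averaging.
Context {R : realType}.
Notation mu := (@lebesgue_measure R).

(** The integral over [[0, T]] is that of the sum of translates over [[0, h]]. In terms of a
    primitive [G], the sum [Phi] of its translates satisfies [Phi h - Phi 0 = G T - G 0] by
    telescoping, and the mean value theorem bounds this by [B h]. *)
Lemma integral_le_average (g : R -> R) (T B : R) (M : nat) :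
  continuous g -> 0 < T -> (0 < M)%N ->
  (forall t, \sum_(j < M) g (t + j%:R * (T / M%:R)) <= B) ->
  (\int[mu]_(x in `[0%R, T]) (g x)%:E <= (B * (T / M%:R))%:E)%E.
Proof.
move=> cg T0 M0 hB; set h := T / M%:R.
have MR : 0 < M%:R :> R by rewrite ltr0n.
have h0 : 0 < h by rewrite divr_gt0.
(* Integration starts at [-1] and runs up to [T + 1], so that [0] and [T] are interior points where
   [G] is differentiable. *)
pose G (x : R) : R := (\int[mu]_(t in `[(-1)%R, x]) g t)%R.
have gint : mu.-integrable `[(-1)%R, T + 1] (EFin \o g).
  apply: continuous_compact_integrable; first exact: segment_compact.
  exact: continuous_subspaceT.
have dG (x : R) : -1 < x -> x < T + 1 -> is_derive x 1 G (g x).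
  move=> x1 xT; have [d e] := continuous_FTC1_closed xT gint x1 (cg x).
  split; [exact: d | by rewrite -e derive1E].
have cG (x : R) : -1 < x -> x < T + 1 -> {for x, continuous G}.
  move=> x1 xT; apply: differentiable_continuous; apply/derivable1_diffP.
  by have [] := dG _ x1 xT.
have FTC : (\int[mu]_(x in `[0%R, T]) (g x)%:E = (G T)%:E - (G 0)%:E)%E.
  apply: continuous_FTC2 => //.
  - exact: continuous_subspaceT.
  - split.
    + move=> x; rewrite in_itv /= => /andP[x0 xT].
      by have [] : is_derive x 1 G (g x) by apply: dG; lra.
    + by apply: cvg_at_right_filter; apply: cG; lra.
    + by apply: cvg_at_left_filter; apply: cG; lra.
  - move=> x; rewrite in_itv /= => /andP[x0 xT].
    by rewrite derive1E; apply: derive_val; apply: dG; lra.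
rewrite FTC -EFinB lee_fin.
pose Phi (x : R) : R := \sum_(j < M) G (x + j%:R * h).
have Mh : M%:R * h = T by rewrite /h mulrC divfK // gt_eqF.
have rng (x : R) (j : 'I_M) : 0 <= x <= h -> -1 < x + j%:R * h < T + 1.
  move=> /andP[x0 xh].
  have : 0 <= j%:R * h by rewrite mulr_ge0 // ltW.
  have : (j.+1)%:R * h <= M%:R * h by rewrite ler_pM2r // ler_nat.
  rewrite Mh -natr1 mulrDl mul1r => h1 h2; apply/andP; split; lra.
have dPhi (x : R) : 0 <= x <= h -> is_derive x 1 Phi (\sum_(j < M) g (x + j%:R * h)).
  move=> hx.
  have -> : Phi = \sum_(j < M) (fun x => G (x + j%:R * h)).
    by apply/funext => y; rewrite fct_sumE.
  apply: is_derive_sum => j.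
  have /andP[r1 r2] := rng x j hx.
  have dj := dG _ r1 r2.
  have ds : is_derive x 1 (fun y : R => y + j%:R * h) 1.
    rewrite -[X in is_derive _ _ _ X]addr0.
    exact: is_deriveD.
  by rewrite -[g _]mulr1; exact: (@is_derive1_comp R G (fun y => y + j%:R * h) x).
have [c] : exists2 c, c \in `[0, h]%R & Phi h - Phi 0 = (\sum_(j < M) g (c + j%:R * h)) * (h - 0).
  apply: (@MVT_segment R Phi (fun c => \sum_(j < M) g (c + j%:R * h))).
  - exact: ltW.
  - by move=> x; rewrite in_itv /= => /andP[x0 xh]; apply: dPhi; rewrite !ltW.
  - apply: derivable_within_continuous => x; rewrite in_itv /= => hx.
    by have [] := dPhi x hx.
move=> _; rewrite subr0.
have -> : Phi h - Phi 0 = G T - G 0.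
  rewrite /Phi -sumrB.
  transitivity (\sum_(0 <= j < M) (G (j.+1%:R * h) - G (j%:R * h))).
    rewrite big_mkord; apply: eq_bigr => j _.
    by rewrite add0r -natr1; congr (G _ - _); ring.
  by rewrite (telescope_sumr (fun j => G (j%:R * h))) // mul0r Mh.
by move=> ->; rewrite ler_wpM2r // ltW.
Qed.

Lemma continuous_normr_powR (p : R) : 1 <= p -> continuous (fun x : R => `|x| `^ p).
Proof.
move=> p1 x.
have [->|x0] := eqVneq x 0.
  rewrite /continuous_at normr0 powR0; last by rewrite gt_eqF //; lra.
  apply/cvgrPdist_le => /= e e0; near=> y.
  rewrite sub0r normrN ger0_norm ?powR_ge0 //.
  have y1 : `|y| <= 1.
    by near: y; apply: (@nbhs0_le R R); exact: ltr01.
  have ye : `|y| <= e by near: y; apply: (@nbhs0_le R R).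
  have [->|y0] := eqVneq y 0; first by rewrite normr0 powR0 ?ltW // gt_eqF //; lra.
  by apply: le_trans ye; apply: ge1r_powR => //; rewrite normr_gt0 y0.
apply: (@continuous_comp R R R Num.norm (fun z => z `^ p)); first exact: norm_continuous.
have n0 : 0 < `|x| by rewrite normr_gt0.
apply: differentiable_continuous; apply/derivable1_diffP.
by apply: derivable_powR; rewrite in_itv /= n0.
Unshelve. all: by end_near.
Qed.
End Averaging.

Section Transfer.
Context {R : realType}.
Local Notation normc := (@Normc.normc R).
Local Notation mu := (@lebesgue_measure R).

Lemma continuous_normc_expsum (T : finType) (phi : T -> R) (a : T -> R[i]) :
  continuous (fun t : R => normc (\sum_x a x * expi (- (t * phi x)))).
Proof.
pose u t := \sum_x (complex.Re (a x) * cos (t * phi x) + complex.Im (a x) * sin (t * phi x)).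
pose v t := \sum_x (complex.Im (a x) * cos (t * phi x) - complex.Re (a x) * sin (t * phi x)).
have E t : \sum_x a x * expi (- (t * phi x)) = (u t +i* v t)%C.
  rewrite /u /v /expi; elim/big_rec3: _ => [//|x y z w _ ->].
  by rewrite cosN sinN; case: (a x) => p q; congr (_ +i* _)%C => /=; ring.
have -> : (fun t : R => normc (\sum_x a x * expi (- (t * phi x)))) =
    (fun t => Num.sqrt (u t ^+ 2 + v t ^+ 2)).
  by apply/funext => t; rewrite E.
have lin (x : T) : continuous (fun t : R => t * phi x).
  by move=> t; apply: cvgM; [exact: cvg_id|exact: cvg_cst].
have cc (x : T) : continuous (fun t : R => cos (t * phi x)).
  by move=> t; apply: (@continuous_comp R R R (fun t => t * phi x) cos);
    [exact: lin|exact: continuous_cos].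
have cs (x : T) : continuous (fun t : R => sin (t * phi x)).
  by move=> t; apply: (@continuous_comp R R R (fun t => t * phi x) sin);
    [exact: lin|exact: continuous_sin].
have cu : continuous u.
  apply: (@continuous_big R T +%R 0 predT (@add_continuous R)) => x _ t.
  by apply: cvgD; apply: cvgM; [exact: cvg_cst|exact: cc|exact: cvg_cst|exact: cs].
have cv : continuous v.
  apply: (@continuous_big R T +%R 0 predT (@add_continuous R)) => x _ t.
  by apply: cvgB; apply: cvgM; [exact: cvg_cst|exact: cc|exact: cvg_cst|exact: cs].
move=> t; apply: (@continuous_comp R R R (fun t => u t ^+ 2 + v t ^+ 2) Num.sqrt).
  by apply: cvgD; rewrite !expr2; apply: cvgM; first [exact: cu|exact: cv].
exact: sqrt_continuous.
Qed.

Lemma LpNorm02pi_le (p B : R) (f : R -> R[i]) (M : nat) : 1 <= p -> 0 <= B -> (0 < M)%N ->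
  continuous (fun t : R => normc (f t)) ->
  (forall t, \sum_(j < M) normc (f (t + j%:R * (2 * pi / M%:R))) `^ p <= B) ->
  (LpNorm02pi p f <= ((B * (2 * pi / M%:R)) `^ p^-1)%:E)%E.
Proof.
move=> p1 B0 M0 cf hB; have p0 : 0 < p by lra.
have MR : 0 < M%:R :> R by rewrite ltr0n.
have pi0 : 0 < 2 * pi :> R by rewrite mulr_gt0 // pi_gt0.
pose g (t : R) := normc (f t) `^ p.
have gE (t : R) : g t = `|normc (f t)| `^ p by rewrite /g ger0_norm // normc_ge0.
have cg : continuous g.
  have -> : g = (fun x : R => `|x| `^ p) \o (fun t => normc (f t)) by apply/funext => t /=.
  by move=> t; apply: continuous_comp; [exact: cf|exact: continuous_normr_powR].
have mg : measurable_fun [set: R] g by exact: continuous_measurable_fun.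
have I1 : (\int[@leb02pi R]_x (`|(normc (f x))%:E| `^ p) =
    \int[mu]_(x in `[0%R, (2 * pi)%R]) (g x)%:E)%E.
  under eq_integral => x _ do rewrite /= -gE.
  have mD : measurable (`[0, 2 * pi] : set (measurableTypeR R)) by exact: measurable_itv.
  rewrite (@ge0_negligible_integral _ (measurableTypeR R) R (@leb02pi R) setT (~` `[0, 2 * pi])) //; last 4 first.
  - exact: measurableC.
  - exact/measurable_EFinP.
  - by move=> x _; rewrite lee_fin powR_ge0.
  - by rewrite /leb02pi /= /mrestr setICl measure0.
  rewrite setDE setCK setTI; apply: eq_measure_integral => A mA AD.
  by rewrite /leb02pi /= /mrestr setIidl.
have I2 := integral_le_average cg pi0 M0 hB.
rewrite /LpNorm02pi unlock I1 -poweR_EFin; apply: gt0_ler_poweR => //.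
- by rewrite invr_ge0 ltW.
- rewrite in_itv /= leey andbT; apply: integral_ge0 => x _.
  by rewrite lee_fin powR_ge0.
- by rewrite in_itv /= leey andbT lee_fin mulr_ge0 // divr_ge0 // ltW.
Qed.

(** Conjugation reconciles the sign in [expsum] with that of [ee]; the translation by [t] goes into
    the coefficients without changing their moduli. *)
Lemma grid_sum_shift (T : finType) (phi : T -> int) (a : T -> R[i]) (t : R) (M j : nat) :
  normc (\sum_x a x * expi (- ((t + j%:R * (2 * pi / M%:R)) * (phi x)%:~R))) =
  normc (grid_sum phi (fun x => conjc (a x * expi (- (t * (phi x)%:~R)))) M j).
Proof.
rewrite -[LHS]normc_conjc conjc_sum; congr normc; apply: eq_bigr => x _.
rewrite mulrDl opprD expiD mulrA [LHS]conjcM; congr (conjc _ * _).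
by rewrite conjc_expi opprK /ee; congr expi; ring.
Qed.

Lemma fsum_image (V : nmodType) (T : finType) (K : choiceType) (h : T -> K) (D : set K) (F : K -> V) :
  injective h -> D `<=` range h ->
  \sum_(k \in D) F k = \sum_(x : T) (if `[< D (h x) >] then F (h x) else 0).
Proof.
move=> inj Dh.
pose F' k : V := if `[< D k >] then F k else 0.
transitivity (\sum_(k \in D) F' k).
  by apply: eq_fsbigr => k; rewrite inE => Dk; rewrite /F' asboolT.
rewrite (fsbig_widen _ (range h)) //; last first.
  by move=> k [_ nD] /=; rewrite /F' asboolF.
rewrite fsbig_image; last by move=> x y _ _; exact: inj.
rewrite -(_ : [set` index_enum T] = [set: T]); last first.
  by apply/seteqP; split => // x _ /=; rewrite mem_index_enum.
by rewrite -fsbig_seq // index_enum_uniq.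
Qed.

End Transfer.

Theorem lemma1p9 (R : realType) (r : nat) (hr : (1 <= r)%N)
    (p : R) (hp : Num.max (4 / r%:R) 2 < p) :
  exists2 C : R, 0 < C &
    forall (b : 'rV[R]_r) (N : R) (a : 'rV[int]_r -> R[i]),
      1 < N -> (l2norm a < +oo)%E ->
      (LpNorm02pi p (expsum a b N)
         <= (C * N `^ (r%:R / 2 - 2 / p))%:E * l2norm a)%E.
Proof.
have /andP[p4 p2] : (4 / r%:R < p) && (2 < p) by rewrite -gt_max.
have [C C0 HC] := cube_bound hr p4 p2.
have rR : 0 < r%:R :> R by rewrite ltr0n.
have p0 : 0 < p by lra.
set e := r%:R / 2 - 2 / p.
(* Positivity, which comes from [p > 4 / r], is what allows [L^e] to be replaced by [(2 N)^e] at the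
   end. *)
have e0 : 0 < e.
  rewrite /e subr_gt0 ltr_pdivrMr //; move: p4; rewrite ltr_pdivrMr //; lra.
have pi0 : 0 < pi :> R := pi_gt0 R.
have K0 : 0 < 2 * pi * C by rewrite !mulr_gt0.
exists ((2 * pi * C) `^ p^-1 * 2 `^ e) => [|b N a N1 _]; first by rewrite mulr_gt0 ?powR_gt0.
have N0 : 0 <= N by lra.
(* An interval of length [N] contains at most [L] integers, counted from the ceiling [c i] of its
   left end; [L <= 2 N] because [N > 1]. *)
pose L := (Num.truncn N).+1.
have /andP[LN NL] := truncn_itv N0.
have L2N : L%:R <= 2 * N by rewrite /L -natr1; lra.
have LR : 0 < L%:R :> R by rewrite ltr0n.
have {}NL : N < L%:R by [].
have L0 : (0 < L)%N by [].
clearbody L.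
pose c (i : 'I_r) : int := Num.ceil (b 0 i).
pose h (n : {ffun 'I_r -> 'I_L}) : 'rV[int]_r := \row_i (c i + (n i)%:Z).
have hinj : injective h.
  move=> n n' /rowP hn; apply/ffunP => i; have := hn i; rewrite !mxE => /addrI[hi].
  exact: val_inj.
have Jh : Jbox b N `<=` range h.
  move=> xi Jxi.
  have hi i : exists k : 'I_L, xi 0 i = c i + k%:Z.
    have /andP[h1 h2] := Jxi i.
    have cx : c i <= xi 0 i by rewrite /c ceil_le_int_tmp.
    have cb : b 0 i <= (c i)%:~R := ceil_ge _.
    have d0 : 0 <= xi 0 i - c i by rewrite subr_ge0.
    have kL : (absz (xi 0 i - c i)%R < L)%N.
      rewrite -(ltr_nat R); apply: le_lt_trans NL.
      by rewrite natr_absz ger0_norm // intrB; lra.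
    by exists (Ordinal kL); rewrite /= gez0_abs // subrKC.
  have [n hn] := choice hi.
  by exists [ffun i => n i] => //; apply/rowP => i; rewrite mxE ffunE -hn.
(* The cube of side [L] may exceed the box, so the coefficients are set to [0] outside of the
   box. *)
pose al n : R[i] := if `[< Jbox b N (h n) >] then a (h n) else 0.
pose phi : {ffun 'I_r -> 'I_L} -> int := cube_phase c.
have phiE n : normsq (h n) = phi n by apply: eq_bigr => i _; rewrite mxE.
have sumE t : expsum a b N t = \sum_n al n * expi (- (t * (phi n)%:~R)).
  rewrite /expsum (fsum_image _ hinj Jh); apply: eq_bigr => n _.
  by rewrite /al phiE; case: ifP; rewrite ?mul0r.
pose S := \sum_n Normc.normc (al n) ^+ 2.
have S0 : 0 <= S by apply: sumr_ge0 => n _; exact: sqr_ge0.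
have Sl2 : ((S `^ 2^-1)%:E <= l2norm a)%E.
  rewrite /l2norm -poweR_EFin; apply: gt0_ler_poweR; rewrite ?invr_ge0 ?in_itv /= ?leey ?andbT //.
    by apply: esum_ge0 => xi _; rewrite lee_fin sqr_ge0.
  apply: esum_ge; exists (Jbox b N); first by split => //; exact: finite_Jbox.
  rewrite (fsum_image _ hinj Jh) /S -sumEFin; apply: lee_sum => n _.
  by rewrite /al; case: ifP => // _; rewrite Normc.normc0 expr0n.
(* The sum over all pairs is a crude majorant of each difference. It depends on [b], but [M] cancels
   in [B * (2 pi / M)]. *)
pose M := (L ^ 2 + \sum_n \sum_n' 2 * absz (phi n - phi n')%R).+1.
have M0 : (0 < M)%N by [].
have LM : (L ^ 2 <= M)%N by rewrite /M -addnS leq_addr.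
have phiM n n' : 2 * `|phi n - phi n'| < M%:Z.
  have : (2 * absz (phi n - phi n')%R < M)%N.
    rewrite ltnS; apply: leq_trans (leq_addl _ _).
    by rewrite (bigD1 n) //= (bigD1 n') //= -addnA leq_addr.
  by rewrite -ltz_nat PoszM abszE.
clearbody M.
pose B := C * (M%:R / L%:R ^+ 2) * (L%:R ^+ r * S) `^ (p / 2).
have B0 : 0 <= B.
  by rewrite /B mulr_ge0 ?powR_ge0 // mulr_ge0 ?(ltW C0) // divr_ge0 ?exprn_ge0.
have cf : continuous (fun t : R => Normc.normc (expsum a b N t)).
  under eq_fun do rewrite sumE.
  exact: continuous_normc_expsum.
have hB t : \sum_(j < M) Normc.normc (expsum a b N (t + j%:R * (2 * pi / M%:R))) `^ p <= B.
  under eq_bigr => j _ do rewrite sumE grid_sum_shift.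
  apply: le_trans (HC L M c _ L0 LM phiM) _ => //.
  rewrite le_eqVlt; apply/orP; left; apply/eqP; congr (_ * (_ * _) `^ _).
  apply: eq_bigr => n _.
  by rewrite normc_conjc Normc.normcM normc_expi mulr1.
apply: le_trans (LpNorm02pi_le _ B0 M0 cf hB) _; first by lra.
have -> : (B * (2 * pi / M%:R)) `^ p^-1 = (2 * pi * C) `^ p^-1 * L%:R `^ e * S `^ 2^-1.
  have -> : B * (2 * pi / M%:R) = 2 * pi * C * L%:R ^- 2 * (L%:R ^+ r * S) `^ (p / 2).
    by rewrite /B; field; rewrite !gt_eqF ?ltr0n.
  rewrite powRM ?powR_ge0 ?mulr_ge0 ?invr_ge0 ?exprn_ge0 ?(ltW C0) ?(ltW pi0) //.
  rewrite powRM ?mulr_ge0 ?invr_ge0 ?exprn_ge0 ?(ltW C0) ?(ltW pi0) //.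
  have pe : p / 2 * p^-1 = 2^-1 by field; rewrite gt_eqF.
  rewrite -[(_ `^ (p / 2)) `^ _]powRrM pe.
  have -> : L%:R `^ e = (L%:R ^- 2) `^ p^-1 * (L%:R ^+ r) `^ 2^-1.
    rewrite -powR_invn ?(ltW LR) // -[L%:R ^+ r]powR_mulrn ?(ltW LR) // -!powRrM -gt0_powRD //.
    by congr (_ `^ _); rewrite /e; ring.
  by rewrite [(_ * S) `^ _]powRM ?exprn_ge0 //; ring.
rewrite EFinM; apply: lee_pmul => //.
- by rewrite lee_fin mulr_ge0 ?powR_ge0.
- by rewrite lee_fin powR_ge0.
rewrite lee_fin -[leRHS]mulrA ler_wpM2l ?powR_ge0 // -powRM //.
by apply: ge0_ler_powR; rewrite ?nnegrE ?mulr_ge0 ?(ltW e0).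
Qed.
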